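(* Let $\partial_0,\partial_0'\in T$ and $\gamma\in\mathbb{Z}^n$ with $\partial_0(\gamma)\in\mathbb{Z}\setminus\{0\}$, and choose the two distinguished elements $h:=\partial_0(\gamma)^{-1}\partial_0$ and $e:=\partial_0(\gamma)x^{\gamma}\partial_0'$ in the generalized-Witt algebra $\mathbf{W}$ over $\mathbb{F}$, with $[h,e]=e$. Then there exists a structure of noncommutative and noncocommutative Hopf algebra $(U(\mathbf{W})[[t]],m,\iota,\Delta,S,\varepsilon)$ on $U(\mathbf{W})[[t]]$ over $\mathbb{F}[[t]]$, with $U(\mathbf{W})[[t]]/tU(\mathbf{W})[[t]]\cong U(\mathbf{W})$, which leaves the product of $U(\mathbf{W})[[t]]$ undeformed but with the deformed coproduct, antipode and counit defined, for $\alpha\in\mathbb{Z}^n$ and $\partial\in T$, by $$\Delta(x^{\alpha}\partial)=x^{\alpha}\partial\otimes(1-et)^{\frac{\partial_0(\alpha)}{\partial_0(\gamma)}}+\sum_{\ell=0}^{\infty}(-1)^\ell h^{\langle \ell\rangle}\otimes(1-et)^{-\ell}\cdot x^{\alpha+\ell\gamma}(A_\ell\partial-B_\ell\partial_0')t^\ell,$$ $$S(x^{\alpha}\partial)=-(1-et)^{-\frac{\partial_0(\alpha)}{\partial_0(\gamma)}}\cdot\Bigl(\sum_{\ell=0}^{\infty}x^{\alpha+\ell\gamma}(A_\ell\partial-B_\ell\partial_0')\cdot h_1^{\langle \ell\rangle}t^\ell\Bigr),$$ $$\varepsilon(x^{\alpha}\partial)=0,$$ where $A_\ell=\frac{\partial_0(\gamma)^\ell}{\ell!}\prod_{j=0}^{\ell-1}\partial_0'(\alpha+j\gamma)$,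 $B_\ell=\partial_0(\gamma)\partial(\gamma)A_{\ell-1}$ for $\ell\ge1$, and $A_0=1$, $B_0=0$.
   Context: $\mathbb{F}$ is a field of characteristic $0$ and $n>0$. $T=\bigoplus_{i=1}^n\mathbb{Z}\partial_i$, where $\partial_i=x_i\frac{\partial}{\partial x_i}$. The generalized-Witt algebra is $\mathbf{W}=\mathbb{F}[x_1^{\pm1},\dots,x_n^{\pm1}]\otimes_{\mathbb{Z}}T=\mathrm{Span}_{\mathbb{F}}\{x^\alpha\partial\mid\alpha\in\mathbb{Z}^n,\partial\in T\}$, where $x^\alpha\partial:=x^\alpha\otimes\partial$, with bracket $[x^\alpha\partial,x^\beta\partial']=x^{\alpha+\beta}(\partial(\beta)\partial'-\partial'(\alpha)\partial)$, where $\partial(\beta)=\sum_i a_i\beta_i$ for $\partial=\sum_i a_i\partial_i\in T$ and $\beta=(\beta_1,\dots,\beta_n)\in\mathbb{Z}^n$. $U(\mathbf{W})[[t]]$ is the topologically free $\mathbb{F}[[t]]$-algebra of formal power series with coefficients in the universal enveloping algebra $U(\mathbf{W})$ (tensor products are $t$-adically completed). For an element $x$ of a unital algebra and a scalar $a$, $x_a^{\langle \ell\rangle}:=(x+a)(x+a+1)\cdots(x+a+\ell-1)$, $x_a^{\langle 0\rangle}=1$, and $x^{\langle \ell\rangle}:=x_0^{\langle \ell\rangle}$. For a scalar $c$, $(1-et)^c$ denotes the binomial power series.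
   Formalization: Noncocommutativity is asserted only when e ≠ 0 (equivalently ∂₀' ≠ 0): for ∂₀' = 0 the formulas give the standard cocommutative coproduct, so that part of the claim fails; all other parts are stated for every ∂₀'. *)

(* Defs.v *)
From HB Require Import structures.
From mathcomp Require Import all_boot all_algebra finmap.
From mathcomp Require Import boolp.
From mathcomp.multinomials Require Import monalg.

Set Implicit Arguments.
Unset Strict Implicit.
Unset Printing Implicit Defensive.

Import GRing.Theory.
Local Open Scope ring_scope.
Local Open Scope quotient_scope.

(** * Quotients *)

Section Span.
Variables (R : nzRingType) (V : lmodType R) (G : V -> Prop).

Inductive span : V -> Prop :=
| span0 : span 0
| spanD (c : R) (x y : V) : G x -> span y -> span (c *: x + y).

Lemma span_gen x : G x -> span x.
Proof. by move=> Gx; rewrite -[x]addr0 -[x]scale1r; apply: spanD => //; exact: span0. Qed.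

Lemma span_add x y : span x -> span y -> span (x + y).
Proof.
elim=> [|c {}x z Gx _ IH] Sy; first by rewrite add0r.
by rewrite -addrA; apply: spanD => //; apply: IH.
Qed.

Lemma span_scale c x : span x -> span (c *: x).
Proof.
elim=> [|d {}x z Gx _ IH]; first by rewrite scaler0; exact: span0.
by rewrite scalerDr scalerA; apply: spanD.
Qed.

Lemma span_opp x : span x -> span (- x).
Proof. by move=> Sx; rewrite -scaleN1r; apply: span_scale. Qed.

Definition span_rel (x y : V) : bool := `[< span (x - y) >].

Lemma span_rel_equiv : equiv_class_of span_rel.
Proof.
split=> [x|x y|y x z].
- by apply/asboolP; rewrite subrr; exact: span0.
- by apply/asboolP/asboolP => H; rewrite -opprB; apply: span_opp.
- move=> /asboolP H1 /asboolP H2; apply/asboolP.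
  by rewrite -(subrKA y); apply: span_add.
Qed.

Canonical span_equiv := EquivRelPack span_rel_equiv.

(* The quotient of [V] by the submodule spanned by [G]. *)
Definition qmod := {eq_quot span_equiv}.

HB.instance Definition _ : EqQuotient V span_rel qmod := EqQuotient.on qmod.
HB.instance Definition _ := Choice.on qmod.

Lemma qmodW (P : qmod -> Prop) : (forall x, P (\pi_qmod x)) -> forall x, P x.
Proof. exact: quotW. Qed.

Lemma qmodP (x y : V) : reflect (span (x - y)) (\pi_qmod x == \pi_qmod y).
Proof. by rewrite eqmodE; exact: asboolP. Qed.

Lemma qmod_eq (x y : V) : span (x - y) -> \pi_qmod x = \pi_qmod y.
Proof. by move=> H; apply/eqP/qmodP. Qed.

Lemma qmod_repr (x : V) : span (repr (\pi_qmod x) - x).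
Proof. by apply/qmodP; rewrite reprK. Qed.

End Span.

HB.lock Definition qmod_zero (R : nzRingType) (V : lmodType R) (G : V -> Prop)
  : qmod G := \pi_(qmod G) 0.
HB.lock Definition qmod_add (R : nzRingType) (V : lmodType R) (G : V -> Prop)
  (x y : qmod G) : qmod G := \pi_(qmod G) (repr x + repr y).
HB.lock Definition qmod_opp (R : nzRingType) (V : lmodType R) (G : V -> Prop)
  (x : qmod G) : qmod G := \pi_(qmod G) (- repr x).
HB.lock Definition qmod_scale (R : nzRingType) (V : lmodType R) (G : V -> Prop)
  (c : R) (x : qmod G) : qmod G := \pi_(qmod G) (c *: repr x).

Section QuotientModule.
Variables (R : nzRingType) (V : lmodType R) (G : V -> Prop).
Local Notation qmod := (qmod G).
Local Notation qmod_zero := (@qmod_zero _ _ G).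
Local Notation qmod_add := (@qmod_add _ _ G).
Local Notation qmod_opp := (@qmod_opp _ _ G).
Local Notation qmod_scale := (@qmod_scale _ _ G).

Lemma qmod_addE x y : qmod_add (\pi_qmod x) (\pi_qmod y) = \pi_qmod (x + y).
Proof.
by rewrite unlock; apply: qmod_eq; rewrite opprD addrACA; apply: span_add; apply: qmod_repr.
Qed.

Lemma qmod_oppE x : qmod_opp (\pi_qmod x) = \pi_qmod (- x).
Proof. by rewrite unlock; apply: qmod_eq; rewrite -opprD; apply: span_opp; apply: qmod_repr. Qed.

Lemma qmod_scaleE c x : qmod_scale c (\pi_qmod x) = \pi_qmod (c *: x).
Proof. by rewrite unlock; apply: qmod_eq; rewrite -scalerBr; apply: span_scale; apply: qmod_repr. Qed.

Lemma qmod_addA : associative qmod_add.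
Proof. by elim/qmodW=> x; elim/qmodW=> y; elim/qmodW=> z; rewrite !qmod_addE addrA. Qed.
Lemma qmod_addC : commutative qmod_add.
Proof. by elim/qmodW=> x; elim/qmodW=> y; rewrite !qmod_addE addrC. Qed.
Lemma qmod_add0 : left_id qmod_zero qmod_add.
Proof. by rewrite qmod_zero.unlock; elim/qmodW=> x; rewrite !qmod_addE add0r. Qed.
Lemma qmod_addN : left_inverse qmod_zero qmod_opp qmod_add.
Proof. by elim/qmodW=> x; rewrite qmod_oppE qmod_addE addNr qmod_zero.unlock. Qed.

HB.instance Definition _ := GRing.isZmodule.Build qmod
  qmod_addA qmod_addC qmod_add0 qmod_addN.

Lemma qmod_scaleA a b x : qmod_scale a (qmod_scale b x) = qmod_scale (a * b) x.
Proof. by elim/qmodW: x => x; rewrite !qmod_scaleE scalerA. Qed.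
Lemma qmod_scale1 : left_id 1 qmod_scale.
Proof. by elim/qmodW=> x; rewrite !qmod_scaleE scale1r. Qed.
Lemma qmod_scaleDr : right_distributive qmod_scale +%R.
Proof.
move=> c; elim/qmodW=> x; elim/qmodW=> y.
by rewrite [_ + _]qmod_addE !qmod_scaleE scalerDr -qmod_addE.
Qed.
Lemma qmod_scaleDl x : {morph qmod_scale^~ x : a b / a + b}.
Proof. by elim/qmodW: x => x a b; rewrite !qmod_scaleE scalerDl -qmod_addE. Qed.

HB.instance Definition _ := GRing.Zmodule_isLmodule.Build R qmod
  qmod_scaleA qmod_scale1 qmod_scaleDr qmod_scaleDl.

Lemma qmod_piD x y : \pi_qmod (x + y) = \pi_qmod x + \pi_qmod y.
Proof. by rewrite -qmod_addE. Qed.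
Lemma qmod_piN x : \pi_qmod (- x) = - \pi_qmod x.
Proof. by rewrite -qmod_oppE. Qed.
Lemma qmod_piZ c x : \pi_qmod (c *: x) = c *: \pi_qmod x.
Proof. by rewrite -qmod_scaleE. Qed.

Lemma qmod_pi0 : \pi_qmod 0 = 0.
Proof. by rewrite -[RHS]/qmod_zero qmod_zero.unlock. Qed.

Lemma qmod_pi_gen x : G x -> \pi_qmod x = 0.
Proof.
by move=> Gx; rewrite -qmod_pi0; apply: qmod_eq; rewrite subr0; apply: span_gen.
Qed.

End QuotientModule.

Section QuotientAlgebra.
Variables (R : comNzRingType) (A : algType R) (G : A -> Prop).

Definition two_sided (z : A) : Prop := exists a r b, G r /\ z = a * r * b.

(* The quotient of [A] by the two-sided ideal generated by [G]. *)
Definition qalg := qmod two_sided.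

HB.instance Definition _ := GRing.Lmodule.on qalg.
HB.instance Definition _ : EqQuotient A (span_rel two_sided) qalg := EqQuotient.on qalg.

Lemma ideal_mull a x : span two_sided x -> span two_sided (a * x).
Proof.
elim=> [|c {}x z [b [r [d [Gr ->]]]] _ IH]; first by rewrite mulr0; exact: span0.
rewrite mulrDr -scalerAr; apply: spanD => //.
by exists (a * b), r, d; rewrite !mulrA.
Qed.

Lemma ideal_mulr a x : span two_sided x -> span two_sided (x * a).
Proof.
elim=> [|c {}x z [b [r [d [Gr ->]]]] _ IH]; first by rewrite mul0r; exact: span0.
rewrite mulrDl -scalerAl; apply: spanD => //.
by exists b, r, (d * a); rewrite !mulrA.
Qed.

Lemma qalgW (P : qalg -> Prop) : (forall x, P (\pi_qalg x)) -> forall x, P x.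
Proof. exact: quotW. Qed.

End QuotientAlgebra.

HB.lock Definition qalg_one (R : comNzRingType) (A : algType R) (G : A -> Prop)
  : qalg G := \pi_(qalg G) 1.
HB.lock Definition qalg_mul (R : comNzRingType) (A : algType R) (G : A -> Prop)
  (x y : qalg G) : qalg G := \pi_(qalg G) (repr x * repr y).

Section QuotientAlgebraTheory.
Variables (R : comNzRingType) (A : algType R) (G : A -> Prop).
Local Notation qalg := (qalg G).
Local Notation qalg_one := (@qalg_one _ _ G).
Local Notation qalg_mul := (@qalg_mul _ _ G).

Lemma qalg_mulE (x y : A) : qalg_mul (\pi_qalg x) (\pi_qalg y) = \pi_qalg (x * y).
Proof.
rewrite unlock; apply: qmod_eq; set x' := repr _; set y' := repr _.
have -> : x' * y' - x * y = (x' - x) * y' + x * (y' - y).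
  by rewrite mulrBl mulrBr addrA subrK.
apply: span_add; first by apply: ideal_mulr; apply: qmod_repr.
by apply: ideal_mull; apply: qmod_repr.
Qed.

Lemma qalg_mulA : associative qalg_mul.
Proof. by elim/qalgW=> x; elim/qalgW=> y; elim/qalgW=> z; rewrite !qalg_mulE mulrA. Qed.
Lemma qalg_mul1 : left_id qalg_one qalg_mul.
Proof. by elim/qalgW=> x; rewrite qalg_one.unlock qalg_mulE mul1r. Qed.
Lemma qalg_1mul : right_id qalg_one qalg_mul.
Proof. by elim/qalgW=> x; rewrite qalg_one.unlock qalg_mulE mulr1. Qed.
Lemma qalg_mulDl : left_distributive qalg_mul +%R.
Proof.
elim/qalgW=> x; elim/qalgW=> y; elim/qalgW=> z.
by rewrite -qmod_piD !qalg_mulE mulrDl qmod_piD.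
Qed.
Lemma qalg_mulDr : right_distributive qalg_mul +%R.
Proof.
elim/qalgW=> x; elim/qalgW=> y; elim/qalgW=> z.
by rewrite -qmod_piD !qalg_mulE mulrDr qmod_piD.
Qed.

HB.instance Definition _ := GRing.Zmodule_isPzRing.Build qalg
  qalg_mulA qalg_mul1 qalg_1mul qalg_mulDl qalg_mulDr.

Lemma qalg_pi1 : \pi_qalg 1 = 1.
Proof. by rewrite -[RHS]/qalg_one qalg_one.unlock. Qed.

Lemma qalg_piM x y : \pi_qalg (x * y) = \pi_qalg x * \pi_qalg y.
Proof. by rewrite -qalg_mulE. Qed.

Lemma qalg_scaleAl c (x y : qalg) : c *: (x * y) = (c *: x) * y.
Proof.
move: x y; refine (@qalgW _ _ _ _ _) => x; refine (@qalgW _ _ _ _ _) => y.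
by rewrite -(qalg_piM x y) -!qmod_piZ -qalg_piM scalerAl.
Qed.
Lemma qalg_scaleAr c (x y : qalg) : c *: (x * y) = x * (c *: y).
Proof.
move: x y; refine (@qalgW _ _ _ _ _) => x; refine (@qalgW _ _ _ _ _) => y.
by rewrite -(qalg_piM x y) -!qmod_piZ -qalg_piM scalerAr.
Qed.

End QuotientAlgebraTheory.

(** * Formal power series in a central variable [t] *)

Definition fps (V : Type) := nat -> V.

HB.instance Definition _ (V : Type) := gen_eqMixin (fps V).
HB.instance Definition _ (V : Type) := gen_choiceMixin (fps V).

Section FpsZmodule.
Variable V : zmodType.
Implicit Types u v w : fps V.

Definition fps_zero : fps V := fun=> 0.
Definition fps_add u v : fps V := fun k => u k + v k.
Definition fps_opp u : fps V := fun k => - u k.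

Fact fps_addA : associative fps_add.
Proof. by move=> u v w; apply/funext=> k; apply: addrA. Qed.
Fact fps_addC : commutative fps_add.
Proof. by move=> u v; apply/funext=> k; apply: addrC. Qed.
Fact fps_add0 : left_id fps_zero fps_add.
Proof. by move=> u; apply/funext=> k; apply: add0r. Qed.
Fact fps_addN : left_inverse fps_zero fps_opp fps_add.
Proof. by move=> u; apply/funext=> k; apply: addNr. Qed.

HB.instance Definition _ := GRing.isZmodule.Build (fps V)
  fps_addA fps_addC fps_add0 fps_addN.

Lemma fps0E k : (0 : fps V) k = 0. Proof. by []. Qed.
Lemma fpsDE u v k : (u + v) k = u k + v k. Proof. by []. Qed.
Lemma fpsNE u k : (- u) k = - u k. Proof. by []. Qed.

Definition fps_const (a : V) : fps V := fun k => if k == 0%N then a else 0.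

(* The t-adically convergent series sum_l a_l t^l with a_l in V[[t]]. *)
Definition tsum (a : nat -> fps V) : fps V :=
  fun k => \sum_(l < k.+1) a l (k - l)%N.

End FpsZmodule.

(* Extension of a bilinear operation to power series:
   (sum_i f_i t^i, sum_j g_j t^j) |-> sum_(i, j) op f_i g_j t^(i + j). *)
HB.lock Definition cauchy (V W : Type) (X : zmodType) (op : V -> W -> X)
    (f : fps V) (g : fps W) : fps X :=
  fun k => \sum_(i < k.+1) op (f i) (g (k - i)%N).

Section Cauchy.

Lemma triangle_sum (X : zmodType) (T : nat -> nat -> nat -> X) k :
  \sum_(i < k.+1) \sum_(j < i.+1) T j (i - j)%N (k - i)%N =
  \sum_(j < k.+1) \sum_(l < (k - j).+1) T j l (k - j - l)%N.
Proof.
rewrite -(big_mkord xpredT (fun i => \sum_(j < i.+1) T j (i - j)%N (k - i)%N)).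
rewrite -(big_mkord xpredT (fun j => \sum_(l < (k - j).+1) T j l (k - j - l)%N)).
have E i : (0 <= i < k.+1)%N ->
    \sum_(j < i.+1) T j (i - j)%N (k - i)%N =
    \sum_(0 <= j < k.+1 | (j < i.+1)%N) T j (i - j)%N (k - i)%N.
  move=> /andP[_ lik].
  by rewrite -(big_nat_widen 0 i.+1 k.+1 xpredT) // big_mkord.
rewrite (eq_big_nat _ _ E) (exchange_big_dep_nat xpredT) //=.
apply: eq_big_nat => j /andP[_ ljk].
rewrite -(big_mkord xpredT (fun l => T j l (k - j - l)%N)) -subSn //.
rewrite (_ : \sum_(0 <= i < k.+1 | (j < i.+1)%N) _ =
             \sum_(j <= i < k.+1) T j (i - j)%N (k - i)%N); last first.
  by rewrite (big_cat_nat _ (n := j)) //= ?(ltnW ljk) // big_nat_cond big1 ?add0r;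
   [apply: congr_big_nat => // i /andP[]
   |move=> i /andP[/andP[_ lij]]; rewrite ltnS leqNgt lij].
rewrite -{1}[j]add0n big_addn; apply: eq_bigr => l _.
by rewrite addnK addnC subnDA.
Qed.

Lemma cauchyA (V W X Y Z P : zmodType) (op1 : V -> W -> X) (op2 : X -> Y -> Z)
    (op3 : W -> Y -> P) (op4 : V -> P -> Z) :
    (forall y, op2 0 y = 0) -> (forall y, {morph op2^~ y : a b / a + b}) ->
    (forall v, op4 v 0 = 0) -> (forall v, {morph op4 v : a b / a + b}) ->
    (forall v w y, op2 (op1 v w) y = op4 v (op3 w y)) ->
  forall f g h,
    cauchy op2 (cauchy op1 f g) h = cauchy op4 f (cauchy op3 g h).
Proof.
move=> op20 op2D op40 op4D opA f g h; apply/funext=> k; rewrite cauchy.unlock.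
pose T a b c := op4 (f a) (op3 (g b) (h c)).
transitivity (\sum_(i < k.+1) \sum_(j < i.+1) T j (i - j)%N (k - i)%N).
  apply: eq_bigr => i _; rewrite (big_morph (op2^~ _) (op2D _) (op20 _)).
  by apply: eq_bigr => j _; rewrite opA.
rewrite (triangle_sum T); apply: eq_bigr => j _.
by rewrite (big_morph (op4 _) (op4D _) (op40 _)).
Qed.

Lemma cauchyDl (V W X : zmodType) (op : V -> W -> X) :
    (forall w, {morph op^~ w : a b / a + b}) ->
  forall f g h, cauchy op (f + g) h = cauchy op f h + cauchy op g h.
Proof.
move=> opD f g h; apply/funext=> k; rewrite fpsDE cauchy.unlock -big_split.
by apply: eq_bigr => i _; apply: opD.
Qed.

Lemma cauchyDr (V W X : zmodType) (op : V -> W -> X) :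
    (forall v, {morph op v : a b / a + b}) ->
  forall f g h, cauchy op f (g + h) = cauchy op f g + cauchy op f h.
Proof.
move=> opD f g h; apply/funext=> k; rewrite fpsDE cauchy.unlock -big_split.
by apply: eq_bigr => i _; apply: opD.
Qed.

Lemma cauchy_constl (V W X : zmodType) (op : V -> W -> X) a f :
  (forall w, op 0 w = 0) -> cauchy op (fps_const a) f = op a \o f.
Proof.
move=> op0; apply/funext=> k; rewrite cauchy.unlock big_ord_recl big1 => [|i _].
  by rewrite addr0 subn0.
by rewrite /fps_const op0.
Qed.

Lemma cauchy_constr (V W X : zmodType) (op : V -> W -> X) a f :
  (forall v, op v 0 = 0) -> cauchy op f (fps_const a) = op^~ a \o f.
Proof.
move=> op0; apply/funext=> k; rewrite cauchy.unlock big_ord_recr big1 => [|i _].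
  by rewrite /= add0r subnn.
have /negbTE E : (k - i != 0)%N by rewrite -lt0n subn_gt0.
by rewrite /fps_const /= E op0.
Qed.

End Cauchy.

Section FpsRing.
Variable A : pzRingType.

Definition fps_one : fps A := fps_const 1.
Definition fps_mul : fps A -> fps A -> fps A := cauchy *%R.

Fact fps_mulA : associative fps_mul.
Proof.
move=> f g h; apply/esym/cauchyA => [y|y a b|y|y a b|a b c] /=.
- exact: mul0r. - exact: mulrDl. - exact: mulr0. - exact: mulrDr.
- by rewrite mulrA.
Qed.
Fact fps_mul1 : left_id fps_one fps_mul.
Proof.
move=> f; rewrite /fps_mul cauchy_constl; last exact: mul0r.
by apply/funext=> k; rewrite /= mul1r.
Qed.
Fact fps_1mul : right_id fps_one fps_mul.
Proof.
move=> f; rewrite /fps_mul cauchy_constr; last exact: mulr0.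
by apply/funext=> k; rewrite /= mulr1.
Qed.
Fact fps_mulDl : left_distributive fps_mul +%R.
Proof. by move=> f g h; apply: cauchyDl => w a b; apply: mulrDl. Qed.
Fact fps_mulDr : right_distributive fps_mul +%R.
Proof. by move=> f g h; apply: cauchyDr => w a b; apply: mulrDr. Qed.

HB.instance Definition _ := GRing.Zmodule_isPzRing.Build (fps A)
  fps_mulA fps_mul1 fps_1mul fps_mulDl fps_mulDr.

Lemma fpsME (f g : fps A) k : (f * g) k = \sum_(i < k.+1) f i * g (k - i)%N.
Proof. by rewrite -[f * g]/(cauchy _ _ _) unlock. Qed.

End FpsRing.

Fact fps_oner_neq0 (A : nzRingType) : (1 : fps A) != 0.
Proof.
apply/eqP => E; have /eqP : (1 : A) = 0 by exact: (congr1 (@^~ 0%N) E).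
by rewrite oner_eq0.
Qed.

HB.instance Definition _ (A : nzRingType) :=
  GRing.PzSemiRing_isNonZero.Build (fps A) (@fps_oner_neq0 A).

Fact fps_mulC (A : comPzRingType) : commutative (@fps_mul A).
Proof.
move=> f g; apply/funext=> k; rewrite /fps_mul unlock (reindex_inj rev_ord_inj).
apply: eq_bigr => i _; have le_ik : (i <= k)%N by rewrite -ltnS.
by rewrite [val _]/= subSS subKn // [LHS]mulrC.
Qed.

HB.instance Definition _ (A : comPzRingType) :=
  GRing.PzSemiRing_hasCommutativeMul.Build (fps A) (@fps_mulC A).

HB.instance Definition _ (A : comNzRingType) := GRing.ComPzRing.on (fps A).

Section FpsLmodule.
Variables (R : comNzRingType) (V : lmodType R).

Definition fps_scale : fps R -> fps V -> fps V := cauchy *:%R.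

Fact fps_scaleA a b v : fps_scale a (fps_scale b v) = fps_scale (a * b) v.
Proof.
apply/esym/cauchyA => [y|y c d|y|y c d|c d y].
- exact: scale0r. - exact: scalerDl. - exact: scaler0. - exact: scalerDr.
- by rewrite scalerA.
Qed.
Fact fps_scale1 : left_id 1 fps_scale.
Proof.
move=> f; rewrite /fps_scale cauchy_constl; last exact: scale0r.
by apply/funext=> k; rewrite /= scale1r.
Qed.
Fact fps_scaleDr : right_distributive fps_scale +%R.
Proof. by move=> f g h; apply: cauchyDr => w a b; apply: scalerDr. Qed.
Fact fps_scaleDl v : {morph fps_scale^~ v : a b / a + b}.
Proof. by move=> f g; apply: cauchyDl => w a b; apply: scalerDl. Qed.

HB.instance Definition _ := GRing.Zmodule_isLmodule.Build (fps R) (fps V)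
  fps_scaleA fps_scale1 fps_scaleDr fps_scaleDl.

Lemma fpsZE (c : fps R) (v : fps V) k :
  (c *: v) k = \sum_(i < k.+1) c i *: v (k - i)%N.
Proof. by rewrite -[c *: v]/(cauchy _ _ _) unlock. Qed.

End FpsLmodule.

Section FpsAlgebra.
Variables (R : comNzRingType) (A : algType R).

Fact fps_scalerAl (c : fps R) (f g : fps A) : c *: (f * g) = (c *: f) * g.
Proof.
apply/esym/cauchyA => [y|y a b|y|y a b|a b y].
- exact: mul0r. - exact: mulrDl. - exact: scaler0. - exact: scalerDr.
- by rewrite scalerAl.
Qed.

Fact fps_scalerAr (c : fps R) (f g : fps A) : c *: (f * g) = f * (c *: g).
Proof.
have E a h : a *: h = cauchy (fun (x : A) (r : R) => r *: x) h a.
  apply/funext=> k; rewrite -[a *: h]/(cauchy _ _ _) cauchy.unlock.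
  rewrite (reindex_inj rev_ord_inj).
  apply: eq_bigr => i _; have le_ik : (i <= k)%N by rewrite -ltnS.
  by rewrite [val _]/= subSS subKn.
rewrite !E; apply: cauchyA => [y|y a b|y|y a b|a b y] /=.
- exact: scaler0. - exact: scalerDr. - exact: mulr0. - exact: mulrDr.
- by rewrite scalerAr.
Qed.

HB.instance Definition _ :=
  GRing.LSemiModule_isLSemiAlgebra.Build (fps R) (fps A) fps_scalerAl.
HB.instance Definition _ :=
  GRing.LSemiAlgebra_isSemiAlgebra.Build (fps R) (fps A) fps_scalerAr.

End FpsAlgebra.

(* The variable t of R[[t]]. *)
Definition fps_t (R : pzRingType) : fps R := fun k => if k == 1%N then 1 else 0.
Arguments fps_t {R}.

(** * Tensor products *)

(* Linear extension of [f] to the free module on [K]. *)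
HB.lock Definition malg_lift (R : nzRingType) (K : choiceType) (X : lmodType R)
    (f : K -> X) (p : {malg R[K]}) : X :=
  \sum_(k <- msupp p) p@_k *: f k.

Section MalgLift.
Variables (R : nzRingType) (K : choiceType) (X : lmodType R) (f : K -> X).

Lemma malg_liftEw (d : {fset K}) p : {subset msupp p <= d} ->
  malg_lift f p = \sum_(k <- d) p@_k *: f k.
Proof.
move=> le; rewrite unlock; apply: big_fset_incl; first exact/fsubsetP.
by move=> x _ /mcoeff_outdom ->; rewrite scale0r.
Qed.

Lemma malg_lift_linear : linear (malg_lift f).
Proof.
move=> c p q; pose d := (msupp p `|` msupp q)%fset.
have dp : {subset msupp p <= d} by move=> x Hx; rewrite in_fsetU Hx.
have dq : {subset msupp q <= d} by move=> x Hx; rewrite in_fsetU Hx orbT.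
have dr : {subset msupp (c *: p + q) <= d}.
  move=> x; rewrite -mcoeff_neq0 mcoeffD mcoeffZ in_fsetU -!mcoeff_neq0.
  apply: contraR; rewrite negb_or !negbK => /andP[/eqP-> /eqP->].
  by rewrite mulr0 addr0.
rewrite (malg_liftEw dr) (malg_liftEw dp) (malg_liftEw dq).
rewrite scaler_sumr -big_split; apply: eq_bigr => k _ /=.
by rewrite mcoeffD mcoeffZ scalerDl scalerA.
Qed.

HB.instance Definition _ :=
  GRing.isLinear.Build R {malg R[K]} X *:%R (malg_lift f) malg_lift_linear.

Lemma malg_liftU k : malg_lift f << k >> = f k.
Proof.
rewrite (malg_liftEw (d := [fset k]%fset)).
  by rewrite big_seq_fset1 mcoeffUU scale1r.
by move=> x; rewrite -mcoeff_neq0 mcoeffU in_fset1 [x == k]eq_sym; case: (k == x); rewrite // mulr0n eqxx.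
Qed.

End MalgLift.

Section Tensor.
Variables (R : comNzRingType) (A B : lmodType R).

Inductive tensor_relator : {malg R[(A * B)%type]} -> Prop :=
| tensor_addl a a' b :
    tensor_relator (<< (a + a', b) >> - << (a, b) >> - << (a', b) >>)
| tensor_addr a b b' :
    tensor_relator (<< (a, b + b') >> - << (a, b) >> - << (a, b') >>)
| tensor_scalel c a b : tensor_relator (<< (c *: a, b) >> - c *: << (a, b) >>)
| tensor_scaler c a b : tensor_relator (<< (a, c *: b) >> - c *: << (a, b) >>).

(* The tensor product of [A] and [B] over [R]. *)
Definition tensor := qmod tensor_relator.

HB.instance Definition _ := GRing.Lmodule.on tensor.

End Tensor.

HB.lock Definition tens (R : comNzRingType) (A B : lmodType R) (a : A) (b : B)
  : tensor A B := \pi_(qmod (@tensor_relator R A B)) << (a, b) >>.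

(* The linear map a (x) b |-> f a b; meaningful when [f] is bilinear. *)
HB.lock Definition tens_lift (R : comNzRingType) (A B X : lmodType R)
    (f : A -> B -> X) (x : tensor A B) : X :=
  malg_lift (fun p => f p.1 p.2) (repr x).

Section TensorTheory.
Variables (R : comNzRingType) (A B : lmodType R).
Local Notation tensor_relator := (@tensor_relator R A B).
Local Notation tensor := (tensor A B).
Local Notation tens := (@tens R A B).

Lemma tensDl b : {morph tens^~ b : x y / x + y}.
Proof.
move=> x y; rewrite tens.unlock; apply: etrans (qmod_piD _ _ _); apply: qmod_eq.
by rewrite opprD addrA; apply: span_gen; exact: tensor_addl.
Qed.

Lemma tensDr a : {morph tens a : x y / x + y}.
Proof.
move=> x y; rewrite tens.unlock; apply: etrans (qmod_piD _ _ _); apply: qmod_eq.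
by rewrite opprD addrA; apply: span_gen; exact: tensor_addr.
Qed.

Lemma tensZl c a b : tens (c *: a) b = c *: tens a b.
Proof.
rewrite tens.unlock; apply: etrans (qmod_piZ _ _ _); apply: qmod_eq.
by apply: span_gen; exact: tensor_scalel.
Qed.

Lemma tensZr c a b : tens a (c *: b) = c *: tens a b.
Proof.
rewrite tens.unlock; apply: etrans (qmod_piZ _ _ _); apply: qmod_eq.
by apply: span_gen; exact: tensor_scaler.
Qed.

Lemma tensor_ind (P : tensor -> Prop) :
    P 0 -> (forall a b x, P x -> P (tens a b + x)) ->
  forall x, P x.
Proof.
move=> P0 PD; refine (@qmodW _ _ _ _ _) => p; rewrite [p]monalgE.
elim: (enum_fset (msupp p)) => [|k s IH]; first by rewrite big_nil qmod_pi0.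
rewrite big_cons qmod_piD.
have -> : << p@_k *g k >> = p@_k *: << k >> :> {malg R[(A * B)%type]}.
  by apply/malgP => l; rewrite mcoeffZ !mcoeffU mulrnAr mulr1.
rewrite qmod_piZ; case: k => a b; have -> : \pi_(qmod tensor_relator) << (a, b) >> = tens a b.
  by rewrite tens.unlock.
by rewrite -tensZl; exact: PD.
Qed.

Section Lift.
Variables (X : lmodType R) (f : A -> B -> X).
Hypotheses (f_linl : forall b, linear (f^~ b)) (f_linr : forall a, linear (f a)).

Let fDl b : {morph f^~ b : x y / x + y}.
Proof. by move=> x y; have := f_linl b 1 x y; rewrite !scale1r. Qed.
Let fDr a : {morph f a : x y / x + y}.
Proof. by move=> x y; have := f_linr a 1 x y; rewrite !scale1r. Qed.
Let f0l b : f 0 b = 0.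
Proof. by apply: (addrI (f 0 b)); rewrite -[LHS]fDl !addr0. Qed.
Let f0r a : f a 0 = 0.
Proof. by apply: (addrI (f a 0)); rewrite -[LHS]fDr !addr0. Qed.
Let fZl c a b : f (c *: a) b = c *: f a b.
Proof. by have := f_linl b c a 0; rewrite !addr0 f0l addr0. Qed.
Let fZr c a b : f a (c *: b) = c *: f a b.
Proof. by have := f_linr a c b 0; rewrite !addr0 f0r addr0. Qed.

Let lift_span p : span tensor_relator p -> malg_lift (fun p => f p.1 p.2) p = 0.
Proof.
elim=> [|c {}p q rp _ IH]; first exact: linear0.
rewrite malg_lift_linear IH addr0; suff -> : malg_lift (fun p => f p.1 p.2) p = 0.
  by rewrite scaler0.
have LB u v : malg_lift (fun p => f p.1 p.2) (u - v) =
    malg_lift (fun p => f p.1 p.2) u - malg_lift (fun p => f p.1 p.2) v.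
  exact: linearB.
have LZ d u : malg_lift (fun p => f p.1 p.2) (d *: u) =
    d *: malg_lift (fun p => f p.1 p.2) u.
  exact: linearZ.
case: rp => [a a' b|a b b'|d a b|d a b]; rewrite !LB ?LZ !malg_liftU /=.
- by rewrite fDl -addrA -opprD subrr.
- by rewrite fDr -addrA -opprD subrr.
- by rewrite fZl subrr.
- by rewrite fZr subrr.
Qed.

Lemma tens_lift_pi p :
  tens_lift f (\pi_(qmod tensor_relator) p) = malg_lift (fun p => f p.1 p.2) p.
Proof.
rewrite unlock; apply/eqP; rewrite -subr_eq0 -linearB /=; apply/eqP/lift_span; exact: qmod_repr.
Qed.

Lemma tens_liftE a b : tens_lift f (tens a b) = f a b.
Proof. by rewrite tens.unlock tens_lift_pi malg_liftU. Qed.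

Lemma tens_lift_linear : linear (tens_lift f).
Proof.
move=> c; refine (@qmodW _ _ _ _ _) => p; refine (@qmodW _ _ _ _ _) => q.
by rewrite -[_ *: _]qmod_piZ -[_ + _]qmod_piD !tens_lift_pi linearP.
Qed.

End Lift.

End TensorTheory.

HB.lock Definition tens_mul (R : comNzRingType) (A B : algType R)
    (x y : tensor A B) : tensor A B :=
  tens_lift (fun (a : A) (b : B) =>
    tens_lift (fun (a' : A) (b' : B) => tens (a * a') (b * b')) y) x.

Section TensorRing.
Variables (R : comNzRingType) (A B : algType R).
Local Notation T := (tensor A B).
Local Notation tens_mul := (@tens_mul R A B).

Let mul_in (a : A) (b : B) (y : T) :=
  tens_lift (fun (a' : A) (b' : B) => tens (a * a') (b * b')) y.

Let inl (a : A) (b b' : B) : linear (fun a' : A => tens (a * a') (b * b')).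
Proof. by move=> c x y; rewrite mulrDr -scalerAr tensDl tensZl. Qed.
Let inr (a : A) (b : B) (a' : A) : linear (fun b' : B => tens (a * a') (b * b')).
Proof. by move=> c x y; rewrite mulrDr -scalerAr tensDr tensZr. Qed.

Let mul_inE a b a' b' : mul_in a b (tens a' b') = tens (a * a') (b * b').
Proof. exact: tens_liftE. Qed.
Let mul_in_lin a b : linear (mul_in a b).
Proof. exact: tens_lift_linear. Qed.
Let mul_inD a b : {morph mul_in a b : x y / x + y}.
Proof. by move=> x y; have := mul_in_lin a b 1 x y; rewrite !scale1r. Qed.
Let mul_in0 a b : mul_in a b 0 = 0.
Proof. by apply: (addrI (mul_in a b 0)); rewrite -mul_inD !addr0. Qed.

Let outl (b : B) y : linear (fun a : A => mul_in a b y).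
Proof.
move=> c a a'; elim/tensor_ind: y => [|x z y IH]; first by rewrite !mul_in0 scaler0 addr0.
rewrite !mul_inD !mul_inE IH mulrDl -scalerAl tensDl tensZl scalerDr.
by rewrite addrACA.
Qed.
Let outr (a : A) y : linear (fun b : B => mul_in a b y).
Proof.
move=> c b b'; elim/tensor_ind: y => [|x z y IH]; first by rewrite !mul_in0 scaler0 addr0.
rewrite !mul_inD !mul_inE IH mulrDl -scalerAl tensDr tensZr scalerDr.
by rewrite addrACA.
Qed.

Let tens_mul_lin y : linear (tens_mul^~ y).
Proof. by rewrite unlock; apply: tens_lift_linear => b; [exact: outl | exact: outr]. Qed.

Let tens_mul_in a b y : tens_mul (tens a b) y = mul_in a b y.
Proof. by rewrite unlock; apply: tens_liftE => ?; [exact: outl | exact: outr]. Qed.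

Fact tens_mulE (a : A) (b : B) (a' : A) (b' : B) :
  tens_mul (tens a b) (tens a' b') = tens (a * a') (b * b').
Proof. by rewrite tens_mul_in mul_inE. Qed.

Fact tens_mulDl : left_distributive tens_mul +%R.
Proof. by move=> x y z; have := tens_mul_lin z 1 x y; rewrite !scale1r. Qed.

Let tens_mul0l y : tens_mul 0 y = 0.
Proof. by apply: (addrI (tens_mul 0 y)); rewrite -tens_mulDl !addr0. Qed.

Fact tens_mulDr : right_distributive tens_mul +%R.
Proof.
move=> x y z; elim/tensor_ind: x => [|a b x IH]; first by rewrite !tens_mul0l addr0.
by rewrite !tens_mulDl IH !tens_mul_in mul_inD addrACA.
Qed.

Let tens_mul0r y : tens_mul y 0 = 0.
Proof. by apply: (addrI (tens_mul y 0)); rewrite -tens_mulDr !addr0. Qed.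

Fact tens_mulA : associative tens_mul.
Proof.
move=> x y z; elim/tensor_ind: x => [|a b x IH]; first by rewrite !tens_mul0l.
rewrite !tens_mulDl IH; congr (_ + _) => {x IH}.
elim/tensor_ind: y => [|a' b' y IHy]; first by rewrite ?(tens_mul0l, tens_mul0r).
rewrite !(tens_mulDl, tens_mulDr) IHy; congr (_ + _) => {y IHy}.
elim/tensor_ind: z => [|a'' b'' z IHz]; first by rewrite !tens_mul0r.
by rewrite !tens_mulDr IHz !tens_mulE !mulrA.
Qed.

Fact tens_mul1 : left_id (tens 1 1 : T) tens_mul.
Proof.
move=> x; elim/tensor_ind: x => [|a b x IH]; first by rewrite tens_mul0r.
by rewrite tens_mulDr IH tens_mulE !mul1r.
Qed.

Fact tens_1mul : right_id (tens 1 1 : T) tens_mul.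
Proof.
move=> x; elim/tensor_ind: x => [|a b x IH]; first by rewrite tens_mul0l.
by rewrite tens_mulDl IH tens_mulE !mulr1.
Qed.

HB.instance Definition _ := GRing.Zmodule_isPzRing.Build (tensor A B)
  tens_mulA tens_mul1 tens_1mul tens_mulDl tens_mulDr.

Lemma tensM (a a' : A) (b b' : B) : (tens a b : T) * tens a' b' = tens (a * a') (b * b').
Proof. exact: tens_mulE. Qed.

Lemma tens1 : tens 1 1 = 1 :> T. Proof. by []. Qed.

End TensorRing.

(** * Universal enveloping algebras *)

(* The free associative algebra (noncommutative polynomials) on the set [L]. *)
Definition freealg (R : comNzRingType) (L : choiceType) := {malg R[{fmonom L}]}.

HB.instance Definition _ (R : comNzRingType) (L : choiceType) :=
  GRing.Lalgebra.on (@freealg R L).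

Fact freealg_scalerAr (R : comNzRingType) (L : choiceType) (c : R)
  (u v : {malg R[{fmonom L}]}) : c *: (u * v) = u * (c *: v).
Proof.
apply/malgP => k; rewrite [LHS](mcoeffZ c (u * v)) [X in c * X](mcoeffMl u v k).
rewrite (mcoeffMlw k (fsubset_refl _) (msuppZ_le c v)) mulr_sumr; apply: eq_bigr => i _.
rewrite mulr_sumr; apply: eq_bigr => j _.
by rewrite mcoeffZ mulrnAr mulrCA.
Qed.

HB.instance Definition _ (R : comNzRingType) (L : choiceType) :=
  GRing.LSemiAlgebra_isSemiAlgebra.Build R (freealg R L)
    (@freealg_scalerAr R L).

Definition freealg_var (R : comNzRingType) (L : choiceType) (x : L)
  : freealg R L := << fmu x >>.
Arguments freealg_var R {L} x.

(* The morphism freealg R L -> B sending scalars along k and variables along f. *)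
HB.lock Definition freealg_eval (R : comNzRingType) (L : choiceType)
    (B : pzRingType) (k : R -> B) (f : L -> B) (p : freealg R L) : B :=
  \sum_(m <- msupp p) k p@_m * \prod_(x <- fmonom_val m) f x.

Section FreeAlgEval.
Variables (R : comNzRingType) (L : choiceType) (B : pzRingType).
Variables (k : {rmorphism R -> B}) (f : L -> B).
Hypothesis k_central : forall c b, k c * b = b * k c.
Local Notation ev := (@freealg_eval R L B k f).

Lemma freealg_evalEw (d : {fset {fmonom L}}) p : {subset msupp p <= d} ->
  ev p = \sum_(m <- d) k p@_m * \prod_(x <- fmonom_val m) f x.
Proof.
move=> le; rewrite unlock; apply: big_fset_incl; first exact/fsubsetP.
by move=> x _ /mcoeff_outdom ->; rewrite rmorph0 mul0r.
Qed.

Lemma freealg_evalD : {morph ev : p q / p + q}.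
Proof.
move=> p q; pose d := (msupp p `|` msupp q)%fset.
have dp : {subset msupp p <= d} by move=> x Hx; rewrite in_fsetU Hx.
have dq : {subset msupp q <= d} by move=> x Hx; rewrite in_fsetU Hx orbT.
have dr : {subset msupp (p + q) <= d}.
  move=> x; rewrite -mcoeff_neq0 mcoeffD in_fsetU -!mcoeff_neq0.
  by apply: contraR; rewrite negb_or !negbK => /andP[/eqP-> /eqP->]; rewrite addr0.
rewrite (freealg_evalEw dr) (freealg_evalEw dp) (freealg_evalEw dq).
rewrite -big_split; apply: eq_bigr => m _ /=.
by rewrite mcoeffD rmorphD mulrDl.
Qed.

Lemma freealg_eval0 : ev 0 = 0.
Proof. by rewrite unlock msupp0 big_seq_fset0. Qed.

Lemma freealg_evalU c m : ev << c *g m >> = k c * \prod_(x <- fmonom_val m) f x.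
Proof.
rewrite (freealg_evalEw (d := [fset m]%fset)); first by rewrite big_seq_fset1 mcoeffUU.
by move=> x /(fsubsetP msuppU_le).
Qed.

Lemma freealg_eval_var x : ev (freealg_var R x) = f x.
Proof. by rewrite freealg_evalU rmorph1 mul1r fmuE big_seq1. Qed.

Lemma freealg_eval1 : ev 1 = 1.
Proof. by rewrite freealg_evalU rmorph1 mul1r fm1 big_nil. Qed.

Lemma freealg_evalM : {morph ev : p q / p * q}.
Proof.
move=> p q; rewrite malgME (big_morph ev freealg_evalD freealg_eval0).
rewrite (@freealg_evalEw (msupp p) p) // mulr_suml; apply: eq_bigr => m _.
rewrite (big_morph ev freealg_evalD freealg_eval0) (@freealg_evalEw (msupp q) q) // mulr_sumr.
apply: eq_bigr => l _; rewrite freealg_evalU rmorphM fmM big_cat /=.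
by rewrite -!mulrA; congr (_ * _); rewrite !mulrA k_central.
Qed.

Lemma freealg_evalN : {morph ev : p / - p}.
Proof.
move=> p; apply: (addrI (ev p)).
by rewrite -freealg_evalD !subrr freealg_eval0.
Qed.

Lemma freealg_evalZ c p : ev (c *: p) = k c * ev p.
Proof.
rewrite (@freealg_evalEw (msupp p) (c *: p)); last exact/fsubsetP/msuppZ_le.
rewrite (@freealg_evalEw (msupp p) p) // mulr_sumr.
by apply: eq_bigr => m _; rewrite (mcoeffZ c p) rmorphM mulrA.
Qed.

End FreeAlgEval.

Section Uenv.
Variables (R : comNzRingType) (L : lmodType R) (br : L -> L -> L).
Local Notation var := (freealg_var R).

Inductive uenv_relator : freealg R L -> Prop :=
| uenv_linear (c : R) (x y : L) :
    uenv_relator (var (c *: x + y) - (c *: var x + var y))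
| uenv_bracket (x y : L) :
    uenv_relator (var (br x y) - (var x * var y - var y * var x)).

(* The universal enveloping algebra of the Lie algebra [L] with bracket [br]. *)
Definition uenv := qalg uenv_relator.

HB.instance Definition _ := GRing.PzRing.on uenv.
HB.instance Definition _ := GRing.Lmodule.on uenv.

End Uenv.

HB.lock Definition uenv_in (R : comNzRingType) (L : lmodType R)
    (br : L -> L -> L) (x : L) : uenv br :=
  \pi_(qalg (uenv_relator br)) (freealg_var R x).
Arguments uenv_in {R L} br x.

(* The morphism U(L) -> B of rings sending scalars along k and L along f;
   meaningful when k is a ring morphism with central values, and f is k-linear
   and sends brackets to commutators. *)
HB.lock Definition uenv_eval (R : comNzRingType) (L : lmodType R)
    (br : L -> L -> L) (B : pzRingType) (k : R -> B) (f : L -> B)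
    (x : uenv br) : B :=
  freealg_eval k f (repr x).

Section UenvTheory.
Variables (R : comNzRingType) (L : lmodType R) (br : L -> L -> L).
Local Notation U := (uenv br).
Local Notation piU := (\pi_(qalg (uenv_relator br))).

Lemma uenv_in_linear : linear (uenv_in br).
Proof.
move=> c x y; rewrite uenv_in.unlock.
set p := freealg_var R x; set q := freealg_var R y.
have <- : piU (c *: p + q) = c *: piU p + piU q by rewrite qmod_piD qmod_piZ.
apply: qmod_eq; apply: span_gen; exists 1; exists (freealg_var R (c *: x + y) - (c *: p + q)).
by exists 1; split; [exact: uenv_linear | rewrite mul1r mulr1].
Qed.

HB.instance Definition _ :=
  GRing.isLinear.Build R L U *:%R (uenv_in br) uenv_in_linear.

Lemma uenv_inB x y :
  uenv_in br (br x y) = uenv_in br x * uenv_in br y - uenv_in br y * uenv_in br x.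
Proof.
rewrite uenv_in.unlock.
set p := freealg_var R x; set q := freealg_var R y.
have <- : piU (p * q - q * p) = piU p * piU q - piU q * piU p.
  apply: etrans (qmod_piD _ _ _) _; congr (_ + _); first exact: qalg_piM.
  by apply: etrans (qmod_piN _ _) _; congr (- _); exact: qalg_piM.
apply: qmod_eq; apply: span_gen; exists 1; exists (freealg_var R (br x y) - (p * q - q * p)).
by exists 1; split; [exact: uenv_bracket | rewrite mul1r mulr1].
Qed.

Section Eval.
Variables (B : pzRingType) (k : {rmorphism R -> B}) (f : L -> B).
Hypothesis k_central : forall c b, k c * b = b * k c.
Hypothesis f_lin : forall c x y, f (c *: x + y) = k c * f x + f y.
Hypothesis f_br : forall x y, f (br x y) = f x * f y - f y * f x.
Local Notation ev := (uenv_eval (br := br) k f).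

Lemma uenv_eval_pi p : ev (piU p) = freealg_eval k f p.
Proof.
rewrite unlock; apply/eqP.
rewrite -subr_eq0 -freealg_evalN -freealg_evalD; apply/eqP.
elim: (qmod_repr _ p) => [|c x y [a [r [b [rr ->]]]] _ IH].
  exact: freealg_eval0.
rewrite freealg_evalD IH addr0 freealg_evalZ !(freealg_evalM _ k_central).
suff -> : freealg_eval k f r = 0 by rewrite mulr0 mul0r mulr0.
have evB u v : freealg_eval k f (u - v) = freealg_eval k f u - freealg_eval k f v.
  by rewrite freealg_evalD freealg_evalN.
case: rr => [d u v|u v]; rewrite evB freealg_eval_var.
  by rewrite freealg_evalD freealg_evalZ !freealg_eval_var f_lin subrr.
have evM w z : freealg_eval k f (freealg_var R w * freealg_var R z) = f w * f z.
  by rewrite (freealg_evalM f k_central) !freealg_eval_var.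
rewrite evB f_br; apply/eqP; rewrite subr_eq0; apply/eqP.
by congr (_ - _); apply/esym/evM.
Qed.

Lemma uenv_eval_in x : ev (uenv_in br x) = f x.
Proof. by rewrite uenv_in.unlock uenv_eval_pi freealg_eval_var. Qed.

Lemma uenv_evalD : {morph ev : x y / x + y}.
Proof.
refine (@qalgW _ _ _ _ _) => x; refine (@qalgW _ _ _ _ _) => y.
by rewrite -[_ + _]qmod_piD !uenv_eval_pi freealg_evalD.
Qed.

Lemma uenv_evalM : {morph ev : x y / x * y}.
Proof.
refine (@qalgW _ _ _ _ _) => x; refine (@qalgW _ _ _ _ _) => y.
by rewrite -[_ * _]qalg_piM !uenv_eval_pi freealg_evalM.
Qed.

Lemma uenv_eval1 : ev 1 = 1.
Proof. by rewrite -[1]qalg_pi1 uenv_eval_pi freealg_eval1. Qed.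

Lemma uenv_evalZ c x : ev (c *: x) = k c * ev x.
Proof.
move: x; refine (@qalgW _ _ _ _ _) => x.
by rewrite -[_ *: _]qmod_piZ !uenv_eval_pi freealg_evalZ.
Qed.

End Eval.

Fact uenv_oner_neq0 : (1 : U) != 0.
Proof.
pose ev := uenv_eval (br := br) (idfun : {rmorphism R -> R}) (fun=> 0).
have ev1 : ev 1 = 1.
  by apply: uenv_eval1 => [c b|c x y|x y]; rewrite ?mulr0 ?subrr ?addr0 // mulrC.
have ev0 : ev 0 = 0.
  rewrite -(scale0r (1 : U)) /ev uenv_evalZ ?mul0r // => [c b|c x y|x y];
  by rewrite ?mulr0 ?subrr ?addr0 // mulrC.
by apply/eqP => E; have /eqP := ev0; rewrite -E ev1 oner_eq0.
Qed.

End UenvTheory.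

HB.instance Definition _ (R : comNzRingType) (L : lmodType R) (br : L -> L -> L) :=
  GRing.PzSemiRing_isNonZero.Build (uenv br) (uenv_oner_neq0 br).
HB.instance Definition _ (R : comNzRingType) (L : lmodType R) (br : L -> L -> L) :=
  GRing.LSemiModule_isLSemiAlgebra.Build R (uenv br)
    (@qalg_scaleAl _ _ (uenv_relator br)).
HB.instance Definition _ (R : comNzRingType) (L : lmodType R) (br : L -> L -> L) :=
  GRing.LSemiAlgebra_isSemiAlgebra.Build R (uenv br)
    (@qalg_scaleAr _ _ (uenv_relator br)).

(* The standard Hopf structure of U(L), for which L is primitive. *)
Section UenvHopf.
Variables (R : comNzRingType) (L : lmodType R) (br : L -> L -> L).
Local Notation U := (uenv br).

Definition uenv_coprod : U -> tensor U U :=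
  uenv_eval (B := tensor U U) (fun c => c *: tens 1 1)
    (fun x => tens (uenv_in br x) 1 + tens 1 (uenv_in br x)).

Definition uenv_counit : U -> R := uenv_eval id (fun=> 0).

(* An antimorphism, i.e., a morphism to the converse ring. *)
Definition uenv_antipode : U -> U :=
  uenv_eval (B := U^c) (fun c => c%:A) (fun x => - uenv_in br x).

End UenvHopf.

(** * The generalized-Witt algebra *)

(* Both T (via its basis d_1, ..., d_n) and Z^n are 'rV[int]_n;
   [wpair d b] is the integer d(b). *)
Definition wpair n (d b : 'rV[int]_n) : int := \sum_i d 0 i * b 0 i.

Section Witt.
Variables (F : fieldType) (n : nat).

(* F[x_1^+-1, ..., x_n^+-1] (x)_Z T, as the vector space with basis
   the x^a d_i = x^a (x) d_i, encoded by the pairs (a, i). *)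
Definition witt := {malg F[('rV[int]_n * 'I_n)%type]}.

HB.instance Definition _ := GRing.Lmodule.on witt.

Definition witt_mon (a d : 'rV[int]_n) : witt :=
  \sum_(i < n) (d 0 i)%:~R *: << (a, i) >>.

(* [x^a d_i, x^b d_j] = x^(a + b) (b_i d_j - a_j d_i) *)
Definition witt_br_basis (u v : 'rV[int]_n * 'I_n) : witt :=
  (v.1 0 u.2)%:~R *: << (u.1 + v.1, v.2) >>
  - (u.1 0 v.2)%:~R *: << (u.1 + v.1, u.2) >>.

Definition witt_br (p q : witt) : witt :=
  malg_lift (fun u => malg_lift (fun v => witt_br_basis u v) q) p.

Let scale_aux (V : lmodType F) (x y z t : int) (u v : V) :
  x%:~R *: (y%:~R *: (z%:~R *: u - t%:~R *: v)) =
  (x * y * z)%:~R *: u - (x * y * t)%:~R *: v.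
Proof. by rewrite !scalerBr !scalerA !intrM. Qed.

Let scale_auxl (V : lmodType F) (u : V) (x y : 'I_n -> int) (z : int) :
  \sum_i (x i * z * y i)%:~R *: u = (\sum_i x i * y i)%:~R *: (z%:~R *: u).
Proof.
rewrite -scaler_suml scalerA -intrM mulr_suml rmorph_sum; congr (_ *: _).
by apply: eq_bigr => i _; rewrite mulrAC.
Qed.

Let scale_auxr (V : lmodType F) (u : V) (x y : 'I_n -> int) (z : int) :
  \sum_i (z * x i * y i)%:~R *: u = (\sum_i x i * y i)%:~R *: (z%:~R *: u).
Proof.
rewrite -scaler_suml scalerA -intrM mulr_suml rmorph_sum; congr (_ *: _).
by apply: eq_bigr => i _; rewrite -mulrA mulrC.
Qed.

Lemma witt_br_mon a d b d' :
  witt_br (witt_mon a d) (witt_mon b d') =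
  (wpair d b)%:~R *: witt_mon (a + b) d'
  - (wpair d' a)%:~R *: witt_mon (a + b) d.
Proof.
rewrite /witt_br /witt_mon linear_sum /=.
transitivity (\sum_(i < n) \sum_(j < n)
   ((d 0 i * d' 0 j * b 0 i)%:~R *: << (a + b, j) >>
    - (d 0 i * d' 0 j * a 0 j)%:~R *: << (a + b, i) >> : witt)).
  apply: eq_bigr => i _; rewrite linearZ /= malg_liftU linear_sum scaler_sumr.
  apply: eq_bigr => j _; rewrite linearZ /= malg_liftU /witt_br_basis /=.
  exact: scale_aux.
transitivity (\sum_(i < n) \sum_(j < n)
     ((d 0 i * d' 0 j * b 0 i)%:~R *: << (a + b, j) >> : witt)
   - \sum_(i < n) \sum_(j < n)
     ((d 0 i * d' 0 j * a 0 j)%:~R *: << (a + b, i) >> : witt)).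
  rewrite -sumrB; apply: eq_bigr => i _; by rewrite -sumrB.
congr (_ - _).
  by rewrite exchange_big scaler_sumr; apply: eq_bigr => j _; apply: scale_auxl.
by rewrite scaler_sumr; apply: eq_bigr => i _; apply: scale_auxr.
Qed.

End Witt.

(** * Topological Hopf algebras over [R[[t]]] *)

(* V[[t]] (x) W[[t]], completed t-adically, is identified with (V (x) W)[[t]]. *)
Definition ctens (R : comNzRingType) (A B : lmodType R)
    (u : fps A) (v : fps B) : fps (tensor A B) :=
  cauchy (@tens R A B) u v.

(* The continuous R[[t]]-linear map sending u (x) v to the value on (u, v) of the
   R[[t]]-bilinear extension of [f] (f should be R-bilinear). *)
Definition ctens_lift (R : comNzRingType) (A B X : lmodType R)
    (f : A -> B -> fps X) (w : fps (tensor A B)) : fps X :=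
  tsum (fun i k => tens_lift (fun a b => f a b k) (w i)).

(* f (x) g, for R[[t]]-linear f and g; those are automatically continuous, hence
   determined by their values on constant series. *)
Definition ctens_map (R : comNzRingType) (A B A' B' : lmodType R)
    (f : fps A -> fps A') (g : fps B -> fps B') :
    fps (tensor A B) -> fps (tensor A' B') :=
  ctens_lift (fun a b => ctens (f (fps_const a)) (g (fps_const b))).

Definition tens_swap (R : comNzRingType) (A B : lmodType R) :
    tensor A B -> tensor B A :=
  tens_lift (fun a b => tens b a).

Definition tens_assoc (R : comNzRingType) (A B C : lmodType R) :
    tensor (tensor A B) C -> tensor A (tensor B C) :=
  tens_lift (fun x c => tens_lift (fun a b => tens a (tens b c)) x).

(* Delta, S, eps make the R[[t]]-algebra U[[t]] a topological Hopf algebra. *)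
Record topological_hopf (R : comNzRingType) (U : algType R)
    (Delta : fps U -> fps (tensor U U)) (S : fps U -> fps U)
    (eps : fps U -> fps R) : Prop := {
  hopf_coprod_linear : linear Delta;
  hopf_coprod_morph : monoid_morphism Delta;
  hopf_counit_linear : linear_for *%R eps;
  hopf_counit_morph : monoid_morphism eps;
  hopf_antipode_linear : linear S;
  hopf_coassoc : forall u : fps U,
    @tens_assoc R U U U \o ctens_map Delta id (Delta u)
    = ctens_map id Delta (Delta u);
  hopf_counit_l : forall u : fps U,
    ctens_lift (fun a b : U => eps (fps_const a) *: fps_const b) (Delta u) = u;
  hopf_counit_r : forall u : fps U,
    ctens_lift (fun a b : U => eps (fps_const b) *: fps_const a) (Delta u) = u;
  hopf_antipode_l : forall u : fps U,
    ctens_lift (fun a b : U => S (fps_const a) * fps_const b) (Delta u)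
    = (eps u)%:A;
  hopf_antipode_r : forall u : fps U,
    ctens_lift (fun a b : U => fps_const a * S (fps_const b)) (Delta u)
    = (eps u)%:A
}.

(* U[[t]] / t U[[t]] *)
Definition mod_t (R : comNzRingType) (U : algType R) :=
  qalg (fun z : fps U => z = fps_t *: 1).

(* Reduction modulo t induces an isomorphism from U[[t]] / t U[[t]] to U, which
   identifies the reductions of Delta, S, eps with Delta0, S0, eps0. *)
Definition hopf_deformation_of (R : comNzRingType) (U : algType R)
    (Delta : fps U -> fps (tensor U U)) (S : fps U -> fps U)
    (eps : fps U -> fps R)
    (Delta0 : U -> tensor U U) (S0 : U -> U) (eps0 : U -> R) : Prop :=
  exists phi : mod_t U -> U,
  [/\ bijective phi,
      zmod_morphism phi /\ monoid_morphism phi,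
      forall (c : fps R) (x : mod_t U), phi (c *: x) = c 0%N *: phi x,
      forall u : fps U, phi (\pi_(mod_t U) u) = u 0%N
    & forall u : fps U,
      [/\ Delta u 0%N = Delta0 (u 0%N), S u 0%N = S0 (u 0%N)
        & eps u 0%N = eps0 (u 0%N)]].

(** * Ingredients of the deformed structure *)

(* x_a^<l> = (x + a) (x + a + 1) ... (x + a + l - 1) *)
Definition rising (R : comNzRingType) (A : algType R) (a : R) (x : A) (l : nat)
    : A :=
  \prod_(i < l) (x + (a + i%:R)%:A).

Definition gbinom (F : fieldType) (c : F) (k : nat) : F :=
  (\prod_(i < k) (c - i%:R)) / k`!%:R.

(* The binomial series (1 - e t)^c. *)
Definition binpow (F : fieldType) (A : algType F) (e : A) (c : F) : fps A :=
  fun k => gbinom c k *: (- e) ^+ k.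

Section Coefficients.
Variables (F : fieldType) (n : nat) (d0 d0' g a d : 'rV[int]_n).

Definition coefA (l : nat) : F :=
  (wpair d0 g)%:~R ^+ l / l`!%:R
  * \prod_(j < l) (wpair d0' (a + g *+ j))%:~R.

Definition coefB (l : nat) : F :=
  if l is l'.+1 then (wpair d0 g)%:~R * (wpair d g)%:~R * coefA l' else 0.

(* x^(a + l g) (A_l d - B_l d0') *)
Definition witt_term (l : nat) : witt F n :=
  coefA l *: witt_mon F (a + g *+ l) d - coefB l *: witt_mon F (a + g *+ l) d0'.

End Coefficients.

Notation uwitt F n := (uenv (@witt_br F n)).

Definition uwitt_in (F : fieldType) (n : nat) (x : witt F n) : uwitt F n :=
  uenv_in (@witt_br F n) x.

(* Main.v *)
Require Import Defs.
From HB Require Import structures.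
From mathcomp Require Import all_boot all_algebra finmap.
From mathcomp Require Import boolp.
From mathcomp.multinomials Require Import monalg.
From mathcomp Require Import ring.

(** The Hopf structure is the standard one of U(W)[[t]] conjugated by a Drinfeld
    twist of Jordanian type.  Inside (U(W) (x) U(W))[[t]] consider
      F = (1 - t (1 (x) e))^(h (x) 1),
    a binomial series whose exponent is not a scalar but commutes with the base
    ([fps_pow], [jtwist]), and put
      Delta = F Delta_0 F^-1,   S = Q S_0 Q^-1,   Q = sum F' S_0(F''),
    with the counit unchanged.  Drinfeld's argument ([twist_hopf]) reduces all the
    Hopf axioms to facts about F alone: the counit maps either leg of F to 1, F is a
    2-cocycle, and Q is invertible with inverse sum S_0(G') G'', where G = F^-1.

    Besides the primitivity of h and e these facts only involve the relation
    h e = e h + e.  They are identities between power series in t, and the last two are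
    proved by differentiating with respect to t: in characteristic 0 a series satisfying
    p u' = m u, with p(0) = 1, is determined by its constant term ([fps_ode_uniq]).
    The cocycle identity reads
      (1 - t f)^a (1 - t g)^(a + b) = (1 - t g)^b (1 - t (f + g))^a
    where a is central, f and g commute and b f = f b + f ([pow_cocycle]).  The reason
    is that conjugation by (1 - t g)^b multiplies f by 1 - t g ([pow_weight]), hence
    sends 1 - t (f + g) to the product (1 - t f) (1 - t g).  As for Q, it turns out to be
    exp(t h e), because falling factorials of h absorb powers of e ([fderiv_pow_r]).

    The explicit formulas hold for every element X_0 of h-weight s whose divided
    iterated brackets X_l = ad(e)^l X_0 / l! are known: F commutes past X_0 (x) 1 by
    raising its exponent by s ([jtwist_conj_l]), and past 1 (x) X_0 at the cost of one
    term for each X_l ([ad_pow]); the antipode is treated similarly ([ad_rpow]).  In the generalized-Witt algebra the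
    elements x^(alpha + l gamma) (A_l d - B_l d0') are exactly these brackets
    ([witt_e_term], [witt_h_term]).

    The constant term of F is 1, so that the structure reduces to the standard one
    modulo t.  The coefficient of t in Delta(h) is h (x) e ([jtwist_coprod_h1]), which
    differs from e (x) h as soon as e is not 0: matrix coefficients of the action on
    Laurent polynomials tell h and e apart ([witt_coef_mon]). *)

Set Implicit Arguments.
Unset Strict Implicit.
Unset Printing Implicit Defensive.

Import GRing.Theory.
Local Open Scope ring_scope.

(** * Augmented algebras and their tensor products *)

(** An augmentation A -> R prevents 1 (x) 1 from vanishing, so that the tensor product
    of two augmented algebras is again a nontrivial (and augmented) algebra, and tensor
    products can be iterated. *)
HB.mixin Record isAugmented (R : comNzRingType) A of GRing.Algebra R A := {
  aug : A -> R;
  aug_linear : linear_for *%R aug;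
  aug_monoid : monoid_morphism aug
}.
#[short(type="augAlgType")]
HB.structure Definition Augmented (R : comNzRingType) :=
  { A of isAugmented R A & GRing.Algebra R A }.

Section Aug.
Variables (R : comNzRingType) (A : augAlgType R).
HB.instance Definition _ := GRing.isLinear.Build R A R *%R aug (@aug_linear R A).
HB.instance Definition _ := GRing.isMonoidMorphism.Build A R aug (@aug_monoid R A).
End Aug.

Section TensAlg.
Variables (R : comNzRingType) (A B : augAlgType R).
Local Notation T := (tensor A B).

Lemma tens_oner_neq0 : (1 : T) != 0.
Proof.
pose f (a : A) (b : B) : R^o := aug a * aug b.
have fl b : linear (f^~ b).
  by move=> c x y; rewrite /f linearP mulrDl -mulrA.
have fr a : linear (f a).
  by move=> c x y; rewrite /f linearP mulrDr mulrCA.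
apply/eqP => E; have := tens_liftE fl fr 1 1.
rewrite [tens _ _]E.
have -> : tens_lift f 0 = 0.
  apply: (addrI (tens_lift f 0)).
  have := tens_lift_linear fl fr 1 0 0.
  by rewrite !scale1r !addr0 => <-.
by rewrite /f !rmorph1 mulr1 => /esym/eqP; rewrite oner_eq0.
Qed.
HB.instance Definition _ := GRing.PzSemiRing_isNonZero.Build T tens_oner_neq0.

Fact tens_scalerAl (c : R) (x y : T) : c *: (x * y) = (c *: x) * y.
Proof.
elim/tensor_ind: x => [|a b x IH]; first by rewrite !(mul0r, scaler0).
rewrite mulrDl !scalerDr mulrDl IH; congr (_ + _); rewrite -tensZl.
elim/tensor_ind: y {IH} => [|a' b' y IH]; first by rewrite !(mulr0, scaler0).
by rewrite !mulrDr scalerDr IH !tensM -tensZl scalerAl.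
Qed.
Fact tens_scalerAr (c : R) (x y : T) : c *: (x * y) = x * (c *: y).
Proof.
elim/tensor_ind: x => [|a b x IH]; first by rewrite !(mul0r, scaler0).
rewrite mulrDl !scalerDr mulrDl IH; congr (_ + _).
elim/tensor_ind: y {IH} => [|a' b' y IH]; first by rewrite !(mulr0, scaler0).
by rewrite scalerDr !mulrDr scalerDr IH -tensZl !tensM -tensZl scalerAr.
Qed.
HB.instance Definition _ := GRing.LSemiModule_isLSemiAlgebra.Build R T tens_scalerAl.
HB.instance Definition _ := GRing.LSemiAlgebra_isSemiAlgebra.Build R T tens_scalerAr.

Definition tens_aug : T -> R :=
  tens_lift (fun (a : A) (b : B) => aug a * aug b : R^o).

Let aug_linl (b : B) : linear (fun a : A => aug a * aug b : R^o).
Proof. by move=> c x y; rewrite linearP mulrDl -mulrA. Qed.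
Let aug_linr (a : A) : linear (fun b : B => aug a * aug b : R^o).
Proof. by move=> c x y; rewrite linearP mulrDr mulrCA. Qed.

Fact tens_aug_linear : linear_for *%R tens_aug.
Proof. exact: (tens_lift_linear aug_linl aug_linr). Qed.

HB.instance Definition _ :=
  GRing.isLinear.Build R T R *%R tens_aug tens_aug_linear.

Lemma tens_augE a b : tens_aug (tens a b) = aug a * aug b.
Proof. exact: (tens_liftE aug_linl aug_linr). Qed.

Fact tens_aug_monoid : monoid_morphism tens_aug.
Proof.
split=> [|x y]; first by rewrite -tens1 tens_augE !rmorph1 mulr1.
elim/tensor_ind: x => [|a b x IH]; first by rewrite mul0r linear0 mul0r.
rewrite mulrDl !linearD mulrDl /= IH; congr (_ + _) => {x IH}.
elim/tensor_ind: y => [|a' b' y IH]; first by rewrite mulr0 linear0 mulr0.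
by rewrite mulrDr !linearD mulrDr /= IH tensM !tens_augE !rmorphM mulrACA.
Qed.

HB.instance Definition _ :=
  isAugmented.Build R T tens_aug_linear tens_aug_monoid.

End TensAlg.

Section TensMorphisms.
Variables (R : comNzRingType) (A B : augAlgType R).
Local Notation T := (tensor A B).

(** Pure tensors span, so they are enough to test multiplicativity. *)
Lemma tens_linear_mul (C : algType R) (f : {linear T -> C}) :
  (forall a b a' b', f (tens (a * a') (b * b')) = f (tens a b) * f (tens a' b')) ->
  {morph f : x y / x * y}.
Proof.
move=> E x y; elim/tensor_ind: x => [|a b x IH]; first by rewrite mul0r linear0 mul0r.
rewrite mulrDl !linearD mulrDl /= IH; congr (_ + _) => {x IH}.
elim/tensor_ind: y => [|a' b' y IH]; first by rewrite mulr0 linear0 mulr0.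
by rewrite mulrDr !linearD mulrDr /= IH tensM E.
Qed.

Definition tensl (a : A) : T := tens a 1.
Definition tensr (b : B) : T := tens 1 b.

Fact tensl_linear : linear tensl.
Proof. by move=> c x y; rewrite /tensl tensDl tensZl. Qed.
Fact tensr_linear : linear tensr.
Proof. by move=> c x y; rewrite /tensr tensDr tensZr. Qed.
HB.instance Definition _ := GRing.isLinear.Build R A T *:%R tensl tensl_linear.
HB.instance Definition _ := GRing.isLinear.Build R B T *:%R tensr tensr_linear.
Fact tensl_monoid : monoid_morphism tensl.
Proof. by split=> // x y; rewrite /tensl tensM mulr1. Qed.
Fact tensr_monoid : monoid_morphism tensr.
Proof. by split=> // x y; rewrite /tensr tensM mulr1. Qed.
HB.instance Definition _ := GRing.isMonoidMorphism.Build A T tensl tensl_monoid.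
HB.instance Definition _ := GRing.isMonoidMorphism.Build B T tensr tensr_monoid.

Lemma tensE a b : tens a b = tensl a * tensr b :> T.
Proof. by rewrite /tensl /tensr tensM mulr1 mul1r. Qed.

Lemma tensC a b : tensr b * tensl a = tensl a * tensr b :> T.
Proof. by rewrite /tensl /tensr !tensM !mulr1 !mul1r. Qed.

End TensMorphisms.
Arguments tensl {R A} B a : rename.
Arguments tensr {R} A {B} b : rename.

Section TensMap.
Variables (R : comNzRingType) (A B A' B' : augAlgType R).
Variables (f : {lrmorphism A -> A'}) (g : {lrmorphism B -> B'}).

Definition tmap : tensor A B -> tensor A' B' :=
  tens_lift (fun (a : A) (b : B) => tens (f a) (g b)).

Let linl b : linear (fun a => tens (f a) (g b) : tensor A' B').
Proof. by move=> c x y; rewrite linearP tensDl tensZl. Qed.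
Let linr a : linear (fun b => tens (f a) (g b) : tensor A' B').
Proof. by move=> c x y; rewrite linearP tensDr tensZr. Qed.

Lemma tmapE a b : tmap (tens a b) = tens (f a) (g b).
Proof. exact: (tens_liftE linl linr). Qed.

Fact tmap_linear : linear tmap.
Proof. exact: (tens_lift_linear linl linr). Qed.
HB.instance Definition _ := GRing.isLinear.Build R _ _ *:%R tmap tmap_linear.
Fact tmap_monoid : monoid_morphism tmap.
Proof.
split; first by rewrite -tens1 tmapE !rmorph1.
by apply: tens_linear_mul => a b a' b'; rewrite /= !tmapE tensM !rmorphM.
Qed.
HB.instance Definition _ := GRing.isMonoidMorphism.Build _ _ tmap tmap_monoid.

End TensMap.

Section TensAssoc.
Variables (R : comNzRingType) (A B C : augAlgType R).

Local Notation assoc := (@tens_assoc R A B C).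

Let in_lin1 (c : C) (b : B) : linear (fun a : A => tens a (tens b c : tensor B C)).
Proof. by move=> d x y; rewrite tensDl tensZl. Qed.
Let in_lin2 (c : C) (a : A) : linear (fun b : B => tens a (tens b c : tensor B C)).
Proof. by move=> d x y; rewrite tensDl tensZl tensDr tensZr. Qed.

Let out (x : tensor A B) (c : C) : tensor A (tensor B C) :=
  tens_lift (fun (a : A) (b : B) => tens a (tens b c)) x.
Let outE a b c : out (tens a b) c = tens a (tens b c).
Proof. exact: (tens_liftE (in_lin1 c) (in_lin2 c)). Qed.
Let out_linl c : linear (out^~ c).
Proof. exact: (tens_lift_linear (in_lin1 c) (in_lin2 c)). Qed.
Let out_linr x : linear (out x).
Proof.
move=> d c c'; elim/tensor_ind: x => [|a b x IH].
  have E u : out 0 u = 0.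
    by apply: (addrI (out 0 u)); have := out_linl u 1 0 0; rewrite !scale1r !addr0 => <-.
  by rewrite !E scaler0 addr0.
have outD u y z : out (y + z) u = out y u + out z u.
  by have := out_linl u 1 y z; rewrite !scale1r.
by rewrite !outD IH !outE tensDr tensZr tensDr tensZr scalerDr addrACA.
Qed.

Fact tens_assoc_linear : linear assoc.
Proof. exact: (tens_lift_linear out_linl out_linr). Qed.
HB.instance Definition _ := GRing.isLinear.Build R _ _ *:%R assoc tens_assoc_linear.

Lemma tens_assocE a b c : assoc (tens (tens a b) c) = tens a (tens b c).
Proof. by rewrite -outE; exact: (tens_liftE out_linl out_linr). Qed.

Let assoc_out x c : assoc (tens x c) = out x c.
Proof. exact: (tens_liftE out_linl out_linr). Qed.

Fact tens_assoc_monoid : monoid_morphism assoc.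
Proof.
split; first by rewrite -!tens1 tens_assocE.
apply: tens_linear_mul => x c y d.
elim/tensor_ind: x => [|a b x IH].
  by rewrite mul0r !(tensE 0) linear0 !mul0r linear0 mul0r.
rewrite mulrDl !tensDl !linearD mulrDl /= IH; congr (_ + _) => {x IH}.
elim/tensor_ind: y => [|a' b' y IH].
  by rewrite mulr0 !(tensE 0) linear0 !mul0r linear0 mulr0.
rewrite mulrDr !tensDl !linearD mulrDr /= IH; congr (_ + _) => {y IH}.
by rewrite tensM !tens_assocE !tensM.
Qed.
HB.instance Definition _ := GRing.isMonoidMorphism.Build _ _ assoc tens_assoc_monoid.

End TensAssoc.

(** * The Hopf algebra U(L) *)

Lemma commutatorD (A : pzRingType) (a b c d : A) :
    a * d = d * a -> c * b = b * c ->
  (a + c) * (b + d) - (b + d) * (a + c) = (a * b - b * a) + (c * d - d * c).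
Proof.
move=> ad cb; rewrite mulrDr !mulrDl !mulrDr -ad -cb.
by rewrite opprD addrACA !opprD [X in X + _ = _]addrACA [X in _ + X = _]addrACA
   !subrr addr0 add0r.
Qed.

Section UenvHopfTheory.
Variables (R : comNzRingType) (L : lmodType R) (br : L -> L -> L).
Local Notation U := (uenv br).
Local Notation inU := (uenv_in br).

(** U(L) is spanned by words in L. *)
Lemma uenv_ind (P : U -> Prop) :
    (forall c x y, P x -> P y -> P (c *: x + y)) -> P 1 ->
    (forall x u, P u -> P (inU x * u)) ->
  forall u, P u.
Proof.
move=> PL P1 PM.
have P0 : P 0 by have := PL (-1) 1 1 P1 P1; rewrite scaleN1r addNr.
refine (@qalgW _ _ _ _ _) => p; rewrite [p]monalgE.
elim: (enum_fset (msupp p)) => [|m s IH]; first by rewrite big_nil qmod_pi0.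
rewrite big_cons qmod_piD.
have -> : << p@_m *g m >> = p@_m *: << m >> :> freealg R L.
  by apply/malgP => l; rewrite (mcoeffZ p@_m) !mcoeffU mulrnAr mulr1.
rewrite qmod_piZ; apply: PL => // {IH s}.
case: m => s; elim: s => [|x s IH].
  rewrite (_ : FMonom _ = mone); last by apply/eqP; rewrite fmP fm1.
  by move: P1; rewrite -qalg_pi1.
have -> : << FMonom (x :: s) >> = freealg_var R x * << FMonom s >> :> freealg R L.
  rewrite (malgMEw (msuppU_le) (msuppU_le)) !big_seq_fset1 !mcoeffUU mulr1.
  by congr << _ *g _ >>; apply/eqP; rewrite fmP fmM fmU.
by rewrite qalg_piM; have := PM x _ IH; rewrite uenv_in.unlock.
Qed.

Section EvalLinear.
Variables (B : algType R) (f : L -> B).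
Hypothesis f_lin : linear f.
Hypothesis f_br : forall x y, f (br x y) = f x * f y - f y * f x.
Local Notation ev := (uenv_eval (br := br) (in_alg B) f).

Let cent (c : R) (b : B) : in_alg B c * b = b * in_alg B c.
Proof. by rewrite /= mulr_algl mulr_algr. Qed.
Let f_lin' c x y : f (c *: x + y) = in_alg B c * f x + f y.
Proof. by rewrite f_lin /= mulr_algl. Qed.

Lemma uenv_eval_linear : linear ev.
Proof. by move=> c x y; rewrite uenv_evalD // uenv_evalZ //= mulr_algl. Qed.

Lemma uenv_eval_monoid : monoid_morphism ev.
Proof. by split=> [|x y]; [exact: uenv_eval1 | exact: uenv_evalM]. Qed.

Lemma uenv_eval_gen x : ev (inU x) = f x.
Proof. exact: uenv_eval_in. Qed.

End EvalLinear.

Lemma uenv_lrmorphism_ext (B : algType R) (f g : {lrmorphism U -> B}) :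
  (forall x, f (inU x) = g (inU x)) -> f =1 g.
Proof.
move=> E; apply: uenv_ind => [c x y Ex Ey||x u Eu].
- by rewrite !linearP /= Ex Ey.
- by rewrite !rmorph1.
- by rewrite !rmorphM /= E Eu.
Qed.

Local Notation ep := (@uenv_counit R L br).

Let ep0_lin : linear (fun _ : L => 0 : R^o).
Proof. by move=> c x y; rewrite scaler0 addr0. Qed.
Let ep0_br (x y : L) : (0 : R^o) = 0 * 0 - 0 * 0.
Proof. by rewrite mulr0 subrr. Qed.
Let in_algE : (id : R -> R) = in_alg R^o.
Proof. by apply/funext => x /=; rewrite [LHS](esym (mulr1 x)). Qed.
Let epE : ep = uenv_eval (B := R^o) (in_alg R^o) (fun _ => 0).
Proof. by rewrite /uenv_counit -in_algE. Qed.

Fact uenv_counit_linear : linear_for *%R ep.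
Proof. by rewrite epE; exact: (uenv_eval_linear (B := R^o) ep0_lin ep0_br). Qed.
Fact uenv_counit_monoid : monoid_morphism ep.
Proof. by rewrite epE; exact: (uenv_eval_monoid (B := R^o) ep0_lin ep0_br). Qed.
Lemma uenv_counit_in x : ep (inU x) = 0.
Proof. by rewrite epE; exact: (uenv_eval_gen (B := R^o) ep0_lin ep0_br). Qed.

HB.instance Definition _ :=
  isAugmented.Build R U uenv_counit_linear uenv_counit_monoid.
HB.instance Definition _ :=
  GRing.isLinear.Build R U R *%R ep uenv_counit_linear.
HB.instance Definition _ :=
  GRing.isMonoidMorphism.Build U R ep uenv_counit_monoid.

Local Notation T := (tensor U U).
Local Notation D := (@uenv_coprod R L br).

Let prim (x : L) : T := tens (inU x) 1 + tens 1 (inU x).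
Let prim_lin : linear prim.
Proof.
by move=> c x y; rewrite /prim linearP tensDl tensDr tensZl tensZr scalerDr addrACA.
Qed.
Let prim_br x y : prim (br x y) = prim x * prim y - prim y * prim x.
Proof.
have tB (u v : U) : tensl U (u - v) = tensl U u - tensl U v by rewrite raddfB.
have tB' (u v : U) : tensr U (u - v) = tensr U u - tensr U v by rewrite raddfB.
rewrite /prim uenv_inB -![tens _ 1]/(tensl U _) -![tens 1 _]/(tensr U _) tB tB'.
by rewrite !rmorphM /= commutatorD ?tensC.
Qed.

Fact uenv_coprod_linear : linear D.
Proof. exact: (uenv_eval_linear prim_lin prim_br). Qed.
Fact uenv_coprod_monoid : monoid_morphism D.
Proof. exact: (uenv_eval_monoid prim_lin prim_br). Qed.
Lemma uenv_coprod_in x : D (inU x) = tens (inU x) 1 + tens 1 (inU x).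
Proof. exact: (uenv_eval_gen prim_lin prim_br). Qed.

HB.instance Definition _ :=
  GRing.isLinear.Build R U T *:%R D uenv_coprod_linear.
HB.instance Definition _ :=
  GRing.isMonoidMorphism.Build U T D uenv_coprod_monoid.

Local Notation S := (@uenv_antipode R L br).

Section Antipode.
Let k (c : R) : U^c := c%:A.
Let k_additive : additive k.
Proof. by move=> c d; rewrite /k scalerBl. Qed.
Let k_monoid : monoid_morphism k.
Proof.
split=> [|c d]; first exact: scale1r.
rewrite -[RHS]/((d%:A : U) * c%:A).
by rewrite mulr_algl /k scalerA mulrC.
Qed.
HB.instance Definition _ := GRing.isZmodMorphism.Build R U^c k k_additive.
HB.instance Definition _ := GRing.isMonoidMorphism.Build R U^c k k_monoid.
Let cent (c : R) (b : U^c) : k c * b = b * k c.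
Proof.
(* a product in U^c is the product of U in the opposite order *)
rewrite -[LHS]/((b : U) * c%:A) -[RHS]/(c%:A * (b : U)).
by rewrite mulr_algl mulr_algr.
Qed.
Let f (x : L) : U^c := - inU x.
Let f_lin c x y : f (c *: x + y) = k c * f x + f y.
Proof.
rewrite -[k c * f x]/((- inU x : U) * c%:A) mulr_algr.
by rewrite /f linearP opprD scalerN.
Qed.
Let f_br x y : f (br x y) = f x * f y - f y * f x.
Proof.
rewrite -[f x * f y]/((- inU y : U) * - inU x) -[f y * f x]/((- inU x : U) * - inU y).
by rewrite !mulrNN /f uenv_inB opprB.
Qed.

Lemma uenv_antipode_linear : linear S.
Proof.
move=> c x y; rewrite [LHS](uenv_evalD cent f_lin f_br) (uenv_evalZ cent f_lin f_br).
by rewrite -[k c * _]/((S x : U) * c%:A) mulr_algr.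
Qed.
HB.instance Definition _ :=
  GRing.isLinear.Build R U U *:%R S uenv_antipode_linear.

Lemma uenv_antipode1 : S 1 = 1.
Proof. exact: (uenv_eval1 cent f_lin f_br). Qed.
Lemma uenv_antipodeM x y : S (x * y) = S y * S x.
Proof. exact: (uenv_evalM cent f_lin f_br). Qed.
Lemma uenv_antipode_in x : S (inU x) = - inU x.
Proof. exact: (uenv_eval_in cent f_lin f_br). Qed.
End Antipode.

End UenvHopfTheory.

(** The maps eps (x) id and id (x) eps. *)
Section AugMap.
Variables (R : comNzRingType) (A B : augAlgType R).

Definition augl : tensor A B -> B := tens_lift (fun (a : A) (b : B) => aug a *: b).
Definition augr : tensor A B -> A := tens_lift (fun (a : A) (b : B) => aug b *: a).

Let l1 (b : B) : linear (fun a : A => aug a *: b).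
Proof. by move=> c x y; rewrite linearP /= scalerDl scalerA. Qed.
Let l2 (a : A) : linear (fun b : B => aug a *: b).
Proof. by move=> c x y; rewrite scalerDr !scalerA mulrC. Qed.
Let r1 (b : B) : linear (fun a : A => aug b *: a).
Proof. by move=> c x y; rewrite scalerDr !scalerA mulrC. Qed.
Let r2 (a : A) : linear (fun b : B => aug b *: a).
Proof. by move=> c x y; rewrite linearP /= scalerDl scalerA. Qed.

Fact augl_linear : linear augl. Proof. exact: (tens_lift_linear l1 l2). Qed.
Fact augr_linear : linear augr. Proof. exact: (tens_lift_linear r1 r2). Qed.
HB.instance Definition _ := GRing.isLinear.Build R _ _ *:%R augl augl_linear.
HB.instance Definition _ := GRing.isLinear.Build R _ _ *:%R augr augr_linear.

Lemma auglE a b : augl (tens a b) = aug a *: b.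
Proof. exact: (tens_liftE l1 l2). Qed.
Lemma augrE a b : augr (tens a b) = aug b *: a.
Proof. exact: (tens_liftE r1 r2). Qed.

Fact augl_monoid : monoid_morphism augl.
Proof.
split; first by rewrite -tens1 auglE rmorph1 scale1r.
apply: tens_linear_mul => a b a' b' /=.
by rewrite !auglE rmorphM -scalerAl -scalerAr scalerA.
Qed.
Fact augr_monoid : monoid_morphism augr.
Proof.
split; first by rewrite -tens1 augrE rmorph1 scale1r.
apply: tens_linear_mul => a b a' b' /=.
by rewrite !augrE rmorphM -scalerAl -scalerAr scalerA.
Qed.
HB.instance Definition _ := GRing.isMonoidMorphism.Build _ _ augl augl_monoid.
HB.instance Definition _ := GRing.isMonoidMorphism.Build _ _ augr augr_monoid.

End AugMap.

(** The algebra A (x) A acts on A on the left by (a (x) b) v = a v S(b) and on the right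
    by v (a (x) b) = S(a) v b.  The antipode axioms express the value at v = 1 of the
    action of a coproduct, and the associativity of these actions is what makes them
    survive a twist of the coproduct. *)
Section AntipodeActions.
Variables (R : comNzRingType) (U : augAlgType R) (S : {linear U -> U}).
Local Notation T := (tensor U U).
Hypotheses (S1 : S 1 = 1) (SM : forall x y, S (x * y) = S y * S x).

Definition lact (x : T) (v : U) : U :=
  tens_lift (fun a b : U => a * v * S b) x.
Definition ract (v : U) (x : T) : U :=
  tens_lift (fun a b : U => S a * v * b) x.

Let lact1 v (b : U) : linear (fun a : U => a * v * S b).
Proof. by move=> c x y; rewrite !mulrDl -!scalerAl. Qed.
Let lact2 v (a : U) : linear (fun b : U => a * v * S b).
Proof. by move=> c x y; rewrite linearP mulrDr -scalerAr. Qed.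
Let ract1 v (b : U) : linear (fun a : U => S a * v * b).
Proof. by move=> c x y; rewrite linearP !mulrDl -!scalerAl. Qed.
Let ract2 v (a : U) : linear (fun b : U => S a * v * b).
Proof. by move=> c x y; rewrite mulrDr -scalerAr. Qed.

Lemma lactE a b v : lact (tens a b) v = a * v * S b.
Proof. exact: (tens_liftE (lact1 v) (lact2 v)). Qed.
Lemma ractE a b v : ract v (tens a b) = S a * v * b.
Proof. exact: (tens_liftE (ract1 v) (ract2 v)). Qed.

Lemma lact_linearl v : linear (lact^~ v).
Proof. exact: (tens_lift_linear (lact1 v) (lact2 v)). Qed.
Lemma ract_linearr v : linear (ract v).
Proof. exact: (tens_lift_linear (ract1 v) (ract2 v)). Qed.

Lemma lactDl v : {morph lact^~ v : x y / x + y}.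
Proof. by move=> x y; have := lact_linearl v 1 x y; rewrite !scale1r. Qed.
Lemma lact0l v : lact 0 v = 0.
Proof. by apply: (addrI (lact 0 v)); rewrite -lactDl !addr0. Qed.
Lemma ractDr v : {morph ract v : x y / x + y}.
Proof. by move=> x y; have := ract_linearr v 1 x y; rewrite !scale1r. Qed.
Lemma ract0r v : ract v 0 = 0.
Proof. by apply: (addrI (ract v 0)); rewrite -ractDr !addr0. Qed.

Lemma lact_linearr x : linear (lact x).
Proof.
move=> c v w; elim/tensor_ind: x => [|a b x IH]; first by rewrite !lact0l scaler0 addr0.
rewrite !lactDl !lactE IH scalerDr addrACA; congr (_ + _).
by rewrite mulrDr mulrDl -scalerAr -scalerAl.
Qed.
Lemma ract_linearl x : linear (ract^~ x).
Proof.
move=> c v w; elim/tensor_ind: x => [|a b x IH]; first by rewrite !ract0r scaler0 addr0.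
rewrite !ractDr !ractE IH scalerDr addrACA; congr (_ + _).
by rewrite mulrDr mulrDl -scalerAr -scalerAl.
Qed.

Lemma lactDr x : {morph lact x : v w / v + w}.
Proof. by move=> v w; have := lact_linearr x 1 v w; rewrite !scale1r. Qed.
Lemma lact0r x : lact x 0 = 0.
Proof. by apply: (addrI (lact x 0)); rewrite -lactDr !addr0. Qed.
Lemma ractDl x : {morph ract^~ x : v w / v + w}.
Proof. by move=> v w; have := ract_linearl x 1 v w; rewrite !scale1r. Qed.
Lemma ract0l x : ract 0 x = 0.
Proof. by apply: (addrI (ract 0 x)); rewrite -ractDl !addr0. Qed.
Lemma lactZr c x v : lact x (c *: v) = c *: lact x v.
Proof. by have := lact_linearr x c v 0; rewrite lact0r !addr0. Qed.
Lemma ractZl c x v : ract (c *: v) x = c *: ract v x.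
Proof. by have := ract_linearl x c v 0; rewrite ract0l !addr0. Qed.

Lemma lactM x y v : lact (x * y) v = lact x (lact y v).
Proof.
elim/tensor_ind: x => [|a b x IH]; first by rewrite mul0r !lact0l.
rewrite mulrDl !lactDl IH; congr (_ + _) => {x IH}.
elim/tensor_ind: y => [|a' b' y IH]; first by rewrite mulr0 !lact0l lact0r.
rewrite mulrDr !lactDl lactDr IH; congr (_ + _).
by rewrite tensM !lactE SM !mulrA.
Qed.
Lemma ractM x y v : ract v (x * y) = ract (ract v x) y.
Proof.
elim/tensor_ind: x => [|a b x IH]; first by rewrite mul0r !ract0r ract0l.
rewrite mulrDl !ractDr ractDl IH; congr (_ + _) => {x IH}.
elim/tensor_ind: y => [|a' b' y IH]; first by rewrite mulr0 !ract0r.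
rewrite mulrDr !ractDr IH; congr (_ + _).
by rewrite tensM !ractE SM !mulrA.
Qed.

Lemma lact1l v : lact 1 v = v.
Proof. by rewrite -tens1 lactE S1 mul1r mulr1. Qed.
Lemma ract1r v : ract v 1 = v.
Proof. by rewrite -tens1 ractE S1 mul1r mulr1. Qed.

End AntipodeActions.

Section UenvHopf.
Variables (R : comNzRingType) (L : lmodType R) (br : L -> L -> L).
Local Notation U := (uenv br).
Local Notation T := (tensor U U).
Local Notation inU := (uenv_in br).
Local Notation D := (@uenv_coprod R L br).
Local Notation S := (@uenv_antipode R L br).
Local Notation ep := (@uenv_counit R L br).

Local Notation DI := (@tmap R U U T U D idfun).
Local Notation ID := (@tmap R U U U T idfun D).

Lemma uenv_coassoc u : @tens_assoc R U U U (DI (D u)) = ID (D u).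
Proof.
apply: (uenv_lrmorphism_ext
  (f := @tens_assoc _ U U U \o (DI \o D)) (g := ID \o D)) => x /=.
rewrite uenv_coprod_in !linearD /= !tmapE /= !rmorph1 uenv_coprod_in.
rewrite tensDl tensDr linearD /= -!tens1 !tens_assocE.
by rewrite addrA.
Qed.

Lemma uenv_counitl u : @augl R U U (D u) = u.
Proof.
apply: (uenv_lrmorphism_ext (f := @augl R U U \o D) (g := idfun)) => x /=.
rewrite uenv_coprod_in linearD /= !auglE rmorph1 scale1r.
by rewrite [aug _]uenv_counit_in scale0r add0r.
Qed.

Lemma uenv_counitr u : @augr R U U (D u) = u.
Proof.
apply: (uenv_lrmorphism_ext (f := @augr R U U \o D) (g := idfun)) => x /=.
rewrite uenv_coprod_in linearD /= !augrE rmorph1 scale1r.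
by rewrite [aug _]uenv_counit_in scale0r addr0.
Qed.

Local Notation S1 := (@uenv_antipode1 R L br).
Local Notation SM := (@uenv_antipodeM R L br).

Lemma uenv_lact_coprod u : lact S (D u) 1 = (ep u)%:A.
Proof.
elim/uenv_ind: u => [c x y Ex Ey||x u Eu].
- by rewrite !linearP /= lact_linearl Ex Ey scalerDl scalerA.
- by rewrite !rmorph1 (lact1l S1) scale1r.
- rewrite !rmorphM (lactM SM) Eu /= uenv_counit_in mul0r scale0r lactZr.
  rewrite uenv_coprod_in lactDl !lactE /= S1 uenv_antipode_in.
  by rewrite !mulr1 mul1r subrr scaler0.
Qed.

Lemma uenv_ract_coprod u : ract S 1 (D u) = (ep u)%:A.
Proof.
elim/uenv_ind: u => [c x y Ex Ey||x u Eu].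
- by rewrite !linearP /= ract_linearr Ex Ey scalerDl scalerA.
- by rewrite !rmorph1 (ract1r S1) scale1r.
- rewrite !rmorphM (ractM SM) /= uenv_counit_in mul0r scale0r uenv_coprod_in ractDr.
  by rewrite !ractE /= S1 uenv_antipode_in !mulr1 mul1r addNr ract0l.
Qed.

End UenvHopf.

(** * Power series *)

Section TensLiftLinear.
Variables (R : comNzRingType) (A B X : lmodType R).

Lemma tens_lift_tens (f : {linear tensor A B -> X}) x :
  tens_lift (fun (a : A) (b : B) => f (tens a b)) x = f x.
Proof.
have l1 b : linear (fun a : A => f (tens a b)).
  by move=> c a a'; rewrite tensDl tensZl linearP.
have l2 a : linear (fun b : B => f (tens a b)).
  by move=> c b b'; rewrite tensDr tensZr linearP.
have LD := tens_lift_linear l1 l2.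
have L0 : tens_lift (fun (a : A) (b : B) => f (tens a b)) 0 = 0.
  apply: (addrI (tens_lift (fun (a : A) (b : B) => f (tens a b)) 0)).
  by have := LD 1 0 0; rewrite !scale1r !addr0 => <-.
elim/tensor_ind: x => [|a b x IH]; first by rewrite L0 linear0.
have := LD 1 (tens a b) x; rewrite !scale1r => ->.
by rewrite IH (tens_liftE l1 l2) linearD.
Qed.

(** When f is the restriction to pure tensors of a linear map N with values in series, its
    continuous extension is obtained by applying N to each coefficient. *)
Lemma ctens_lift_tsum (f : A -> B -> fps X) (N : tensor A B -> fps X) w :
    (forall k, linear (N^~ k)) -> (forall a b, f a b = N (tens a b)) ->
  ctens_lift f w = tsum (N \o w).
Proof.
move=> Nlin fN; apply/funext => k; apply: eq_bigr => i _ /=.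
pose g := GRing.isLinear.Build R _ _ _ (N^~ (k - i)%N) (Nlin (k - i)%N).
pose h : {linear tensor A B -> X} := HB.pack (N^~ (k - i)%N) g.
rewrite -[RHS](tens_lift_tens h); congr (tens_lift _ _).
by apply/funext => a; apply/funext => b; rewrite fN.
Qed.

End TensLiftLinear.

Section TsumCauchy.
Variables (V W X : zmodType) (op : V -> W -> X).
Hypotheses (op0l : forall w, op 0 w = 0) (op0r : forall v, op v 0 = 0).
Hypotheses (opDl : forall w, {morph op^~ w : a b / a + b}).
Hypotheses (opDr : forall v, {morph op v : a b / a + b}).

Lemma cauchy_tsumr v a : cauchy op v (tsum a) = tsum (fun l => cauchy op v (a l)).
Proof.
apply/funext => k; rewrite cauchy.unlock /tsum.
pose T i l m := op (v i) (a l m).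
transitivity (\sum_(i < k.+1) \sum_(l < (k - i).+1) T i l (k - i - l)%N).
  by apply: eq_bigr => i _; rewrite (big_morph (op (v i)) (opDr _) (op0r _)).
rewrite -triangle_sum -(triangle_sum (fun l i => T i l)).
apply: eq_bigr => i _; rewrite (reindex_inj rev_ord_inj); apply: eq_bigr => j _ /=.
by rewrite subSS subKn // -ltnS.
Qed.

Lemma cauchy_tsuml a w : cauchy op (tsum a) w = tsum (fun l => cauchy op (a l) w).
Proof.
apply/funext => k; rewrite cauchy.unlock /tsum.
rewrite -(triangle_sum (fun l p q => op (a l p) (w q))).
by apply: eq_bigr => i _; rewrite (big_morph (op^~ (w _)) (opDl _) (op0l _)).
Qed.

End TsumCauchy.

Definition fps_map (V W : Type) (f : V -> W) (u : fps V) : fps W := fun k => f (u k).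

Section FpsBasics.

Lemma tsum_const (V : zmodType) (u : fps V) : tsum (fun i => fps_const (u i)) = u.
Proof.
apply/funext => k; rewrite /tsum big_ord_recr /= subnn big1 ?add0r // => i _.
by rewrite /fps_const subn_eq0 leqNgt ltn_ord.
Qed.

Lemma map_fps_const (V W : zmodType) (f : {additive V -> W}) a :
  fps_map f (fps_const a) = fps_const (f a).
Proof. by apply/funext => k; rewrite /fps_map /fps_const; case: eqP; rewrite ?raddf0. Qed.

Lemma map_fpsD (V W : zmodType) (f : {additive V -> W}) (u v : fps V) :
  fps_map f (u + v) = fps_map f u + fps_map f v.
Proof. by apply/funext => k; rewrite /fps_map !fpsDE raddfD. Qed.

Lemma map_fpsZ (R : comNzRingType) (V W : lmodType R) (f : {linear V -> W}) c (u : fps V) :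
  fps_map f (c *: u) = c *: fps_map f u.
Proof.
apply/funext => k; rewrite /fps_map !fpsZE linear_sum.
by apply: eq_bigr => i _; rewrite linearZ.
Qed.

Variables (A B : pzRingType).
Implicit Types (u v w : fps A) (a b : A).

Lemma map_fpsM (f : {rmorphism A -> B}) u v : fps_map f (u * v) = fps_map f u * fps_map f v.
Proof.
apply/funext => k; rewrite /fps_map !fpsME rmorph_sum.
by apply: eq_bigr => i _; rewrite rmorphM.
Qed.

Lemma map_fps1 (f : {rmorphism A -> B}) : fps_map f 1 = 1.
Proof. exact: (etrans (map_fps_const f 1) (congr1 (@fps_const B) (rmorph1 f))). Qed.

Lemma fps1E k : (1 : fps A) k = if k == 0%N then 1 else 0.
Proof. by []. Qed.

Lemma fps_constME a u k : (fps_const a * u) k = a * u k.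
Proof. by rewrite [LHS](congr1 (@^~ k) (cauchy_constl _ _ (@mul0r A))). Qed.

Lemma fps_mulconstE u a k : (u * fps_const a) k = u k * a.
Proof. by rewrite [LHS](congr1 (@^~ k) (cauchy_constr _ _ (@mulr0 A))). Qed.

Lemma fps_constM a b : fps_const (a * b) = fps_const a * fps_const b.
Proof.
apply/funext => k; rewrite fps_constME /fps_const.
by case: eqP; rewrite ?mulr0.
Qed.

Lemma mulr_tsumr u (a : nat -> fps A) : u * tsum a = tsum (fun l => u * a l).
Proof. by apply: cauchy_tsumr; [exact: mulr0 | exact: mulrDr]. Qed.

Lemma mulr_tsuml u (a : nat -> fps A) : tsum a * u = tsum (fun l => a l * u).
Proof. by apply: cauchy_tsuml; [exact: mul0r | move=> ? ? ?; exact: mulrDl]. Qed.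

Lemma fps_comm u v : (forall i j, u i * v j = v j * u i) -> u * v = v * u.
Proof.
move=> uv; apply/funext => k; rewrite !fpsME (reindex_inj rev_ord_inj).
apply: eq_bigr => i _ /=; have le_ik : (i <= k)%N by rewrite -ltnS.
by rewrite subSS subKn // uv.
Qed.

Lemma tsum_conj V (f : V -> A) (u : fps V) v w :
  tsum (fun l => v * fps_const (f (u l)) * w) = v * fps_map f u * w.
Proof. by rewrite -[fps_map f u in RHS]tsum_const mulr_tsumr mulr_tsuml. Qed.

End FpsBasics.

Lemma ctensE (R : comNzRingType) (A B : augAlgType R) (u : fps A) (v : fps B) :
  ctens u v = fps_map (tensl B) u * fps_map (tensr A) v.
Proof.
apply/funext => k; rewrite fpsME /ctens cauchy.unlock.
by apply: eq_bigr => i _; rewrite tensE.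
Qed.

Section FpsConj.

Lemma fps_conj_linear (R : comNzRingType) (A : algType R) (B : lmodType R)
    (f : {linear B -> A}) (v w : fps A) : linear (fun u => v * fps_map f u * w).
Proof.
move=> c x y; rewrite map_fpsD map_fpsZ mulrDr mulrDl.
by rewrite scalerAl scalerAr.
Qed.

Lemma fps_conj_monoid (A B : pzRingType) (f : {rmorphism B -> A}) (v w : fps A) :
  v * w = 1 -> w * v = 1 -> monoid_morphism (fun u => v * fps_map f u * w).
Proof.
move=> vw wv; split=> [|x y]; first by rewrite map_fps1 mulr1.
by rewrite map_fpsM !mulrA -[_ * w * v]mulrA wv mulr1.
Qed.

Lemma fps_map_linear_for (R : comNzRingType) (B : lmodType R)
    (f : {linear B -> R^o}) : linear_for ( *%R) (fps_map f : fps B -> fps R).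
Proof. by move=> c x y; rewrite map_fpsD map_fpsZ. Qed.

Lemma fps_map_monoid (A B : pzRingType) (f : {rmorphism B -> A}) :
  monoid_morphism (fps_map f).
Proof. by split=> [|x y]; rewrite ?map_fps1 ?map_fpsM. Qed.

Lemma fps_conj_coef_linear (R : comNzRingType) (A : algType R) (B : lmodType R)
    (f : {linear B -> A}) (v w : fps A) k :
  linear (fun x => (v * fps_const (f x) * w) k).
Proof.
move=> c x y; rewrite !fpsME scaler_sumr -big_split /=; apply: eq_bigr => i _.
by rewrite !fps_mulconstE linearP mulrDr mulrDl -scalerAr -scalerAl.
Qed.

End FpsConj.

(** * Twisting a Hopf algebra *)

Section Twist.
Variables (R : comNzRingType) (U : augAlgType R).
Local Notation T := (tensor U U).
Variables (D : {lrmorphism U -> T}) (S0 : {linear U -> U}).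
Local Notation DI := (@tmap R U U T U D idfun).
Local Notation ID := (@tmap R U U U T idfun D).
Local Notation assoc := (@tens_assoc R U U U).
Local Notation ep := (@aug R U).

Hypothesis coassoc0 : forall u, assoc (DI (D u)) = ID (D u).
Hypothesis counitl0 : forall u, @augl R U U (D u) = u.
Hypothesis counitr0 : forall u, @augr R U U (D u) = u.
Hypotheses (S01 : S0 1 = 1) (S0M : forall x y, S0 (x * y) = S0 y * S0 x).
Hypothesis antipodel0 : forall u, ract S0 1 (D u) = (ep u)%:A.
Hypothesis antipoder0 : forall u, lact S0 (D u) 1 = (ep u)%:A.

Variables F G : fps T.

Definition twist_coprod (u : fps U) : fps T := F * fps_map D u * G.
(** twist_l is Drinfeld's element Q = sum F' S_0(F''), and twist_r, built in the same way
    from G = F^-1 as sum S_0(G') G'', is its inverse. *)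
Definition twist_l : fps U := fun k => lact S0 (F k) 1.
Definition twist_r : fps U := fun k => ract S0 1 (G k).
Definition twist_antipode (u : fps U) : fps U := twist_l * fps_map S0 u * twist_r.
Definition twist_counit : fps U -> fps R := fps_map ep.

Hypotheses (FG : F * G = 1) (GF : G * F = 1).
Hypothesis cocycle :
  fps_map assoc (fps_map (tensl U) F) * fps_map assoc (fps_map DI F)
  = fps_map (tensr U) F * fps_map ID F.
Hypotheses (counitl : fps_map (@augl R U U) F = 1) (counitr : fps_map (@augr R U U) F = 1).
Hypothesis twist_lr : twist_l * twist_r = 1.

Let Delta := twist_coprod.
Let S := twist_antipode.
Let eps := twist_counit.

Lemma twist_coprod_linear : linear Delta.
Proof. exact: fps_conj_linear. Qed.

Lemma twist_coprod_monoid : monoid_morphism Delta.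
Proof. exact: fps_conj_monoid. Qed.

Lemma twist_counit_linear : linear_for *%R eps.
Proof. exact: fps_map_linear_for. Qed.

Lemma twist_counit_monoid : monoid_morphism eps.
Proof. exact: fps_map_monoid. Qed.

Lemma twist_antipode_linear : linear S.
Proof. exact: fps_conj_linear. Qed.

(** Delta (x) id is (Delta_0 (x) id) conjugated by F (x) 1, as G (x) 1 commutes with the
    elements of the third leg. *)
Lemma ctens_map_coprodl w :
  ctens_map Delta id w
  = fps_map (tensl U) F * fps_map DI w * fps_map (tensl U) G.
Proof.
pose N x := fps_map (tensl U) F * fps_const (DI x) * fps_map (tensl U) G.
rewrite -tsum_conj; apply: (ctens_lift_tsum (N := N)) => [k|a b].
  exact: fps_conj_coef_linear.
rewrite ctensE /Delta /twist_coprod !map_fpsM !map_fps_const /N tmapE tensE fps_constM.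
rewrite -!mulrA; congr (_ * (_ * _)); apply: fps_comm => i j.
by rewrite /fps_map /fps_const; case: eqP => _; rewrite ?mulr0 ?mul0r // tensC.
Qed.

Lemma ctens_map_coprodr w :
  ctens_map id Delta w
  = fps_map (tensr U) F * fps_map ID w * fps_map (tensr U) G.
Proof.
pose N x := fps_map (tensr U) F * fps_const (ID x) * fps_map (tensr U) G.
rewrite -tsum_conj; apply: (ctens_lift_tsum (N := N)) => [k|a b].
  exact: fps_conj_coef_linear.
rewrite ctensE /Delta /twist_coprod !map_fpsM !map_fps_const /N tmapE tensE fps_constM.
rewrite !mulrA; congr (_ * _ * _); apply: fps_comm => i j.
by rewrite /fps_map /fps_const; case: eqP => _; rewrite ?mulr0 ?mul0r // tensC.
Qed.

(** Both sides are inverses of the common value of the two sides of the cocycle identity. *)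
Let cocycleV :
  fps_map assoc (fps_map DI G) * fps_map assoc (fps_map (tensl U) G)
  = fps_map ID G * fps_map (tensr U) G.
Proof.
set A' := LHS; set B' := RHS.
have eA : A' * (fps_map assoc (fps_map (tensl U) F) * fps_map assoc (fps_map DI F)) = 1.
  rewrite /A' -mulrA [X in _ * X]mulrA -!map_fpsM GF !map_fps1.
  by rewrite mul1r -!map_fpsM GF !map_fps1.
have eB : (fps_map (tensr U) F * fps_map ID F) * B' = 1.
  rewrite /B' -mulrA [X in _ * X]mulrA -!map_fpsM FG !map_fps1.
  by rewrite mul1r -!map_fpsM FG !map_fps1.
by rewrite -[A']mulr1 -eB -cocycle mulrA eA mul1r.
Qed.

Lemma twist_coassoc u :
  assoc \o ctens_map Delta id (Delta u) = ctens_map id Delta (Delta u).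
Proof.
rewrite ctens_map_coprodl ctens_map_coprodr -[LHS]/(fps_map assoc _) /Delta /twist_coprod.
rewrite !map_fpsM.
have -> : fps_map assoc (fps_map DI (fps_map D u)) = fps_map ID (fps_map D u).
  by apply/funext => k; apply: coassoc0.
by rewrite !mulrA cocycle -!mulrA cocycleV.
Qed.

Let counit_inv (f : {rmorphism T -> U}) : fps_map f F = 1 -> fps_map f G = 1.
Proof. by move=> f1; have := map_fpsM f F G; rewrite FG f1 mul1r map_fps1. Qed.

Lemma twist_counit_l u :
  ctens_lift (fun a b : U => eps (fps_const a) *: fps_const b) (Delta u) = u.
Proof.
rewrite (ctens_lift_tsum (N := fun x => fps_const (@augl R U U x))); first last.
- move=> a b; rewrite /eps /twist_counit map_fps_const auglE.
  by rewrite [LHS]cauchy_constl; [apply: map_fps_const|move=> w; apply: scale0r].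
- move=> k c x y; rewrite /fps_const; case: eqP => _; first exact: linearP.
  by rewrite scaler0 addr0.
rewrite [LHS]tsum_const -[LHS]/(fps_map (@augl R U U) (Delta u)).
rewrite /Delta /twist_coprod !map_fpsM counitl (counit_inv counitl) mul1r mulr1.
by apply/funext => k; apply: counitl0.
Qed.

Lemma twist_counit_r u :
  ctens_lift (fun a b : U => eps (fps_const b) *: fps_const a) (Delta u) = u.
Proof.
rewrite (ctens_lift_tsum (N := fun x => fps_const (@augr R U U x))); first last.
- move=> a b; rewrite /eps /twist_counit map_fps_const augrE.
  by rewrite [LHS]cauchy_constl; [apply: map_fps_const|move=> w; apply: scale0r].
- move=> k c x y; rewrite /fps_const; case: eqP => _; first exact: linearP.
  by rewrite scaler0 addr0.
rewrite [LHS]tsum_const -[LHS]/(fps_map (@augr R U U) (Delta u)).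
rewrite /Delta /twist_coprod !map_fpsM counitr (counit_inv counitr) mul1r mulr1.
by apply/funext => k; apply: counitr0.
Qed.

Let rA : fps U -> fps T -> fps U := cauchy (ract S0).
Let lA : fps T -> fps U -> fps U := cauchy (lact S0).

Let rAM v x y : rA v (x * y) = rA (rA v x) y.
Proof.
apply/esym/cauchyA => [y'|y' a b|v'|v' a b|a b c].
- exact: ract0l. - exact: ractDl. - exact: ract0r. - exact: ractDr.
- by rewrite (ractM S0M).
Qed.
Let lAM x y v : lA (x * y) v = lA x (lA y v).
Proof.
apply: cauchyA => [y'|y' a b|v'|v' a b|a b c].
- exact: lact0l. - exact: lactDl. - exact: lact0r. - exact: lactDr.
- by rewrite (lactM S0M).
Qed.

Let rA1 : rA twist_r F = 1.
Proof.
have -> : twist_r = rA 1 G.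
  by rewrite /rA cauchy_constl //; apply: ract0l.
rewrite -rAM GF /rA cauchy_constl; last exact: ract0l.
by apply/funext => k; rewrite /= !fps1E; case: eqP; rewrite ?ract0r ?ract1r.
Qed.

Let lA1 : lA G twist_l = 1.
Proof.
have -> : twist_l = lA F 1.
  by rewrite /lA cauchy_constr //; apply: lact0r.
rewrite -lAM GF /lA cauchy_constr; last exact: lact0r.
by apply/funext => k; rewrite /= !fps1E; case: eqP; rewrite ?lact0l ?lact1l.
Qed.

Let rAD u : rA 1 (fps_map D u) = eps u *: 1.
Proof.
rewrite /rA cauchy_constl; last exact: ract0l.
apply/funext => k; rewrite /= antipodel0 fpsZE big_ord_recr /= subnn.
by rewrite big1 ?add0r // => i _; rewrite fps1E subn_eq0 leqNgt ltn_ord scaler0.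
Qed.

Let lAD u : lA (fps_map D u) 1 = eps u *: 1.
Proof.
rewrite /lA cauchy_constr; last exact: lact0r.
apply/funext => k; rewrite /= antipoder0 fpsZE big_ord_recr /= subnn.
by rewrite big1 ?add0r // => i _; rewrite fps1E subn_eq0 leqNgt ltn_ord scaler0.
Qed.

Let rAZ c v x : rA (c *: v) x = c *: rA v x.
Proof.
apply: cauchyA => [y'|y' a b|v'|v' a b|a b y'].
- exact: ract0l. - exact: ractDl. - exact: scaler0. - exact: scalerDr.
- exact: ractZl.
Qed.

Let lAZ c x v : lA x (c *: v) = c *: lA x v.
Proof.
have E (w : fps U) : c *: w = cauchy (fun (x : U) (r : R) => r *: x) w c.
  apply/funext => k; rewrite fpsZE cauchy.unlock (reindex_inj rev_ord_inj).
  apply: eq_bigr => i _; have le_ik : (i <= k)%N by rewrite -ltnS.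
  by rewrite /= subSS subKn.
rewrite !E; apply/esym/cauchyA => [y'|y' a b|v'|v' a b|a b y'] /=.
- exact: scaler0. - exact: scalerDr. - exact: lact0r. - exact: lactDr.
- by rewrite lactZr.
Qed.

(** With Q' = twist_r = 1 . G acting on the right,
    Q (Q' . F Delta_0(u) G) = Q (1 . G F Delta_0(u) G) = eps(u) Q (1 . G) = eps(u) Q Q'. *)
Lemma twist_antipode_l u :
  ctens_lift (fun a b : U => S (fps_const a) * fps_const b) (Delta u) = (eps u)%:A.
Proof.
pose N x := twist_l * rA twist_r (fps_const x).
rewrite (ctens_lift_tsum (N := N)); first last.
- move=> a b; rewrite /S /twist_antipode map_fps_const /N -!mulrA; congr (_ * _).
  apply/funext => k; rewrite fps_constME fps_mulconstE /rA cauchy_constr; last exact: ract0r.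
  by rewrite /= ractE mulrA.
- move=> k c x y; rewrite /N !fpsME scaler_sumr -big_split /=; apply: eq_bigr => i _.
  rewrite /rA !cauchy_constr; try exact: ract0r.
  by rewrite /= ract_linearr mulrDr -scalerAr.
rewrite -mulr_tsumr -[X in _ * X]cauchy_tsumr; [|exact: ract0r|exact: ractDr].
rewrite [tsum _]tsum_const -/rA /Delta /twist_coprod !rAM rA1 rAD rAZ.
have -> : rA 1 G = twist_r by rewrite /rA cauchy_constl //; apply: ract0l.
by rewrite -scalerAr twist_lr.
Qed.

(** Symmetrically (F Delta_0(u) G . Q) Q' = (F Delta_0(u) G F . 1) Q' = eps(u) Q Q'. *)
Lemma twist_antipode_r u :
  ctens_lift (fun a b : U => fps_const a * S (fps_const b)) (Delta u) = (eps u)%:A.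
Proof.
pose N x := lA (fps_const x) twist_l * twist_r.
rewrite (ctens_lift_tsum (N := N)); first last.
- move=> a b; rewrite /S /twist_antipode map_fps_const /N !mulrA; congr (_ * _).
  apply/funext => k; rewrite fps_mulconstE fps_constME /lA cauchy_constl; last exact: lact0l.
  by rewrite /= lactE.
- move=> k c x y; rewrite /N !fpsME scaler_sumr -big_split /=; apply: eq_bigr => i _.
  rewrite /lA !cauchy_constl; try exact: lact0l.
  by rewrite /= lact_linearl mulrDl -scalerAl.
rewrite -mulr_tsuml -[X in X * _]cauchy_tsuml; [|exact: lact0l|by move=> ? ? ?; exact: lactDl].
rewrite [tsum _]tsum_const -/lA /Delta /twist_coprod !lAM lA1 lAD lAZ.
have -> : lA F 1 = twist_l by rewrite /lA cauchy_constr //; apply: lact0r.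
by rewrite -scalerAl twist_lr.
Qed.

(** Drinfeld's twist: the cocycle identity gives coassociativity, the counit conditions
    give the counit axioms, and the antipode axioms reduce to Q Q' = 1. *)
Theorem twist_hopf : topological_hopf Delta S eps.
Proof.
split.
- exact: twist_coprod_linear.
- exact: twist_coprod_monoid.
- exact: twist_counit_linear.
- exact: twist_counit_monoid.
- exact: twist_antipode_linear.
- exact: twist_coassoc.
- exact: twist_counit_l.
- exact: twist_counit_r.
- exact: twist_antipode_l.
- exact: twist_antipode_r.
Qed.

End Twist.

(** * Differentiation with respect to t *)

Section Char0.
Variables (F : fieldType) (A : algType F).
Hypothesis char0 : [pchar F] =i pred0.

Let nat_neq0 k : k.+1%:R != 0 :> F.
Proof. by rewrite (pcharf0P _).1. Qed.

Lemma mulrn_inj (x y : A) k : x *+ k.+1 = y *+ k.+1 -> x = y.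
Proof.
rewrite -!scaler_nat => E; rewrite -[x]scale1r -[y]scale1r -(mulVf (nat_neq0 k)).
by rewrite -!scalerA E.
Qed.

Lemma scale_factVS k (x : A) : ((k.+1)`!%:R^-1 *: x) *+ k.+1 = (k`!%:R : F)^-1 *: x.
Proof.
rewrite -scaler_nat scalerA factS natrM invfM mulrA.
by rewrite mulfV ?mul1r.
Qed.

Definition fderiv (u : fps A) : fps A := fun k => u k.+1 *+ k.+1.

Lemma fderivE u k : fderiv u k = u k.+1 *+ k.+1. Proof. by []. Qed.

Lemma fderivD u v : fderiv (u + v) = fderiv u + fderiv v.
Proof. by apply/funext => k; rewrite !fderivE mulrnDl. Qed.

Lemma fderivN u : fderiv (- u) = - fderiv u.
Proof. by apply/funext => k; rewrite !fderivE mulNrn. Qed.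

Lemma fderivM u v : fderiv (u * v) = fderiv u * v + u * fderiv v.
Proof.
apply/funext => k; rewrite fpsDE fderivE !fpsME.
transitivity (\sum_(i < k.+2) (u i *+ i * v (k.+1 - i)%N + u i * (v (k.+1 - i)%N *+ (k.+1 - i)))).
  rewrite -sumrMnl; apply: eq_bigr => i _; have le_ik : (i <= k.+1)%N by rewrite -ltnS.
  by rewrite mulrnAl mulrnAr -mulrnDr subnKC.
rewrite big_split /=; congr (_ + _).
  by rewrite big_ord_recl mulr0n mul0r add0r; apply: eq_bigr => i _; rewrite /= subSS.
rewrite big_ord_recr /= subnn mulr0n mulr0 addr0; apply: eq_bigr => i _.
by have le_ik : (i <= k)%N by [rewrite -ltnS]; rewrite fderivE subSn.
Qed.

Lemma fderiv_const a : fderiv (fps_const a) = 0.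
Proof. by apply/funext => k; rewrite fderivE mul0rn. Qed.

Local Notation t := (fps_t : fps A).

Lemma fps_tM0 u : (t * u) 0%N = 0.
Proof. by rewrite fpsME big_ord_recr big_ord0 /= add0r mul0r. Qed.

Lemma fps_tMS u k : (t * u) k.+1 = u k.
Proof.
rewrite fpsME big_ord_recl mul0r add0r big_ord_recl big1 => [|i _].
  by rewrite addr0 /= mul1r subSS subn0.
by rewrite mul0r.
Qed.

Lemma fps_tC u : t * u = u * t.
Proof.
by apply: fps_comm => i j; rewrite /fps_t; case: eqP => _; rewrite ?mul1r ?mulr1 ?mul0r ?mulr0.
Qed.

Lemma fderiv_t : fderiv t = 1.
Proof. by apply/funext => -[|k]; rewrite fderivE ?mul0rn. Qed.

Lemma fps_t_deriv u k : (t * fderiv u) k = u k *+ k.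
Proof. by case: k => [|k]; rewrite ?fps_tM0 ?fps_tMS. Qed.

(** The coefficient of t^k in the equation expresses (k + 1) u_(k+1) in terms of earlier
    coefficients, and k + 1 can be cancelled in characteristic 0. *)
Lemma fps_ode_uniq (p m u v : fps A) :
    p 0%N = 1 -> p * fderiv u = m * u -> p * fderiv v = m * v ->
  u 0%N = v 0%N -> u = v.
Proof.
move=> p0 odeu odev uv0; pose w := u - v.
have odew : p * fderiv w = m * w.
  by rewrite /w fderivD fderivN !mulrDr !mulrN odeu odev.
suff w0 k : w k = 0 by apply/funext => k; have /eqP := w0 k; rewrite subr_eq0 => /eqP.
elim/ltn_ind: k => -[|k] IH; first by rewrite /w fpsDE fpsNE uv0 subrr.
have := congr1 (@^~ k) odew; rewrite !fpsME big_ord_recl p0 mul1r subn0.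
rewrite big1 => [|i _]; last first.
  rewrite fderivE IH ?mul0rn ?mulr0 //= /bump /= add1n ltnS -subSn ?ltn_ord //.
  by rewrite subSS leq_subr.
rewrite big1 => [|i _]; last by rewrite IH ?mulr0 // ltnS leq_subr.
by rewrite addr0 fderivE => E; apply: (@mulrn_inj _ _ k); rewrite E mul0rn.
Qed.

End Char0.

(** * Binomial series with noncentral exponents *)

(** The series (1 - e t)^a, written with the exponent on the left of the base; it deserves
    the name when a and e commute, but it will also be used when they do not. *)
Definition fps_pow (F : fieldType) (A : algType F) (e a : A) : fps A :=
  fun k => (k`!%:R)^-1 *: (\prod_(i < k) (a - i%:R) * (- e) ^+ k).

Section Pow.
Variables (F : fieldType) (A : algType F).
Hypothesis char0 : [pchar F] =i pred0.
Local Notation t := (fps_t : fps A).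
Local Notation "x %:K" := (fps_const x) (at level 2, format "x %:K").
Local Notation "e .-base" := (1 - t * e%:K) (at level 2, format "e .-base").
Implicit Types (e a b x : A).

Lemma fps_pow_coef0 e a : fps_pow e a 0%N = 1.
Proof. by rewrite /fps_pow big_ord0 expr0 mulr1 fact0 invr1 scale1r. Qed.

Lemma fps_pow_coefS e a k :
  fps_pow e a k.+1 *+ k.+1
  = (k`!%:R)^-1 *: (\prod_(i < k) (a - i%:R) * (a - k%:R) * (- e) ^+ k * - e).
Proof. by rewrite scale_factVS // big_ord_recr exprSr /= !mulrA. Qed.

Lemma comm_falling x a k :
  x * a = a * x -> x * \prod_(i < k) (a - i%:R) = \prod_(i < k) (a - i%:R) * x.
Proof.
move=> xa; apply: commr_prod => i _; apply: commrB; first exact: xa.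
exact: commr_nat.
Qed.

Lemma fps_pow_comm e a x :
  x * a = a * x -> x * e = e * x -> x%:K * fps_pow e a = fps_pow e a * x%:K.
Proof.
move=> xa xe; apply/funext => k; rewrite fps_constME fps_mulconstE /fps_pow.
rewrite -scalerAl -scalerAr mulrA comm_falling // -!mulrA; congr (_ *: (_ * _)).
by apply: commrX; apply: commrN.
Qed.

Lemma fps_constD x y : (x + y)%:K = x%:K + y%:K :> fps A.
Proof. by apply/funext => k; rewrite fpsDE /fps_const; case: eqP; rewrite ?addr0. Qed.

Lemma fps_constN x : (- x)%:K = - x%:K :> fps A.
Proof. by apply/funext => k; rewrite fpsNE /fps_const; case: eqP; rewrite ?oppr0. Qed.

Lemma fps_baseE e (u : fps A) k : (e.-base * u) k = u k - (if k is k'.+1 then e * u k' else 0).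
Proof.
rewrite mulrBl mul1r -mulrA fpsDE fpsNE; case: k => [|k].
  by rewrite fps_tM0.
by rewrite fps_tMS fps_constME.
Qed.

(** Euler's equation (1 - e t) u' = - a e u for u = (1 - e t)^a. *)
Lemma fps_pow_ode e a : a * e = e * a ->
  e.-base * fderiv (fps_pow e a) = - (a%:K * e%:K) * fps_pow e a.
Proof.
move=> ae; have powS k : fderiv (fps_pow e a) k = - ((a - k%:R) * e * fps_pow e a k).
  rewrite fderivE fps_pow_coefS /fps_pow -scalerAr -scalerN; congr (_ *: _).
  rewrite mulrN; congr (- _).
  have ne : - e * e = e * - e by rewrite mulrN mulNr.
  have ee : (- e) ^+ k * e = e * (- e) ^+ k by apply/esym/commrX/commrN.
  rewrite -[LHS]mulrA ee -!mulrA; have ake : (a - k%:R) * e = e * (a - k%:R).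
    by apply/esym/commrB; [exact: esym | exact: commr_nat].
  have aka : (a - k%:R) * a = a * (a - k%:R).
    by apply/esym/commrB; [exact: commr_refl | exact: commr_nat].
  rewrite [e * (\prod_(i < k) _ * _)]mulrA comm_falling -?ae // !mulrA.
  by rewrite -comm_falling // -!mulrA.
apply/funext => k; rewrite fps_baseE mulNr fpsNE -fps_constM fps_constME powS.
case: k => [|k]; first by rewrite !subr0.
by rewrite fderivE mulrnAr !mulrBl mulr_natl opprB mulrnAl addrAC subrr add0r.
Qed.

Lemma fps_base0 e : e.-base 0%N = 1 :> A.
Proof. by rewrite -[e.-base]mulr1 fps_baseE subr0. Qed.

Lemma fps_tCK (u v : fps A) : u * (t * v) = t * (u * v).
Proof. by rewrite !mulrA fps_tC. Qed.

Lemma fps_base_comm e (u : fps A) : e%:K * u = u * e%:K -> e.-base * u = u * e.-base.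
Proof. by move=> eu; rewrite mulrBl mulrBr mul1r mulr1 -mulrA eu fps_tCK. Qed.

Lemma fps_constC x y : x * y = y * x -> x%:K * y%:K = y%:K * x%:K :> fps A.
Proof. by rewrite -!fps_constM => ->. Qed.

Lemma fps_pow_expoD e a b : a * e = e * a -> b * e = e * b -> a * b = b * a ->
  fps_pow e (a + b) = fps_pow e a * fps_pow e b.
Proof.
move=> ae be ab; apply: (fps_ode_uniq char0 (p := e.-base)).
- exact: fps_base0.
- by apply: fps_pow_ode; rewrite mulrDl mulrDr ae be.
- have baseC : e.-base * fps_pow e a = fps_pow e a * e.-base.
    by apply/fps_base_comm/fps_pow_comm.
  have bPa : b%:K * fps_pow e a = fps_pow e a * b%:K by apply: fps_pow_comm.
  have ePa : e%:K * fps_pow e a = fps_pow e a * e%:K by apply: fps_pow_comm.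
  rewrite fderivM mulrDr !mulrA fps_pow_ode // baseC -[X in _ + X]mulrA fps_pow_ode //.
  rewrite !mulNr mulrN -opprD fps_constD !mulrDl; congr (- (_ + _)).
  by rewrite !mulrA -bPa -[b%:K * _ * _]mulrA -ePa !mulrA.
- by rewrite fps_pow_coef0 fpsME big_ord_recr big_ord0 /= add0r !fps_pow_coef0 mulr1.
Qed.

Lemma fps_pow_expo0 e : fps_pow e 0 = 1.
Proof.
apply/funext => -[|k]; first exact: fps_pow_coef0.
by rewrite /fps_pow big_ord_recl subrr !mul0r scaler0.
Qed.

End Pow.

(** * The cocycle identity *)

Section Cocycle.
Variables (F : fieldType) (A : algType F).
Hypothesis char0 : [pchar F] =i pred0.
Local Notation t := (fps_t : fps A).
Local Notation "x %:K" := (fps_const x) (at level 2, format "x %:K").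
Local Notation "e .-base" := (1 - t * e%:K) (at level 2, format "e .-base").
Implicit Types (a b e f g h x : A).

Lemma fderiv_base e : fderiv e.-base = - e%:K :> fps A.
Proof.
rewrite fderivD fderivN fderivM fderiv_t fderiv_const mulr0 addr0 mul1r.
by rewrite [fderiv 1](fderiv_const 1) add0r.
Qed.

Lemma weight_exp h e k : h * e = e * h + e ->
  h * (- e) ^+ k = (- e) ^+ k * h + (- e) ^+ k *+ k.
Proof.
move=> he; elim: k => [|k IH]; first by rewrite !expr0 mulr1 mul1r mulr0n addr0.
have hN : h * - e = - e * h + - e by rewrite mulrN he opprD mulNr.
rewrite exprSr mulrA IH mulrDl -[_ * h * _]mulrA hN mulrDr !mulrA -addrA.
by rewrite mulrnAl mulrS.
Qed.

(** As ad h multiplies e by 1, it acts on series in t e as the derivation t d/dt. *)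
Lemma weight_pow h e a : h * e = e * h + e -> h * a = a * h ->
  h%:K * fps_pow e a = fps_pow e a * h%:K + t * fderiv (fps_pow e a).
Proof.
move=> he ha; apply/funext => k.
rewrite fpsDE fps_t_deriv fps_constME fps_mulconstE /fps_pow -scalerAl -scalerAr.
rewrite mulrA comm_falling // -[in LHS]mulrA (weight_exp k he) mulrDr scalerDr !mulrA.
by rewrite mulrnAr scalerMnr.
Qed.

(** Conjugation by (1 - e t)^b multiplies f, which has b-weight 1, by 1 - e t: moving f
    to the left of the series raises its exponent by 1. *)
Lemma pow_weight e f b : b * e = e * b -> f * e = e * f -> b * f = f * b + f ->
  fps_pow e b * f%:K = f%:K * (e.-base * fps_pow e b).
Proof.
move=> be fe bf; have efK : e%:K * f%:K = f%:K * e%:K :> fps A by rewrite fps_constC.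
apply: (fps_ode_uniq char0 (p := e.-base) (m := - (b%:K * e%:K))).
- exact: fps_base0.
- by rewrite fderivM fderiv_const mulr0 addr0 mulrA fps_pow_ode // mulrA.
- rewrite fderivM fderiv_const mul0r add0r mulrA (fps_base_comm efK) -mulrA.
  rewrite [X in _ * (_ * X)]fderivM fderiv_base fps_pow_ode // -mulrDl.
  have -> : - e%:K - b%:K * e%:K = - ((1 + b)%:K * e%:K) :> fps A.
    by rewrite fps_constD mulrDl mul1r opprD.
  rewrite [X in _ * X]mulrA [X in _ * (X * _)]fps_base_comm; last first.
    rewrite mulrN mulNr -!fps_constM; congr (- _%:K).
    by rewrite mulrA; congr (_ * _); rewrite mulrDr mulrDl mulr1 mul1r be.
  rewrite !mulrA; congr (_ * _ * _); rewrite mulrN mulNr -!fps_constM; congr (- _%:K).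
  by rewrite mulrA mulrDr mulr1 addrC -bf -!mulrA fe.
- by rewrite fps_mulconstE fps_constME fps_baseE fps_pow_coef0 subr0 mulr1 mul1r.
Qed.

(** The two sides of the cocycle identity, written R T and P Q, satisfy the same equation
    x y u' = - (y a f + a g + x b g) u, where x = 1 - s f and y = 1 - s g.  Only the rules
    for moving the factors past each other enter, so this is stated in an arbitrary ring,
    dR, ..., dQ standing for the derivatives and s for t. *)
Section CocycleRing.
Variables (B : pzRingType) (s x y a b f g : B).
Hypotheses (xy : x * y = y * x) (xsf : x + s * f = 1).
Hypotheses (sC : forall z, s * z = z * s) (ax : x * a = a * x).

Lemma cocycle_ode_l (R T dR dT : B) :
    x * dR = - (a * f) * R -> y * dT = - ((a + b) * g) * T ->
    b * R = R * b + s * dR -> y * R = R * y -> a * R = R * a -> g * R = R * g ->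
  x * y * (dR * T + R * dT) = - (y * a * f + a * g + x * b * g) * (R * T).
Proof.
move=> odeR odeT bR yR aR gR.
have xRa : x * R * a = a * x * R by rewrite -mulrA -aR mulrA ax.
have xRb : x * R * b = x * b * R + s * (a * f) * R.
  have Rb : R * b = b * R - s * dR by rewrite bR addrK.
  rewrite -mulrA Rb mulrBr [x * (s * dR)]mulrA -sC -[s * x * dR]mulrA odeR.
  by rewrite mulNr mulrN opprK !mulrA.
have aE : a = a * x + s * (a * f).
  rewrite -[LHS]mulr1 -xsf mulrDr; congr (_ + _).
  by rewrite !mulrA -sC.
have xRab : x * R * (a + b) = (a + x * b) * R.
  by rewrite mulrDr xRa xRb addrCA addrC -mulrDl -aE -mulrDl.
have E1 : x * y * (dR * T) = - (y * a * f * (R * T)).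
  by rewrite xy !mulrA -[y * x * dR]mulrA odeR mulNr mulrN mulNr !mulrA.
have E2 : x * y * (R * dT) = - ((a + x * b) * g * (R * T)).
  rewrite mulrA -[x * y * R]mulrA yR [x * (R * y)]mulrA -[x * R * y * dT]mulrA odeT.
  rewrite mulNr mulrN; congr (- _).
  by rewrite !mulrA xRab -[_ * R * g]mulrA -gR !mulrA.
by rewrite mulrDr E1 E2 -opprD -mulrDl [(a + _) * g]mulrDl !mulrA !addrA !mulNr.
Qed.

Lemma cocycle_ode_r (P Q dP dQ : B) :
    y * dP = - (b * g) * P -> (1 - s * (f + g)) * dQ = - (a * (f + g)) * Q ->
    P * (1 - s * (f + g)) = x * y * P -> P * a = a * P -> P * f = f * (y * P) ->
    P * g = g * P -> y * f = f * y -> y * a = a * y ->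
  x * y * (dP * Q + P * dQ) = - (y * a * f + a * g + x * b * g) * (P * Q).
Proof.
move=> odeP odeQ Pz Pa Pf Pg yf ya.
have E1 : x * y * (dP * Q) = - (x * b * g * (P * Q)).
  by rewrite -!mulrA [y * (dP * Q)]mulrA odeP !mulNr mulrN !mulrA.
have E2 : x * y * (P * dQ) = - ((y * a * f + a * g) * (P * Q)).
  rewrite mulrA -Pz -mulrA odeQ mulNr mulrN !mulrA Pa; congr (- _).
  rewrite -[a * P * _]mulrA mulrDr Pf Pg ya -[a * y * f]mulrA yf mulrDr !mulrDl.
  by rewrite !mulrA.
by rewrite mulrDr E1 E2 -opprD addrC -mulrDl mulNr.
Qed.

End CocycleRing.

(** Conjugation by (1 - g t)^b fixes a and g, and turns 1 - (f + g) t into the product of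
    the commuting elements 1 - f t and 1 - g t; take a-th powers. *)
Lemma pow_cocycle a b f g :
    a * b = b * a -> a * f = f * a -> a * g = g * a -> b * g = g * b ->
    f * g = g * f -> b * f = f * b + f ->
  fps_pow f a * fps_pow g (a + b) = fps_pow g b * fps_pow (f + g) a.
Proof.
move=> ab af ag bg fg bf.
have abg : (a + b) * g = g * (a + b) by rewrite mulrDl mulrDr ag bg.
have afg : a * (f + g) = (f + g) * a by rewrite mulrDl mulrDr ag af.
have fgE : (f + g).-base = 1 - t * (f%:K + g%:K) by rewrite fps_constD.
have Kc u v : u * v = v * u -> u%:K * v%:K = v%:K * u%:K :> fps A by exact: fps_constC.
have base_const u v : u * v = v * u -> v.-base * u%:K = u%:K * v.-base.
  by move=> uv; apply: fps_base_comm; apply: Kc.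
have xy : f.-base * g.-base = g.-base * f.-base.
  apply: fps_base_comm; rewrite mulrBr mulrBl mulr1 mul1r fps_tCK -[t * _ * _]mulrA.
  by rewrite (Kc f g).
apply: (fps_ode_uniq char0 (p := f.-base * g.-base)
  (m := - (g.-base * a%:K * f%:K + a%:K * g%:K + f.-base * b%:K * g%:K))).
- by rewrite fps_baseE !fps_base0 subr0.
- rewrite fderivM; apply: (cocycle_ode_l (s := t)) => //.
  + by rewrite subrK.
  + exact: fps_tC.
  + by apply: base_const.
  + exact: fps_pow_ode.
  + by rewrite fps_pow_ode // fps_constD.
  + by apply: weight_pow.
  + by apply/fps_base_comm/fps_pow_comm.
  + exact: fps_pow_comm.
  + exact: fps_pow_comm.
- have Pf : fps_pow g b * f%:K = f%:K * (g.-base * fps_pow g b) by apply: pow_weight.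
  have Pg : fps_pow g b * g%:K = g%:K * fps_pow g b by apply/esym/fps_pow_comm.
  have yf : g.-base * f%:K = f%:K * g.-base by apply: base_const.
  rewrite fderivM; apply: (cocycle_ode_r (s := t)) => //.
  + exact: fps_pow_ode.
  + by rewrite -fgE fps_pow_ode // fps_constD.
  + rewrite mulrBr mulr1 fps_tCK mulrDr Pf Pg mulrDr opprD addrA.
    rewrite -[RHS]mulrA [RHS]mulrBl mul1r [X in _ = X - _]mulrBl mul1r addrAC.
    by rewrite [t * f%:K * _]mulrA !mulrA.
  + by apply/esym/fps_pow_comm.
  + exact: base_const.
- by rewrite !fpsME !big_ord_recl !big_ord0 !fps_pow_coef0.
Qed.

End Cocycle.

(** * Exponentials of h e *)

Section JordanExp.
Variables (F : fieldType) (A : algType F).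
Hypothesis char0 : [pchar F] =i pred0.
Local Notation t := (fps_t : fps A).
Local Notation "x %:K" := (fps_const x) (at level 2, format "x %:K").
Local Notation "e .-base" := (1 - t * e%:K) (at level 2, format "e .-base").
Implicit Types (e h : A) (s : F).

Lemma weight_falling e h k : h * e = e * h + e ->
  e * \prod_(i < k) (h - i%:R) = \prod_(i < k) (h - i.+1%:R) * e.
Proof.
move=> he; elim: k => [|k IH]; first by rewrite !big_ord0 mulr1 mul1r.
rewrite !big_ord_recr /= mulrA IH -!mulrA; congr (_ * _).
rewrite mulrBl he mulrBr -[k.+1%:R]natr1 mulrDl mul1r opprD addrA.
by rewrite mulr_natl mulr_natr addrAC addrK.
Qed.

Lemma weightN e h : h * e = e * h + e -> h * - e = - e * h + - e.
Proof. by move=> he; rewrite mulrN he opprD mulNr. Qed.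

(** When h e = e h + e, the series (1 - e t)^h with h on the left of e is exp(- t h e):
    indeed h (h - 1) ... (h - k + 1) e^k = (h e)^k. *)
Lemma fderiv_pow_r e h : h * e = e * h + e ->
  fderiv (fps_pow e h) = fps_pow e h * (h * - e)%:K.
Proof.
move=> he; apply/funext => k; rewrite fderivE fps_pow_coefS // fps_mulconstE /fps_pow.
rewrite -scalerAl; congr (_ *: _); rewrite -!mulrA; congr (_ * _); rewrite mulrA [RHS]mulrA.
congr (_ * _); rewrite mulrBl weight_exp // mulr_natl -addrA.
by rewrite subrr addr0.
Qed.

Lemma fderiv_pow_l e h : h * e = e * h + e ->
  fderiv (fps_pow e h) = (h * - e)%:K * fps_pow e h.
Proof.
move=> he; apply/funext => k; rewrite fderivE fps_constME /fps_pow -scalerAr.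
rewrite scale_factVS //; congr (_ *: _); rewrite big_ord_recl subr0 exprS !mulrA.
by congr (_ * _); rewrite -!mulrA weight_falling //; apply: weightN.
Qed.

(** The series exp(- t (h - s) e) in the normal order with e on the left of h, since
    ((h - s) e)^k = e^k (h + 1 - s) ... (h + k - s). *)
Definition fps_rpow e h s : fps A :=
  fun k => (k`!%:R)^-1 *: ((- e) ^+ k * rising (1 - s) h k).

Lemma rising_comm h s k x : x * h = h * x -> x * rising s h k = rising s h k * x.
Proof.
move=> xh; apply: commr_prod => i _; apply: commrD; first exact: xh.
by rewrite /GRing.comm mulr_algl mulr_algr.
Qed.

Lemma fderiv_rpow e h s : h * e = e * h + e ->
  fderiv (fps_rpow e h s) = ((h - s%:A) * - e)%:K * fps_rpow e h s.
Proof.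
move=> he; apply/funext => k; rewrite fderivE fps_constME /fps_rpow -scalerAr.
rewrite scale_factVS //; congr (_ *: _).
rewrite /rising big_ord_recr /= -/(rising _ _ _) -rising_comm; last first.
  by rewrite mulrDl mulrDr mulr_algl mulr_algr.
rewrite !mulrA; congr (_ * _); rewrite -[(_ - _) * _ * _]mulrA -exprS.
rewrite mulrBl weight_exp // mulrDr -[RHS]addrA; congr (_ + _).
rewrite mulr_algl mulr_algr -[_ ^+ _ *+ _]scaler_nat -scalerBl; congr (_ *: _).
by rewrite -natr1 addrC addrA.
Qed.

Lemma fps_rpow0 e h : h * e = e * h + e -> fps_rpow e h 0 = fps_pow e h.
Proof.
move=> he; apply: (fps_ode_uniq char0 (p := 1) (m := (h * - e)%:K)) => //.
- by rewrite mul1r fderiv_rpow // scale0r subr0.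
- by rewrite mul1r fderiv_pow_l.
- by rewrite fps_pow_coef0 /fps_rpow /rising big_ord0 expr0 fact0 invr1 mulr1 scale1r.
Qed.

(** Conjugation by exp(t h e) maps e to (1 - e t)^-1 e. *)
Lemma base_pow_weight e h : h * e = e * h + e ->
  e.-base * (fps_pow (- e) h * e%:K) = e%:K * fps_pow (- e) h.
Proof.
move=> he; set Q := fps_pow (- e) h.
have dQ : fderiv Q = (h * e)%:K * Q by rewrite fderiv_pow_l ?opprK //; apply: weightN.
apply: (fps_ode_uniq char0 (p := 1) (m := (e * h)%:K)) => //; rewrite ?mul1r.
- have ehe : e * h = h * e - e by rewrite he addrK.
  have baseC : e.-base * (h * e)%:K = (h * e)%:K * e.-base + t * (e%:K * e%:K).
    rewrite mulrBl mulrBr mul1r mulr1 fps_tCK -mulrA -!fps_constM mulrA ehe.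
    by rewrite mulrBl fps_constD fps_constN mulrBr opprB addrA addrAC.
  set W := Q * e%:K; have dW : fderiv W = (h * e)%:K * W.
    by rewrite fderivM fderiv_const mulr0 addr0 dQ mulrA.
  rewrite fderivM fderiv_base dW [e.-base * (_ * W)]mulrA baseC mulrDl.
  rewrite ehe fps_constD fps_constN mulNr [RHS]mulrBl -[(h * e)%:K * _ * W]mulrA.
  rewrite [e%:K * (e.-base * W)]mulrA [e%:K * e.-base]mulrBr mulr1 fps_tCK.
  by rewrite [(e%:K - _) * W]mulrBl opprB addrCA [- _ + _]addrC.
- by rewrite fderivM fderiv_const mul0r add0r dQ !fps_constM !mulrA.
- by rewrite fps_baseE subr0 fps_mulconstE fps_constME /Q fps_pow_coef0 mul1r mulr1.
Qed.

(** For u = exp(t h e) exp(- t (h - s) e) one gets u' = s exp(t h e) e exp(- t (h - s) e),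
    and moving e to the left with [base_pow_weight] this becomes (1 - e t) u' = s e u, the
    equation of (1 - e t)^(-s). *)
Lemma pow_rpow e h s : h * e = e * h + e ->
  fps_pow (- e) h * fps_rpow e h s = fps_pow e (- s%:A).
Proof.
move=> he; have se : - s%:A * e = e * - s%:A by rewrite mulNr mulrN mulr_algl mulr_algr.
apply: (fps_ode_uniq char0 (p := e.-base) (m := - ((- s%:A)%:K * e%:K))).
- exact: fps_base0.
- rewrite fderivM fderiv_rpow // fderiv_pow_r; last exact: weightN.
  have hse : h * e + (h - s%:A) * - e = s%:A * e.
    by rewrite mulrN mulrBl opprB addrCA subrr addr0.
  have sC (u : fps A) : s%:A%:K * u = u * s%:A%:K.
    by apply/funext => k; rewrite fps_constME fps_mulconstE mulr_algl mulr_algr.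
  rewrite opprK -mulrA -mulrDr -mulrDl -fps_constD hse.
  rewrite fps_constM fps_constN !mulNr opprK !mulrA -[_ * _ * s%:A%:K]sC.
  by rewrite -!mulrA; congr (_ * _); rewrite !mulrA -[_ * _ * e%:K]mulrA base_pow_weight.
- exact: fps_pow_ode.
- rewrite fpsME big_ord1 /= subnn !fps_pow_coef0 mul1r.
  by rewrite /fps_rpow /rising big_ord0 expr0 fact0 invr1 mulr1 scale1r.
Qed.

End JordanExp.

(** * Expansion along iterated brackets with e *)

Section AdExpansion.
Variables (F : fieldType) (A : algType F).
Hypothesis char0 : [pchar F] =i pred0.
Local Notation "x %:K" := (fps_const x) (at level 2, format "x %:K").

Lemma binpowE (e : A) (c : F) : binpow e c = fps_pow e c%:A.
Proof.
apply/funext => k; rewrite /binpow /gbinom /fps_pow mulrC -scalerA; congr (_ *: _).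
have -> : \prod_(i < k) (c%:A - i%:R) = (\prod_(i < k) (c - i%:R))%:A :> A.
  rewrite -[RHS]/(in_alg A _) rmorph_prod.
  by apply: eq_bigr => i _; rewrite /= scalerBl scaler_nat.
by rewrite mulr_algl.
Qed.

Lemma fps_ode_uniq_r (m u v : fps A) :
  fderiv u = u * m -> fderiv v = v * m -> u 0%N = v 0%N -> u = v.
Proof.
move=> odeu odev uv0; apply/funext => k; elim/ltn_ind: k => -[|k] IH //.
apply: (mulrn_inj char0 (k := k)); rewrite -!fderivE odeu odev !fpsME.
by apply: eq_bigr => i _; rewrite IH.
Qed.

Variables (e : A) (X : fps A).
Hypothesis adX : forall l, e * X l = X l * e + X l.+1 *+ l.+1.

(** exp(- t e) *)
Definition fps_expN : fps A := fun k => (k`!%:R)^-1 *: (- e) ^+ k.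

Lemma fderiv_expN : fderiv fps_expN = - (fps_expN * e%:K).
Proof.
apply/funext => k; rewrite fderivE fpsNE fps_mulconstE scale_factVS // /fps_expN.
by rewrite exprSr mulrN scalerN scalerAl.
Qed.

(** As X_l = ad(e)^l X_0 / l!, the series X is exp(t e) X_0 exp(- t e). *)
Lemma ad_expN : (X 0%N)%:K * fps_expN = fps_expN * X.
Proof.
apply: (fps_ode_uniq_r (m := - e%:K)).
- by rewrite fderivM fderiv_const mul0r add0r fderiv_expN !mulrN mulrA.
- have dX : fderiv X = e%:K * X - X * e%:K.
    apply/funext => l; rewrite fderivE fpsDE fpsNE fps_constME fps_mulconstE adX.
    by rewrite addrAC subrr add0r.
  rewrite fderivM fderiv_expN dX mulrBr mulNr mulrN !mulrA addrA addNr.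
  by rewrite add0r.
- by rewrite fps_constME fpsME big_ord1 /fps_expN /= expr0 fact0 invr1 scale1r mulr1 mul1r.
Qed.

Lemma ad_expN_coef k : X 0%N * fps_expN k = \sum_(l < k.+1) fps_expN (k - l)%N * X l.
Proof.
rewrite -fps_constME ad_expN fpsME (reindex_inj rev_ord_inj); apply: eq_bigr => i _ /=.
by have le_ik : (i <= k)%N by [rewrite -ltnS]; rewrite subSS subKn.
Qed.

Lemma falling_split (b : A) k l : (l <= k)%N ->
  \prod_(i < k) (b - i%:R) =
  \prod_(i < l) (b - i%:R) * \prod_(i < k - l) (b - l%:R - i%:R).
Proof.
move=> le_lk; rewrite -(big_mkord xpredT (fun i => b - i%:R)).
rewrite (big_cat_nat _ (n := l)) //= big_mkord; congr (_ * _).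
rewrite -{1}[l]add0n big_addn big_mkord; apply: eq_bigr => i _.
by rewrite natrD opprD addrA addrAC.
Qed.

(** Compare the expansions of X_0 e^k given by [ad_expN], after splitting the falling
    factorial b (b - 1) ... (b - k + 1) at its l-th factor. *)
Lemma ad_pow (b : A) : (forall l, b * X l = X l * b) ->
  (X 0%N)%:K * fps_pow e b =
  tsum (fun l => (\prod_(i < l) (b - i%:R))%:K * fps_pow e (b - l%:R) * (X l)%:K).
Proof.
move=> bX; apply/funext => k; rewrite fps_constME /fps_pow -scalerAr mulrA.
rewrite comm_falling -?bX // -mulrA scalerAr [k`!%:R^-1 *: _]scalerAr.
rewrite -[X in _ * X = _]/(X 0%N * fps_expN k) ad_expN_coef mulr_sumr.
apply: eq_bigr => l _; have le_lk : (l <= k)%N by rewrite -ltnS.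
rewrite fps_mulconstE fps_constME (falling_split _ le_lk) /fps_expN.
by rewrite -!scalerAl -!scalerAr !mulrA -!scalerAl.
Qed.

Variables (h : A) (s : F).
Hypothesis wX : forall l, h * X l = X l * h + (s + l%:R) *: X l.

Lemma rising_split a k l : (l <= k)%N ->
  rising a h k = rising (a + l%:R) h (k - l) * rising a h l :> A.
Proof.
move=> le_lk; rewrite -rising_comm; last exact/esym/rising_comm.
rewrite /rising -(big_mkord xpredT (fun i => h + (a + i%:R)%:A)).
rewrite (big_cat_nat _ (n := l)) //= big_mkord; congr (_ * _).
rewrite -{1}[l]add0n big_addn big_mkord; apply: eq_bigr => i _.
by rewrite natrD addrA addrAC.
Qed.

Lemma rising_weight a k l : X l * rising (a + l%:R) h k = rising (a - s) h k * X l.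
Proof.
rewrite /rising; elim: k => [|k IH]; first by rewrite !big_ord0 mulr1 mul1r.
rewrite !big_ord_recr /= mulrA IH -!mulrA; congr (_ * _).
rewrite mulrDr mulrDl wX mulr_algl mulr_algr -[RHS]addrA -scalerDl; congr (_ + _ *: _).
by rewrite addrACA [s + _]addrC addrA subrK addrAC.
Qed.

(** Here the factors of the rising factorial that remain on the left of X_l have to be
    moved across it, which shifts them by the weight s + l of X_l. *)
Lemma ad_rpow :
  (X 0%N)%:K * fps_rpow e h 0
  = fps_rpow e h s * tsum (fun l => (X l * rising 1 h l)%:K).
Proof.
rewrite tsum_const; apply/funext => k; rewrite fps_constME /fps_rpow subr0.
rewrite scalerAl mulrA -[X in X * _ = _]/(X 0%N * fps_expN k) ad_expN_coef mulr_suml.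
rewrite fpsME [RHS](reindex_inj rev_ord_inj) /=.
apply: eq_bigr => l _; have le_lk : (l <= k)%N by rewrite -ltnS.
rewrite subSS subKn // (rising_split _ le_lk) /fps_expN mulrA -[_ * X l * _]mulrA.
by rewrite rising_weight !mulrA -!scalerAl.
Qed.

End AdExpansion.

(** * The Jordanian twist *)

Section PowMore.
Variables (F : fieldType).
Hypothesis char0 : [pchar F] =i pred0.

Lemma map_fps_pow (A B : algType F) (f : {lrmorphism A -> B}) e a :
  fps_map f (fps_pow e a) = fps_pow (f e) (f a).
Proof.
apply/funext => k; rewrite /fps_map /fps_pow linearZ rmorphM rmorphXn rmorphN.
congr (_ *: (_ * _)); rewrite rmorph_prod; apply: eq_bigr => i _.
by rewrite rmorphB rmorph_nat.
Qed.

Lemma fps_pow_base0 (A : algType F) (a : A) : fps_pow 0 a = 1.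
Proof.
apply/funext => -[|k]; first exact: fps_pow_coef0.
by rewrite /fps_pow oppr0 exprS mul0r mulr0 scaler0.
Qed.

(** An element x of weight s shifts the exponent h by s. *)
Lemma fps_pow_shift (A : algType F) (e h x : A) (s : F) :
    h * x = x * h + s *: x -> x * e = e * x ->
  fps_pow e h * fps_const x = fps_const x * fps_pow e (h + s%:A).
Proof.
move=> hx xe; apply/funext => k; rewrite fps_mulconstE fps_constME /fps_pow.
rewrite -scalerAl -scalerAr; congr (_ *: _).
have -> : \prod_(i < k) (h - i%:R) * (- e) ^+ k * x
  = \prod_(i < k) (h - i%:R) * x * (- e) ^+ k.
  by rewrite -!mulrA; congr (_ * _); apply/esym/commrX/commrN.
rewrite mulrA; congr (_ * _); elim: k => [|k IH]; first by rewrite !big_ord0 mulr1 mul1r.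
rewrite !big_ord_recr /= mulrA -IH -!mulrA; congr (_ * _).
by rewrite mulrBl hx mulrBr mulrDr mulr_algr mulr_natl mulr_natr.
Qed.

End PowMore.

Section JordanTwist.
Variables (F : fieldType).
Hypothesis char0 : [pchar F] =i pred0.
Variable (U : augAlgType F).
Local Notation T := (tensor U U).
Variables (D : {lrmorphism U -> T}) (S0 : {linear U -> U}).
Local Notation DI := (@tmap F U U T U D idfun).
Local Notation ID := (@tmap F U U U T idfun D).
Local Notation assoc := (@tens_assoc F U U U).

Hypotheses (S01 : S0 1 = 1) (S0M : forall x y, S0 (x * y) = S0 y * S0 x).

Variables h e : U.
Hypothesis he : h * e = e * h + e.
Hypotheses (Dh : D h = tensl U h + tensr U h) (De : D e = tensl U e + tensr U e).
Hypotheses (augh : aug h = 0) (auge : aug e = 0).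
Hypotheses (Sh : S0 h = - h) (Se : S0 e = - e).

(** The twist (1 - t (1 (x) e))^(h (x) 1) and its inverse. *)
Definition jtwist : fps T := fps_pow (tensr U e) (tensl U h).
Definition jtwistV : fps T := fps_pow (tensr U e) (- tensl U h).

Let hCe : tensl U h * tensr U e = tensr U e * tensl U h :> T.
Proof. by rewrite tensC. Qed.
Let hNCe : - tensl U h * tensr U e = tensr U e * - tensl U h :> T.
Proof. by rewrite mulNr mulrN hCe. Qed.

Lemma jtwistK : jtwist * jtwistV = 1.
Proof. by rewrite -fps_pow_expoD // ?mulrN ?mulNr // subrr fps_pow_expo0. Qed.
Lemma jtwistVK : jtwistV * jtwist = 1.
Proof. by rewrite -fps_pow_expoD // ?mulrN ?mulNr // addNr fps_pow_expo0. Qed.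

(** The four factors are binomial series because algebra morphisms preserve these; with
    a = h (x) 1 (x) 1, b = 1 (x) h (x) 1, f = 1 (x) e (x) 1 and g = 1 (x) 1 (x) e the identity
    becomes [pow_cocycle]. *)
Lemma jtwist_cocycle :
  fps_map assoc (fps_map (tensl U) jtwist) * fps_map assoc (fps_map DI jtwist)
  = fps_map (tensr U) jtwist * fps_map ID jtwist.
Proof.
rewrite !map_fps_pow /=.
have e12 : DI (tensr U e) = tensr T e by rewrite [LHS]tmapE rmorph1.
have e23 : ID (tensr U e) = tensr U (tensl U e) + tensr U (tensr U e).
  by rewrite [LHS]tmapE /= De -raddfD.
have h12 : DI (tensl U h) = tensl U (tensl U h) + tensl U (tensr U h).
  by rewrite [LHS]tmapE /= Dh -raddfD.
have h23 : ID (tensl U h) = tensl T h by rewrite [LHS]tmapE rmorph1.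
have a1 u : assoc (tensl U (tensl U u)) = tensl T u by rewrite [LHS]tens_assocE.
have a2 u : assoc (tensl U (tensr U u)) = tensr U (tensl U u).
  by rewrite [LHS]tens_assocE.
have a3 u : assoc (tensr T u) = tensr U (tensr U u).
  by rewrite [LHS]tens_assocE.
rewrite e12 e23 h12 h23 linearD /= !a1 !a2 !a3.
have rM (u v : T) : tensr U u * tensr U v = tensr U (u * v) by rewrite rmorphM.
apply: pow_cocycle => //; rewrite ?tensC // !rM; first by congr tensr; rewrite tensC.
  by congr tensr; rewrite tensC.
by rewrite -raddfD; congr tensr; rewrite -!rmorphM he rmorphD.
Qed.

Lemma jtwist_counitl : fps_map (@augl F U U) jtwist = 1.
Proof.
rewrite map_fps_pow /=; have -> : augl (tensl U h) = 0 :> U by rewrite [LHS]auglE augh scale0r.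
exact: fps_pow_expo0.
Qed.
Lemma jtwist_counitr : fps_map (@augr F U U) jtwist = 1.
Proof.
rewrite map_fps_pow /=; have -> : augr (tensr U e) = 0 :> U by rewrite [LHS]augrE auge scale0r.
exact: fps_pow_base0.
Qed.

Let powE (a x : U) k :
  fps_pow (tensr U x) (tensl U a) k
  = tens (\prod_(i < k) (a - i%:R)) ((k`!%:R)^-1 *: (- x) ^+ k) :> T.
Proof.
rewrite tensZr tensE rmorph_prod rmorphXn rmorphN /fps_pow; congr (_ *: (_ * _)).
by apply: eq_bigr => i _; rewrite rmorphB rmorph_nat.
Qed.

Lemma jtwist_l : twist_l S0 jtwist = fps_pow (- e) h.
Proof.
apply/funext => k; rewrite /twist_l /jtwist powE lactE mulr1 linearZ -scalerAr /fps_pow.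
congr (_ *: (_ * _)); rewrite opprK; elim: k => [|k IH]; first by rewrite !expr0 S01.
by rewrite exprS S0M IH linearN Se opprK -exprSr.
Qed.

Lemma jtwist_r : twist_r S0 jtwistV = fps_pow e h.
Proof.
apply/funext => k; rewrite /twist_r /jtwistV -raddfN powE ractE mulr1 -scalerAr /fps_pow.
congr (_ *: (_ * _)); elim: k => [|k IH]; first by rewrite !big_ord0 S01.
rewrite !big_ord_recr /= S0M IH linearB linearN /= Sh opprK.
have -> : S0 k%:R = k%:R by rewrite linearMn S01.
by rewrite comm_falling // mulrBl mulrBr mulr_natl mulr_natr.
Qed.

Lemma jtwist_lr : twist_l S0 jtwist * twist_r S0 jtwistV = 1.
Proof.
rewrite jtwist_l jtwist_r -(fps_rpow0 char0 he) pow_rpow // scale0r oppr0.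
exact: fps_pow_expo0.
Qed.

End JordanTwist.

(** Explicit values of the twisted structure on a primitive element X_0 of weight s with
    X_l = ad(e)^l X_0 / l!. *)
Section JordanFormulas.
Variables (F : fieldType).
Hypothesis char0 : [pchar F] =i pred0.
Variable (U : augAlgType F).
Local Notation T := (tensor U U).
Variables (D : {lrmorphism U -> T}) (S0 : {linear U -> U}).
Hypotheses (S01 : S0 1 = 1) (S0M : forall x y, S0 (x * y) = S0 y * S0 x).
Variables h e : U.
Hypothesis he : h * e = e * h + e.
Hypotheses (Sh : S0 h = - h) (Se : S0 e = - e).

Variables (X : fps U) (s : F).
Hypothesis adX : forall l, e * X l = X l * e + X l.+1 *+ l.+1.
Hypothesis wX : forall l, h * X l = X l * h + (s + l%:R) *: X l.
Hypothesis DX : D (X 0%N) = tensl U (X 0%N) + tensr U (X 0%N).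
Hypothesis SX : S0 (X 0%N) = - X 0%N.

Local Notation JF := (jtwist h e).
Local Notation JG := (jtwistV h e).

Let ellC (x y : U) : tensl U x * tensr U y = tensr U y * tensl U x :> T.
Proof. by rewrite tensC. Qed.

Lemma map_tensr_binpow (c : F) :
  fps_map (tensr U) (binpow e c) = fps_pow (tensr U e) c%:A :> fps T.
Proof.
rewrite binpowE map_fps_pow /=; congr fps_pow.
by rewrite linearZ /= rmorph1.
Qed.

(** Crossing X_0 (x) 1 raises the exponent of F from h (x) 1 to h (x) 1 + s, and only the
    power s survives after multiplication by F^-1. *)
Lemma jtwist_conj_l :
  JF * fps_const (tensl U (X 0%N)) * JG
  = fps_const (tensl U (X 0%N)) * fps_pow (tensr U e) s%:A.
Proof.
rewrite /jtwist (fps_pow_shift (s := s)); last by rewrite ellC.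
  rewrite -mulrA [tensl U h + _]addrC; congr (_ * _).
  have sC (y : T) : s%:A * y = y * s%:A by rewrite mulr_algl mulr_algr.
  rewrite (fps_pow_expoD char0) ?sC // -mulrA -[X in _ * X]/(JF * JG) jtwistK // mulr1.
  by [].
have := wX 0%N; rewrite addr0 => /(congr1 (tensl U)).
by rewrite rmorphM linearD rmorphM linearZ.
Qed.

Lemma falling_opp (A : algType F) (x : A) l :
  \prod_(i < l) (- x - i%:R) = (-1) ^+ l *: rising 0 x l.
Proof.
rewrite /rising; elim: l => [|l IH]; first by rewrite !big_ord0 expr0 scale1r.
rewrite !big_ord_recr /= IH -scalerAl exprS mulN1r scaleNr.
by rewrite add0r scaler_nat -opprD mulrN scalerN.
Qed.

(** F^-1 has exponent - h (x) 1; expanding (1 (x) X_0) F^-1 by [ad_pow] leaves powers with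
    exponents - h (x) 1 - l, of which F cancels the noncentral part. *)
Lemma jtwist_conj_r :
  JF * fps_const (tensr U (X 0%N)) * JG
  = tsum (fun l => ctens (fps_const ((-1) ^+ l *: rising 0 h l))
      (binpow e (- l%:R) * fps_const (X l))).
Proof.
have adrX l : tensr U e * fps_map (tensr U) X l =
    fps_map (tensr U) X l * tensr U e + fps_map (tensr U) X l.+1 *+ l.+1.
  by rewrite -!rmorphM adX rmorphD rmorphMn.
have hX l : - tensl U h * fps_map (tensr U) X l = fps_map (tensr U) X l * - tensl U h.
  by rewrite mulNr mulrN ellC.
rewrite -mulrA (ad_pow char0 adrX hX) mulr_tsumr; congr tsum; apply/funext => l.
have nC (y : T) : - l%:R * y = y * - l%:R by rewrite mulNr mulrN mulr_natl mulr_natr.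
rewrite (fps_pow_expoD char0) ?nC //; last by rewrite mulNr mulrN ellC.
have cF : JF * fps_const (\prod_(i < l) (- tensl U h - i%:R)) =
    fps_const (\prod_(i < l) (- tensl U h - i%:R)) * JF.
  apply/esym/fps_pow_comm; apply/esym/comm_falling; first by rewrite mulrN mulNr.
  by rewrite mulrN mulNr ellC.
rewrite -[fps_pow _ (- tensl U h)]/JG !mulrA cF -[_ * JF * JG]mulrA jtwistK // mulr1.
rewrite ctensE map_fpsM map_tensr_binpow !map_fps_const falling_opp !mulrA.
have -> : (- l%:R : F)%:A = - l%:R :> T by rewrite scaleNr scaler_nat.
congr (fps_const _ * _ * _); rewrite [RHS]linearZ /=; congr (_ *: _).
rewrite /rising rmorph_prod; apply: eq_bigr => i _.
by rewrite rmorphD /= [X in _ = _ + X]linearZ /= rmorph1.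
Qed.

Lemma jtwist_coprodE :
  twist_coprod D JF JG (fps_const (X 0%N))
  = ctens (fps_const (X 0%N)) (binpow e s)
    + tsum (fun l => ctens (fps_const ((-1) ^+ l *: rising 0 h l))
        (binpow e (- l%:R) * fps_const (X l))).
Proof.
rewrite /twist_coprod map_fps_const /= DX fps_constD mulrDr mulrDl.
by rewrite jtwist_conj_l jtwist_conj_r ctensE map_fps_const map_tensr_binpow.
Qed.

Lemma jtwist_antipodeE :
  twist_antipode S0 JF JG (fps_const (X 0%N))
  = - (binpow e (- s) * tsum (fun l => fps_const (X l * rising 1 h l))).
Proof.
rewrite /twist_antipode map_fps_const /= SX jtwist_l // jtwist_r // fps_constN.
rewrite mulrN mulNr -mulrA -(fps_rpow0 char0 he) (ad_rpow char0 adX wX) mulrA.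
by rewrite pow_rpow // binpowE scaleNr.
Qed.

End JordanFormulas.

(** * Reduction modulo t *)

Section Deformation.
Local Open Scope quotient_scope.
Variables (R : comNzRingType) (U : algType R).
Local Notation pi := (\pi_(mod_t U)).

Lemma mod_t_ideal_const0 (z : fps U) :
  Defs.span (two_sided (fun z : fps U => z = fps_t *: 1)) z -> z 0%N = 0.
Proof.
elim=> [//|c x y [a [r [b [-> ->]]]] _ IH].
rewrite fpsDE IH addr0 fpsZE big_ord1 /= !fpsME !big_ord1 /= !fpsME !big_ord1 /= fpsZE big_ord1.
by rewrite scale0r mulr0 mul0r scaler0.
Qed.

Definition mod_t_eval (x : mod_t U) : U := (repr x : fps U) 0%N.

Lemma mod_t_eval_pi (u : fps U) : mod_t_eval (pi u) = u 0%N.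
Proof.
rewrite /mod_t_eval; apply/eqP; rewrite -subr_eq0 -fpsNE -fpsDE; apply/eqP.
exact/mod_t_ideal_const0/qmod_repr.
Qed.

Lemma mod_t_pi_const (u : fps U) : pi (fps_const (u 0%N)) = pi u.
Proof.
apply: qmod_eq; apply: span_gen.
(* w is the quotient of fps_const (u 0) - u by t *)
pose w : fps U := fun k => - u k.+1.
exists 1, (fps_t *: 1), w; split=> //; rewrite mul1r -scalerAl mul1r.
apply/funext => -[|k]; rewrite fpsDE fpsNE fpsZE /fps_const /=.
  by rewrite big_ord1 scale0r subrr.
rewrite big_ord_recl scale0r add0r big_ord_recl big1 => [|i _].
  by rewrite /= scale1r addr0 sub0r subSS subn0.
by rewrite scale0r.
Qed.

Lemma hopf_deformation_const_coef (Delta : fps U -> fps (tensor U U))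
    (S : fps U -> fps U) (eps : fps U -> fps R)
    (Delta0 : U -> tensor U U) (S0 : U -> U) (eps0 : U -> R) :
    (forall u, Delta u 0%N = Delta0 (u 0%N)) -> (forall u, S u 0%N = S0 (u 0%N)) ->
    (forall u, eps u 0%N = eps0 (u 0%N)) ->
  hopf_deformation_of Delta S eps Delta0 S0 eps0.
Proof.
move=> D0 S00 e0; exists mod_t_eval; split.
- exists (fun v => pi (fps_const v)) => [x|v]; last by rewrite mod_t_eval_pi.
  by elim/qalgW: x => u; rewrite mod_t_eval_pi mod_t_pi_const.
- split; first move=> x y; last split=> [|x y].
  + elim/qalgW: x => x; elim/qalgW: y => y.
    by rewrite -[pi x - pi y]/(pi x + - pi y) -qmod_piN -qmod_piD !mod_t_eval_pi.
  + by rewrite -qalg_pi1 mod_t_eval_pi.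
  + elim/qalgW: x => x; elim/qalgW: y => y.
    by rewrite -qalg_piM !mod_t_eval_pi fpsME big_ord1.
- move=> c x; elim/qalgW: x => x.
  by rewrite -qmod_piZ !mod_t_eval_pi fpsZE big_ord1.
- exact: mod_t_eval_pi.
- by move=> u.
Qed.

End Deformation.

(** * The elements x^(alpha + l gamma) (A_l d - B_l d0') *)

Section LinearProp.
Variables (R : nzRingType) (V W : lmodType R) (f : V -> W).
Hypothesis f_lin : linear f.

Let g : {linear V -> W} := HB.pack f (GRing.isLinear.Build R V W _ f f_lin).

Lemma linear_propZ c x : f (c *: x) = c *: f x.
Proof. by rewrite -[f]/(g : V -> W) linearZ. Qed.
Lemma linear_propB x y : f (x - y) = f x - f y.
Proof. by rewrite -[f]/(g : V -> W) linearB. Qed.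

Lemma linear_prop_comb p q x y : f (p *: x - q *: y) = p *: f x - q *: f y.
Proof. by rewrite linear_propB !linear_propZ. Qed.

End LinearProp.

Lemma linear_eigen_comb (R : comNzRingType) (V : lmodType R) (f : V -> V) s p q x y :
  linear f -> f x = s *: x -> f y = s *: y ->
  f (p *: x - q *: y) = s *: (p *: x - q *: y).
Proof.
move=> fl fx fy; rewrite (linear_prop_comb fl) fx fy scalerBr !scalerA.
by rewrite ![s * _]mulrC.
Qed.

(** The shape of the action of ad(e) on the span of x^beta d and x^beta d0', for abstract
    coefficients. *)
Lemma linear_ad_comb (R : comNzRingType) (V : lmodType R) (f : V -> V) (c u v w : R)
    (p q p' q' : R) (x y x' y' : V) k : linear f ->
    f x = c *: (u *: x' - v *: y') -> f y = c *: (u *: y' - w *: y') ->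
    p' *+ k = c * u * p -> q' *+ k = c * (p * v + q * (u - w)) ->
  f (p *: x - q *: y) = (p' *: x' - q' *: y') *+ k.
Proof.
move=> fl fx fy pE qE; rewrite (linear_prop_comb fl) fx fy.
rewrite mulrnBl !scalerMnl pE qE -scalerBl !scalerBr !scalerA -addrA -opprD -scalerDl.
congr (_ *: _ - _ *: _); first by rewrite [RHS]mulrC mulrA.
by rewrite [RHS]mulrDr !mulrA [p * c]mulrC [q * c]mulrC.
Qed.

Section WittRelations.
Variables (F : fieldType) (n : nat).
Local Notation W := (witt F n).
Local Notation mon := (witt_mon F).
Implicit Types a b d : 'rV[int]_n.

Lemma malg_lift_linear_fun (R : comNzRingType) (K : choiceType) (X : lmodType R)
    (f f' : K -> X) c p :
  malg_lift (fun k => c *: f k + f' k) p = c *: malg_lift f p + malg_lift f' p.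
Proof.
rewrite !malg_lift.unlock scaler_sumr -big_split; apply: eq_bigr => k _ /=.
by rewrite scalerDr !scalerA mulrC.
Qed.

Lemma witt_br_linearl (y : W) : linear (fun x => witt_br x y).
Proof. exact: malg_lift_linear. Qed.

Lemma witt_br_linearr (x : W) : linear (witt_br x).
Proof.
move=> c y z; pose f w u : W := malg_lift (@witt_br_basis F n u) w.
rewrite -[LHS]/(malg_lift (f (c *: y + z)) x).
have -> : f (c *: y + z) = fun u => c *: f y u + f z u.
  by apply/funext => u; apply: malg_lift_linear.
exact: malg_lift_linear_fun.
Qed.

Lemma witt_brZl c x y : witt_br (c *: x) y = c *: witt_br x y :> W.
Proof. exact: (linear_propZ (witt_br_linearl y)). Qed.

Lemma witt_brZr c x y : witt_br x (c *: y) = c *: witt_br x y :> W.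
Proof. exact: (linear_propZ (witt_br_linearr x)). Qed.

Lemma wpairDr d a b : wpair d (a + b) = wpair d a + wpair d b.
Proof. by rewrite /wpair -big_split; apply: eq_bigr => i _; rewrite mxE mulrDr. Qed.
Lemma wpairMn d a k : wpair d (a *+ k) = wpair d a *+ k.
Proof. by rewrite /wpair -sumrMnl; apply: eq_bigr => i _; rewrite mulmxnE mulrnAr. Qed.
Lemma wpair0r d : wpair d 0 = 0.
Proof. by rewrite /wpair big1 // => i _; rewrite mxE mulr0. Qed.

Variables d0 d0' g : 'rV[int]_n.
Hypothesis char0 : [pchar F] =i pred0.
Hypothesis d0g : wpair d0 g != 0.
Local Notation c := ((wpair d0 g)%:~R : F).
Local Notation h := (c^-1 *: mon 0 d0).
Local Notation e := (c *: mon g d0').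

Lemma intr_neq0 (z : int) : z != 0 -> z%:~R != 0 :> F.
Proof.
have natr0 := (pcharf0P F).1 char0.
by case: z => k; rewrite ?NegzE ?rmorphN /= ?oppr_eq0 /= -?pmulrn natr0.
Qed.

Lemma witt_h_mon a d : witt_br h (mon a d) = ((wpair d0 a)%:~R / c) *: mon a d.
Proof.
by rewrite witt_brZl witt_br_mon wpair0r scale0r subr0 add0r scalerA mulrC.
Qed.

Lemma witt_he : witt_br h e = e.
Proof. by rewrite witt_brZr witt_h_mon divff ?scale1r // intr_neq0. Qed.

Variables a d : 'rV[int]_n.
Local Notation A l := (coefA F d0 d0' g a l).
Local Notation B l := (Defs.coefB F d0 d0' g a d l).
Local Notation term l := (witt_term F d0 d0' g a d l).

Lemma witt_term0 : term 0 = mon a d.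
Proof.
rewrite /witt_term /coefA /Defs.coefB scale0r subr0 big_ord0 expr0 fact0 mulr1 divr1.
by rewrite scale1r mulr0n addr0.
Qed.

Lemma witt_h_term l : witt_br h (term l) = ((wpair d0 a)%:~R / c + l%:R) *: term l.
Proof.
have <- : (wpair d0 (a + g *+ l))%:~R / c = (wpair d0 a)%:~R / c + l%:R.
  rewrite wpairDr wpairMn rmorphD /= rmorphMn /= mulrDl mulrnAl divff ?intr_neq0 //.
exact: (linear_eigen_comb _ _ (witt_br_linearr h) (witt_h_mon _ _) (witt_h_mon _ _)).
Qed.

Lemma coefAS l : A l.+1 *+ l.+1 = c * (wpair d0' (a + g *+ l))%:~R * A l.
Proof.
have natr0 : l.+1%:R != 0 :> F by rewrite ((pcharf0P F).1 char0).
have fact0 : l`!%:R != 0 :> F.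
  by rewrite ((pcharf0P F).1 char0) -lt0n fact_gt0.
rewrite /coefA -mulr_natr factS natrM big_ord_recr /= exprS.
by field; rewrite fact0 ?natr1 ?nat1r natr0.
Qed.

(** Both A and B obey first-order recurrences; the one for B follows from the one for A
    since B_(l+1) is a multiple of A_l. *)
Lemma coefBS l :
  B l.+1 *+ l.+1
  = c * (A l * (wpair d g)%:~R + B l * ((wpair d0' (a + g *+ l))%:~R - (wpair d0' g)%:~R)).
Proof.
rewrite {1}/Defs.coefB -mulrnAr; case: l => [|l].
  by rewrite mul0r addr0 -mulrA [_ * A 0]mulrC.
have -> : (wpair d0' (a + g *+ l.+1))%:~R - (wpair d0' g)%:~R
  = (wpair d0' (a + g *+ l))%:~R :> F.
  by rewrite mulrS addrCA [wpair d0' (g + _)]wpairDr rmorphD /= addrAC subrr add0r.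
rewrite mulrS coefAS /Defs.coefB; ring.
Qed.

(** Thus witt_term l is ad(e)^l (x^alpha d) / l!. *)
Lemma witt_e_term l : witt_br e (term l) = term l.+1 *+ l.+1.
Proof.
have gE : g + (a + g *+ l) = a + g *+ l.+1 by rewrite addrCA mulrS.
have br_e d1 : witt_br e (mon (a + g *+ l) d1) =
    c *: ((wpair d0' (a + g *+ l))%:~R *: mon (a + g *+ l.+1) d1
          - (wpair d1 g)%:~R *: mon (a + g *+ l.+1) d0').
  by rewrite -gE; apply: etrans (witt_brZl _ _ _) _; congr (_ *: _); apply: witt_br_mon.
exact: (linear_ad_comb (witt_br_linearr e) (br_e d) (br_e d0') (coefAS l) (coefBS l)).
Qed.

End WittRelations.

(** * The action on Laurent polynomials *)

(** The ring of endomorphisms of a vector space of arbitrary dimension. *)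
Section LinearEndomorphisms.
Variables (F : fieldType) (V : lmodType F).

Record linend := LinEnd { linend_fun : V -> V; linend_linear : linear linend_fun }.

HB.instance Definition _ := gen_eqMixin linend.
HB.instance Definition _ := gen_choiceMixin linend.

Implicit Types f g : linend.

Lemma linendP f g : linend_fun f =1 linend_fun g -> f = g.
Proof.
case: f g => [f fl] [g gl] /= /funext E; case: g / E gl => gl.
by congr LinEnd; apply: Prop_irrelevance.
Qed.

Lemma linend_scalar_linear (c : F) : linear (fun v : V => c *: v).
Proof. by move=> d x y; rewrite scalerDr !scalerA mulrC. Qed.
Lemma linend_add_linear f g : linear (fun v => linend_fun f v + linend_fun g v).
Proof. by move=> c x y; rewrite !linend_linear scalerDr addrACA. Qed.
Lemma linend_opp_linear f : linear (fun v => - linend_fun f v).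
Proof. by move=> c x y; rewrite linend_linear opprD scalerN. Qed.
Lemma linend_comp_linear f g : linear (fun v => linend_fun f (linend_fun g v)).
Proof. by move=> c x y; rewrite !linend_linear. Qed.

Definition linend_scalar c := LinEnd (linend_scalar_linear c).
Definition linend_add f g := LinEnd (linend_add_linear f g).
Definition linend_opp f := LinEnd (linend_opp_linear f).
Definition linend_comp f g := LinEnd (linend_comp_linear f g).

Lemma linendD f x y : linend_fun f (x + y) = linend_fun f x + linend_fun f y.
Proof. by have := linend_linear f 1 x y; rewrite !scale1r. Qed.
Lemma linendZ f c x : linend_fun f (c *: x) = c *: linend_fun f x.
Proof. exact: (linear_propZ (linend_linear f)). Qed.

Fact linend_addA : associative linend_add.
Proof. by move=> f g h; apply: linendP => v /=; rewrite addrA. Qed.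
Fact linend_addC : commutative linend_add.
Proof. by move=> f g; apply: linendP => v /=; rewrite addrC. Qed.
Fact linend_add0 : left_id (linend_scalar 0) linend_add.
Proof. by move=> f; apply: linendP => v /=; rewrite scale0r add0r. Qed.
Fact linend_addN : left_inverse (linend_scalar 0) linend_opp linend_add.
Proof. by move=> f; apply: linendP => v /=; rewrite scale0r addNr. Qed.
HB.instance Definition _ :=
  GRing.isZmodule.Build linend linend_addA linend_addC linend_add0 linend_addN.

Fact linend_compA : associative linend_comp.
Proof. by move=> f g h; apply: linendP. Qed.
Fact linend_1comp : left_id (linend_scalar 1) linend_comp.
Proof. by move=> f; apply: linendP => v /=; rewrite scale1r. Qed.
Fact linend_comp1 : right_id (linend_scalar 1) linend_comp.
Proof. by move=> f; apply: linendP => v /=; rewrite scale1r. Qed.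
Fact linend_compDl : left_distributive linend_comp +%R.
Proof. by move=> f g h; apply: linendP. Qed.
Fact linend_compDr : right_distributive linend_comp +%R.
Proof. by move=> f g h; apply: linendP => v /=; rewrite linendD. Qed.
HB.instance Definition _ := GRing.Zmodule_isPzRing.Build linend
  linend_compA linend_1comp linend_comp1 linend_compDl linend_compDr.

Fact linend_scalar_additive : additive linend_scalar.
Proof. by move=> c d; apply: linendP => v /=; rewrite scalerBl. Qed.
Fact linend_scalar_monoid : monoid_morphism linend_scalar.
Proof. by split=> // c d; apply: linendP => v /=; rewrite scalerA. Qed.
HB.instance Definition _ :=
  GRing.isZmodMorphism.Build F linend linend_scalar linend_scalar_additive.
HB.instance Definition _ :=
  GRing.isMonoidMorphism.Build F linend linend_scalar linend_scalar_monoid.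

Lemma linend_scalar_central c f : linend_scalar c * f = f * linend_scalar c.
Proof. by apply: linendP => v /=; rewrite linendZ. Qed.

End LinearEndomorphisms.

Section WittRep.
Variables (F : fieldType) (n : nat).
Local Notation W := (witt F n).
Local Notation V := {malg F['rV[int]_n]}.
Local Notation basis := ('rV[int]_n * 'I_n)%type.

Lemma malg_linearE (K : choiceType) (X : lmodType F) (f : {malg F[K]} -> X) p :
  linear f -> f p = malg_lift (fun k => f << k >>) p.
Proof.
move=> fl; pose f' : {linear {malg F[K]} -> X} := HB.pack f (GRing.isLinear.Build F _ _ _ f fl).
rewrite -[f]/(f' : _ -> _) malg_lift.unlock {1}[p]monalgE linear_sum.
apply: eq_bigr => k _; rewrite -linearZ; congr (f' _).
by apply/malgP => l; rewrite mcoeffZ !mcoeffU mulrnAr mulr1.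
Qed.

Lemma malg_linear_ext (K : choiceType) (X : lmodType F) (f g : {malg F[K]} -> X) :
  linear f -> linear g -> (forall k, f << k >> = g << k >>) -> f =1 g.
Proof.
move=> fl gl fg p; rewrite (malg_linearE p fl) (malg_linearE p gl).
by congr (malg_lift _ _); apply/funext.
Qed.

(** x^a d_i acts as the derivation x^b |-> b_i x^(a + b). *)
Definition witt_act_basis (u : basis) (b : 'rV[int]_n) : V :=
  (b 0 u.2)%:~R *: << u.1 + b >>.

Definition witt_act (p : W) (v : V) : V :=
  malg_lift (fun u => malg_lift (witt_act_basis u) v) p.

Lemma witt_act_linearl v : linear (witt_act^~ v).
Proof. exact: malg_lift_linear. Qed.
Lemma witt_act_linearr p : linear (witt_act p).
Proof.
move=> c y z; pose f w u : V := malg_lift (witt_act_basis u) w.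
rewrite -[LHS]/(malg_lift (f (c *: y + z)) p).
have -> : f (c *: y + z) = fun u => c *: f y u + f z u.
  by apply/funext => u; apply: malg_lift_linear.
exact: malg_lift_linear_fun.
Qed.

Lemma witt_actUU u b : witt_act << u >> << b >> = witt_act_basis u b.
Proof. by rewrite /witt_act !malg_liftU. Qed.

Lemma linear_prop_comp (R : nzRingType) (X Y Z : lmodType R) (f : Y -> Z) (k : X -> Y) :
  linear f -> linear k -> linear (fun x => f (k x)).
Proof. by move=> fl kl c x y; rewrite kl fl. Qed.

Lemma linear_prop_sub (R : nzRingType) (X Y : lmodType R) (f k : X -> Y) :
  linear f -> linear k -> linear (fun x => f x - k x).
Proof.
by move=> fl kl c x y; rewrite kl fl scalerBr opprD addrACA.
Qed.

Lemma malg_scaleE (K : choiceType) (x y : int) (k : K) :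
  x%:~R *: (y%:~R *: << k >>) = (x * y)%:~R *: << k >> :> {malg F[K]}.
Proof. by rewrite scalerA -intrM. Qed.

Lemma malg_trilinear_ext (K1 K2 K3 : choiceType) (X : lmodType F)
    (f g : {malg F[K1]} -> {malg F[K2]} -> {malg F[K3]} -> X) :
    (forall q v, linear (fun p => f p q v)) -> (forall q v, linear (fun p => g p q v)) ->
    (forall p v, linear (fun q => f p q v)) -> (forall p v, linear (fun q => g p q v)) ->
    (forall p q, linear (f p q)) -> (forall p q, linear (g p q)) ->
    (forall k l m, f << k >> << l >> << m >> = g << k >> << l >> << m >>) ->
  forall p q v, f p q v = g p q v.
Proof.
move=> f1 g1 f2 g2 f3 g3 fg p q v; apply: (malg_linear_ext (f3 p q) (g3 p q)) => m.
apply: (malg_linear_ext (f2 p << m >>) (g2 p << m >>)) => l.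
by apply: (malg_linear_ext (f1 << l >> << m >>) (g1 << l >> << m >>)) => k.
Qed.

Lemma scale_int_sub (X : lmodType F) (e : X) (x y x' y' : int) :
  x - y = x' - y' -> x%:~R *: e - y%:~R *: e = x'%:~R *: e - y'%:~R *: e.
Proof. by move=> E; rewrite -[LHS]scalerBl -[RHS]scalerBl -!intrB E. Qed.

Lemma witt_act_basis_br (act : basis -> V -> V) :
    (forall u m, act u << m >> = witt_act_basis u m) ->
    (forall u x v, act u (x *: v) = x *: act u v) ->
  forall (a : 'rV_n) i (b : 'rV_n) j m,
    (b 0 i)%:~R *: act (a + b, j) << m >> - (a 0 j)%:~R *: act (a + b, i) << m >>
    = act (a, i) (act (b, j) << m >>) - act (b, j) (act (a, i) << m >>).
Proof.
move=> actU actZ a i b j m; rewrite !actU /witt_act_basis /= !actZ !actU /witt_act_basis /=.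
rewrite [b + (a + m)]addrCA -addrA !malg_scaleE.
by apply: scale_int_sub; rewrite !mxE; ring.
Qed.

Lemma witt_act_br p q v :
  witt_act (witt_br p q) v = witt_act p (witt_act q v) - witt_act q (witt_act p v).
Proof.
move: p q v; apply: malg_trilinear_ext => [q v|q v|p v|p v|p q|p q|].
- exact: (@linear_prop_comp F W W V (fun r => witt_act r v) (fun r => witt_br r q)
    (@witt_act_linearl _) (@witt_br_linearl F n q)).
- apply: linear_prop_sub; first exact: witt_act_linearl.
  apply: linear_prop_comp; first exact: witt_act_linearr.
  exact: witt_act_linearl.
- exact: (@linear_prop_comp F W W V (fun r => witt_act r v) (witt_br p)
    (@witt_act_linearl _) (@witt_br_linearr F n p)).
- apply: linear_prop_sub; last exact: witt_act_linearl.
  apply: linear_prop_comp; first exact: witt_act_linearr.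
  exact: witt_act_linearl.
- exact: witt_act_linearr.
- by apply: linear_prop_sub; apply: linear_prop_comp; apply: witt_act_linearr.
move=> [a i] [b j] m; rewrite /witt_br !malg_liftU.
apply: etrans (linear_prop_comb (witt_act_linearl _) _ _ _ _) _.
exact: (witt_act_basis_br witt_actUU (fun u => linear_propZ (witt_act_linearr << u >>))).
Qed.

Definition witt_rep (p : W) : linend V := LinEnd (witt_act_linearr p).

Definition witt_ev : uwitt F n -> linend V := uenv_eval (@linend_scalar F V) witt_rep.

Let rep_lin (c : F) (x y : W) :
  witt_rep (c *: x + y) = linend_scalar V c * witt_rep x + witt_rep y.
Proof. by apply: linendP => v; apply: witt_act_linearl. Qed.

Let rep_br (x y : W) :
  witt_rep (witt_br x y) = witt_rep x * witt_rep y - witt_rep y * witt_rep x.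
Proof. by apply: linendP => v; apply: witt_act_br. Qed.

Let scal_central := @linend_scalar_central F V.

Definition witt_coef (b b' : 'rV[int]_n) (u : uwitt F n) : F :=
  (linend_fun (witt_ev u) << b >>)@_b'.

Lemma witt_coef_linear b b' : linear_for *%R (witt_coef b b').
Proof.
move=> c x y; rewrite /witt_coef /witt_ev (uenv_evalD scal_central rep_lin rep_br).
rewrite (uenv_evalZ scal_central rep_lin rep_br).
by rewrite -[linend_fun _ _]/(c *: linend_fun _ _ + linend_fun _ _) mcoeffD mcoeffZ.
Qed.

Lemma witt_act_mon a d b : witt_act (witt_mon F a d) << b >> = (wpair d b)%:~R *: << a + b >>.
Proof.
rewrite /witt_mon; pose g : {linear W -> V} :=
  HB.pack (fun p => witt_act p << b >>) (GRing.isLinear.Build F W V _ _ (witt_act_linearl << b >>)).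
rewrite -[LHS]/(g _) linear_sum /wpair rmorph_sum scaler_suml; apply: eq_bigr => i _.
rewrite linearZ /= -[witt_act _ _]/(witt_act << (a, i) >> << b >>) witt_actUU.
by rewrite malg_scaleE.
Qed.

Lemma witt_coef_mon a d b b' :
  witt_coef b b' (uwitt_in (witt_mon F a d)) = (wpair d b)%:~R * (a + b == b')%:R.
Proof.
rewrite /witt_coef /witt_ev (uenv_eval_in scal_central rep_lin rep_br).
by rewrite -[linend_fun _ _]/(witt_act _ _) witt_act_mon mcoeffZ mcoeffU.
Qed.

End WittRep.

(** * The Jordanian deformation of U(L) *)

Lemma fps_pow_coef1 (F : fieldType) (A : algType F) (e a : A) : fps_pow e a 1%N = - (a * e).
Proof.
rewrite /fps_pow big_ord1 subr0 expr1 mulrN (_ : 1`! = 1%N) //.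
by rewrite invr1 scale1r.
Qed.

(** The coefficient of t in F is - h (x) e, and its commutator with h (x) 1 + 1 (x) h is
    - h (x) [e, h] = h (x) e. *)
Section JordanFirstOrder.
Variables (F : fieldType) (U : augAlgType F).
Local Notation T := (tensor U U).
Variables (D : {lrmorphism U -> T}) (h e : U).
Hypothesis he : h * e = e * h + e.
Hypothesis Dh : D h = tensl U h + tensr U h.

Lemma jtwist_coprod_h1 : twist_coprod D (jtwist h e) (jtwistV h e) (fps_const h) 1%N = tens h e.
Proof.
rewrite /twist_coprod map_fps_const /= Dh.
have F1 : jtwist h e 1%N = - (tensl U h * tensr U e).
  exact: fps_pow_coef1.
have G1 : jtwistV h e 1%N = tensl U h * tensr U e.
  by rewrite /jtwistV fps_pow_coef1 mulNr opprK.
rewrite fpsME 2!big_ord_recl big_ord0 addr0 /= !fps_mulconstE F1 G1.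
rewrite /jtwist /jtwistV !fps_pow_coef0 mul1r mulr1 mulrDl mulNr mulrDr.
rewrite mulrA -(mulrA _ _ (tensl U h)) tensC mulrA.
rewrite mulrA [tensr U h * tensl U h]tensC -!mulrA -!rmorphM opprD addrACA subrr add0r.
by rewrite -mulrBr -rmorphB he addrC addKr tensE.
Qed.

End JordanFirstOrder.

(** The bilinear form f (x) g separates the two tensors. *)
Lemma tens_neq_swap (R : comNzRingType) (A : lmodType R) (f g : A -> R) (a b : A)
    (fb ga : R) :
    linear_for *%R f -> linear_for *%R g ->
    f a = 0 -> f b = fb -> g a = ga -> fb * ga != 0 ->
  tens a b <> tens b a.
Proof.
move=> fl gl fa <- <- /eqP fbga0 E; apply: fbga0; pose k (x y : A) : R^o := f x * g y.
have kl y : linear (k^~ y) by move=> c x z; rewrite /k fl mulrDl -mulrA.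
have kr x : linear (k x) by move=> c y z; rewrite /k gl mulrDr mulrCA.
by rewrite -[LHS](tens_liftE kl kr) -E (tens_liftE kl kr) /k fa mul0r.
Qed.

Lemma tens_swapE (R : comNzRingType) (A B : lmodType R) (a : A) (b : B) :
  tens_swap (tens a b) = tens b a.
Proof.
apply: tens_liftE => [b'|a'] c x y /=.
- by rewrite tensDr tensZr.
- by rewrite tensDl tensZl.
Qed.

Section UenvJordan.
Variables (F : fieldType) (L : lmodType F) (br : L -> L -> L).
Hypothesis char0 : [pchar F] =i pred0.
Local Notation U := (uenv br).
Local Notation T := (tensor U U).
Local Notation D := (@uenv_coprod F L br).
Local Notation S0 := (@uenv_antipode F L br).
Local Notation inU := (uenv_in br).
Variables h e : L.
Hypothesis he : br h e = e.

Local Notation JF := (jtwist (inU h) (inU e)).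
Local Notation JG := (jtwistV (inU h) (inU e)).

Lemma uenv_weight : inU h * inU e = inU e * inU h + inU e.
Proof.
have E := uenv_inB br h e; rewrite he in E.
by rewrite [X in _ = _ + X]E addrC subrK.
Qed.

Definition uenv_jcoprod : fps U -> fps T := twist_coprod D JF JG.
Definition uenv_jantipode : fps U -> fps U := twist_antipode S0 JF JG.
Definition uenv_jcounit : fps U -> fps F := @twist_counit F U.

Lemma uenv_jtwist_hopf : topological_hopf uenv_jcoprod uenv_jantipode uenv_jcounit.
Proof.
have S1 := @uenv_antipode1 F L br; have SM := @uenv_antipodeM F L br.
have Din (x : L) : D (inU x) = tensl U (inU x) + tensr U (inU x).
  exact: uenv_coprod_in.
have augin (x : L) : aug (inU x) = 0 by exact: uenv_counit_in.
have Sin (x : L) : S0 (inU x) = - inU x by exact: uenv_antipode_in.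
apply: twist_hopf.
- exact: uenv_coassoc.
- exact: uenv_counitl.
- exact: uenv_counitr.
- exact: S1.
- exact: SM.
- exact: uenv_ract_coprod.
- exact: uenv_lact_coprod.
- exact: jtwistK.
- exact: jtwistVK.
- exact: (jtwist_cocycle char0 uenv_weight (Din h) (Din e)).
- exact: (jtwist_counitl _ (augin h)).
- exact: (jtwist_counitr _ (augin e)).
- exact: (jtwist_lr char0 S1 SM uenv_weight (Sin h) (Sin e)).
Qed.

Lemma uenv_jdeformation :
  hopf_deformation_of uenv_jcoprod uenv_jantipode uenv_jcounit
    D S0 (@uenv_counit F L br).
Proof.
apply: hopf_deformation_const_coef => // u.
- rewrite /uenv_jcoprod /twist_coprod !fpsME !big_ord1 /= !fpsME !big_ord1 /=.
  by rewrite /jtwist /jtwistV !fps_pow_coef0 mul1r mulr1.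
- rewrite /uenv_jantipode /twist_antipode !fpsME !big_ord1 /= !fpsME !big_ord1 /=.
  rewrite /twist_l /twist_r /jtwist /jtwistV !fps_pow_coef0.
  by rewrite (lact1l (@uenv_antipode1 F L br)) (ract1r (@uenv_antipode1 F L br)) mul1r mulr1.
Qed.

Variables (x : nat -> L) (s : F).
Hypothesis adx : forall l, br e (x l) = x l.+1 *+ l.+1.
Hypothesis wx : forall l, br h (x l) = (s + l%:R) *: x l.

Let X : fps U := fun l => inU (x l).

Let adX l : inU e * X l = X l * inU e + X l.+1 *+ l.+1.
Proof. by rewrite /X -raddfMn -adx /= uenv_inB addrC subrK. Qed.

Let wX l : inU h * X l = X l * inU h + (s + l%:R) *: X l.
Proof. by rewrite /X -linearZ -wx /= uenv_inB addrC subrK. Qed.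

Lemma uenv_jcoprodE :
  uenv_jcoprod (fps_const (inU (x 0%N)))
  = ctens (fps_const (inU (x 0%N))) (binpow (inU e) s)
    + tsum (fun l => ctens (fps_const ((-1) ^+ l *: rising 0 (inU h) l))
        (binpow (inU e) (- l%:R) * fps_const (inU (x l)))).
Proof. exact: (jtwist_coprodE char0 adX wX (uenv_coprod_in br (x 0%N))). Qed.

Lemma uenv_jantipodeE :
  uenv_jantipode (fps_const (inU (x 0%N)))
  = - (binpow (inU e) (- s)
       * tsum (fun l => fps_const (inU (x l) * rising 1 (inU h) l))).
Proof.
apply: (jtwist_antipodeE char0 (@uenv_antipode1 F L br) (@uenv_antipodeM F L br)
  uenv_weight _ _ adX wX); exact: uenv_antipode_in.
Qed.

Lemma uenv_jcoprod_h1 : uenv_jcoprod (fps_const (inU h)) 1%N = tens (inU h) (inU e).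
Proof. exact: (jtwist_coprod_h1 uenv_weight (uenv_coprod_in br h)). Qed.

End UenvJordan.

(** * The deformation of U(W) *)

Section WittNontrivial.
Variables (F : fieldType) (n : nat) (d0 d0' g : 'rV[int]_n).
Hypothesis char0 : [pchar F] =i pred0.
Hypothesis d0g : wpair d0 g != 0.
Local Notation c := ((wpair d0 g)%:~R : F).
Local Notation h := (c^-1 *: witt_mon F 0 d0).
Local Notation e := (c *: witt_mon F g d0').

Let c0 : c != 0. Proof. exact: intr_neq0. Qed.

Lemma witt_coef_scale b b' z (w : witt F n) :
  witt_coef b b' (uwitt_in (z *: w)) = z * witt_coef b b' (uwitt_in w).
Proof.
have -> : uwitt_in (z *: w) = z *: uwitt_in w.
  exact: (linear_propZ (@uenv_in_linear _ _ (@witt_br F n))).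
exact: (@linear_propZ F (uwitt F n) F^o (witt_coef b b') (@witt_coef_linear F n b b')).
Qed.

Lemma witt_coef_scale_mon (b b' : 'rV[int]_n) z (a d : 'rV[int]_n) :
  witt_coef b b' (uwitt_in (z *: witt_mon F a d))
  = z * ((wpair d b)%:~R * (a + b == b')%:R).
Proof. exact: etrans (witt_coef_scale _ _ _ _) (congr1 _ (witt_coef_mon _ _ _ _ _)). Qed.

(** The element m = x^gamma d0 satisfies [h, m] = m, and it acts on x^gamma by the nonzero
    scalar d0(gamma), so that m is not 0 in U(W). *)
Lemma uwitt_noncomm : exists u v : fps (uwitt F n), u * v <> v * u.
Proof.
pose m := witt_mon F g d0.
exists (fps_const (uwitt_in h)), (fps_const (uwitt_in m)) => /(congr1 (@^~ 0%N)).
rewrite !fps_constME => E.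
have : uwitt_in (witt_br h m) = 0.
  by rewrite /uwitt_in uenv_inB; apply/eqP; rewrite subr_eq0; apply/eqP.
rewrite witt_h_mon divff // scale1r => m0.
have := witt_coef_mon F g d0 g (g + g); rewrite -/m m0 eqxx mulr1.
have -> : witt_coef g (g + g) (0 : uwitt F n) = 0.
  have := witt_coef_scale g (g + g) 0 m; rewrite mul0r => <-.
  by rewrite /uwitt_in linearZ /= scale0r.
by move/esym/eqP; apply/negP.
Qed.

Lemma witt_mon_neq0 (d : 'rV[int]_n) : witt_mon F g d <> 0 -> exists b, wpair d b != 0.
Proof.
move=> m0; have [[i di]|d00] := pselect (exists i, d 0 i != 0).
  exists (delta_mx 0 i); rewrite /wpair (bigD1 i) //= big1 => [|j ji].
    by rewrite mxE !eqxx mulr1 addr0.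
  by rewrite mxE (negbTE ji) andbF mulr0.
case: m0; rewrite /witt_mon big1 // => i _.
have -> : d 0 i = 0 by apply/eqP/negPn/negP => di; apply: d00; exists i.
by rewrite scale0r.
Qed.

(** The diagonal coefficient at x^gamma is 1 on h and 0 on e, while e has a nonzero
    coefficient at some x^b with d0'(b) different from 0. *)
Lemma tens_he_swap : e <> 0 ->
  tens (uwitt_in e) (uwitt_in h) <> tens (uwitt_in h) (uwitt_in e).
Proof.
move=> e0; have [b d0'b] : exists b, wpair d0' b != 0.
  by apply: witt_mon_neq0 => m0; apply: e0; rewrite m0 scaler0.
have g0 : (g + g == g) = false.
  apply/negbTE/eqP => gg; move: d0g; have -> : g = 0 by apply: (addrI g); rewrite addr0.
  by rewrite wpair0r eqxx.
have fe := witt_coef_scale_mon g g c g d0'; rewrite g0 !mulr0 in fe.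
have fh := witt_coef_scale_mon g g c^-1 0 d0.
have ge := witt_coef_scale_mon b (g + b) c g d0'.
apply: (tens_neq_swap (@witt_coef_linear F n g g) (@witt_coef_linear F n b (g + b)) fe fh ge).
rewrite add0r !eqxx !mulr1 mulVf // mul1r mulf_neq0 //; exact: intr_neq0.
Qed.

End WittNontrivial.

Theorem theorem2p7 (F : fieldType) (n : nat) (d0 d0' g : 'rV[int]_n) :
  [pchar F] =i pred0 -> (0 < n)%N -> wpair d0 g != 0 ->
  let c : F := (wpair d0 g)%:~R in
  let h : witt F n := c^-1 *: witt_mon F 0 d0 in
  let e : witt F n := c *: witt_mon F g d0' in
  witt_br h e = e /\
  exists (Delta : fps (uwitt F n) -> fps (tensor (uwitt F n) (uwitt F n)))
         (S : fps (uwitt F n) -> fps (uwitt F n))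
         (eps : fps (uwitt F n) -> fps F),
  [/\ topological_hopf Delta S eps,
      exists u v : fps (uwitt F n), u * v <> v * u,
      e <> 0 -> exists u : fps (uwitt F n),
        @tens_swap F (uwitt F n) (uwitt F n) \o Delta u <> Delta u,
      hopf_deformation_of Delta S eps (@uenv_coprod F _ (@witt_br F n))
        (@uenv_antipode F _ (@witt_br F n)) (@uenv_counit F _ (@witt_br F n))
    & forall a d : 'rV[int]_n,
      [/\ Delta (fps_const (uwitt_in (witt_mon F a d))) =
            ctens (fps_const (uwitt_in (witt_mon F a d)))
                  (binpow (uwitt_in e) ((wpair d0 a)%:~R / c))
            + tsum (fun l => ctens
                (fps_const ((-1) ^+ l *: rising 0 (uwitt_in h) l))
                (binpow (uwitt_in e) (- l%:R)
                 * fps_const (uwitt_in (witt_term F d0 d0' g a d l)))),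
          S (fps_const (uwitt_in (witt_mon F a d))) =
            - (binpow (uwitt_in e) (- ((wpair d0 a)%:~R / c))
               * tsum (fun l => fps_const
                   (uwitt_in (witt_term F d0 d0' g a d l)
                    * rising 1 (uwitt_in h) l)))
        & eps (fps_const (uwitt_in (witt_mon F a d))) = 0]].
Proof.
move=> char0 _ d0g c h e; split; first exact: witt_he.
have he : witt_br h e = e by exact: witt_he.
exists (uenv_jcoprod (br := @witt_br F n) h e), (uenv_jantipode (br := @witt_br F n) h e),
  (@uenv_jcounit F _ (@witt_br F n)); split.
- exact: uenv_jtwist_hopf.
- exact: (uwitt_noncomm char0 d0g).
- move=> e0; exists (fps_const (uwitt_in h)) => /(congr1 (@^~ 1%N)) /=.
  rewrite (uenv_jcoprod_h1 he) tens_swapE.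
  exact: (tens_he_swap char0 d0g e0).
- exact: uenv_jdeformation.
- move=> a d; pose x l := witt_term F d0 d0' g a d l.
  have x0 : x 0%N = witt_mon F a d by exact: witt_term0.
  have adx l : witt_br e (x l) = x l.+1 *+ l.+1 by exact: witt_e_term.
  have wx l : witt_br h (x l) = ((wpair d0 a)%:~R / c + l%:R) *: x l.
    exact: witt_h_term.
  rewrite -x0; split.
  + exact: (uenv_jcoprodE char0 adx wx).
  + exact: (uenv_jantipodeE char0 he adx wx).
  + rewrite /uenv_jcounit /twist_counit map_fps_const /=.
    by rewrite [aug _]uenv_counit_in; apply/funext => k; rewrite /fps_const; case: eqP.
Qed.
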